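(* For every odd integer $n\ge 3$ there exist a point $p\in\mathbb{R}^n$ and a complete, nonflat, smooth Riemannian metric $g$ on $\mathbb{R}^n$ with nonnegative sectional curvature, admitting a minimal positive Green function, such that $g$ is Euclidean in a neighborhood of $p$ and, for the normalized minimal positive Green function $G$ of $(\mathbb{R}^n,g)$ with pole $p$ and $b=G^{1/(2-n)}$, $$|\nabla b|^2\in C^{n-3,1}\setminus C^{n-2}$$ near $p$ (that is, the continuous extension of $|\nabla b|^2$ across $p$ is of class $C^{n-3,1}$ in a neighborhood of $p$ but is not of class $C^{n-2}$ in any neighborhood of $p$), while $(\mathbb{R}^n,g)$ is not isometric to Euclidean space.
   Context: $\Delta=\operatorname{div}\nabla$ with respect to $g$, and $r(x)=d(p,x)$. The minimal positive Green function with pole $p$ is normalized by $-\Delta G(p,\cdot)=(n-2)|\mathbb{S}^{n-1}|\,\delta_p$ (distributionally) and $G(p,x)=r(x)^{2-n}(1+o(1))$ as $x\to p$. $C^{k,1}$ denotes functions whose derivatives of order up to $k$ exist and are continuous, with $k$-th derivatives Lipschitz. *)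

(* Defs.v *)
From HB Require Import structures.
From mathcomp Require Import all_boot all_order all_algebra.
From mathcomp Require Import all_classical all_reals all_analysis.

Set Implicit Arguments.
Unset Strict Implicit.
Unset Printing Implicit Defensive.

Import Order.TTheory GRing.Theory Num.Theory.
Import numFieldNormedType.Exports.

Local Open Scope classical_set_scope.
Local Open Scope ring_scope.

(* Points and tangent vectors of R^n are row vectors. *)

Section smoothness.
Context (R : realType) (n : nat).
Implicit Types (U : set 'rV[R]_n) (f : 'rV[R]_n -> R).

Definition pderiv (i : 'I_n) f : 'rV[R]_n -> R := 'D_(delta_mx ord0 i) f.

(* The iterated partial derivative along the list [s] of coordinate indices. *)
Definition pderivs (s : seq 'I_n) f : 'rV[R]_n -> R := foldr pderiv f s.

(* For [U] open. *)
Definition is_Ck (k : nat) U f : Prop :=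
  (forall s i x, (size s < k)%N -> U x ->
     derivable (pderivs s f) x (delta_mx ord0 i)) /\
  (forall s x, (size s <= k)%N -> U x -> {for x, continuous (pderivs s f)}).

Definition is_Ck1 (k : nat) U f : Prop :=
  is_Ck k U f /\
  (forall s, size s = k -> [lipschitz pderivs s f x | x in U]).

Definition smooth U f : Prop := forall k, is_Ck k U f.

Definition test_function f : Prop :=
  smooth setT f /\ compact (closure [set x | f x != 0]).

End smoothness.

Section metric.
Context (R : realType) (n : nat).
Implicit Types (g : 'rV[R]_n -> 'M[R]_n) (x u v w : 'rV[R]_n).

Definition ip g x u v : R := (u *m g x *m v^T) ord0 ord0.

(* [g x i j] is the coefficient g_ij(x) in the standard coordinates. *)
Definition riemannian_metric g : Prop :=
  [/\ forall x, (g x)^T = g x,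
      forall x v, v != 0 -> 0 < ip g x v v
    & forall i j, smooth setT (fun x => g x i j)].

Definition euclidean_metric : 'rV[R]_n -> 'M[R]_n := fun=> 1%:M.

(* Gamma^k_ij *)
Definition christoffel g (k i j : 'I_n) x : R :=
  2^-1 * \sum_l invmx (g x) k l *
    (pderiv i (fun y => g y j l) x + pderiv j (fun y => g y i l) x
     - pderiv l (fun y => g y i j) x).

(* The coefficient of d_l in R(d_i, d_j) d_k, where
   R(X, Y) Z = nabla_X nabla_Y Z - nabla_Y nabla_X Z - nabla_[X, Y] Z. *)
Definition riemann_coef g (l i j k : 'I_n) x : R :=
  pderiv i (christoffel g l j k) x - pderiv j (christoffel g l i k) x
  + \sum_m (christoffel g m j k x * christoffel g l i m x
            - christoffel g m i k x * christoffel g l j m x).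

Definition riemann g x u v w : 'rV[R]_n :=
  \row_l \sum_i \sum_j \sum_k
    riemann_coef g l i j k x * u ord0 i * v ord0 j * w ord0 k.

Definition flat g : Prop := forall x u v w, riemann g x u v w = 0.

Definition sectional g x u v : R :=
  ip g x (riemann g x u v v) u /
  (ip g x u u * ip g x v v - ip g x u v ^+ 2).

Definition nonneg_sectional g : Prop :=
  forall x u v, row_free (col_mx u v) -> 0 <= sectional g x u v.

(* Piecewise C^1 curves are given by the list of their C^1 pieces, each one
   the restriction to [0, 1] of a C^1 map defined on R. *)
Definition C1_curve (c : R -> 'rV[R]_n) : Prop :=
  (forall t, derivable c t 1) /\ continuous (derive1 c).

Fixpoint joins x (s : seq (R -> 'rV[R]_n)) (y : 'rV[R]_n) : Prop :=
  if s is c :: s' then [/\ C1_curve c, c 0 = x & joins (c 1) s' y]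
  else x = y.

Definition curve_length g (c : R -> 'rV[R]_n) : R :=
  \int[lebesgue_measure]_(t in `[0, 1])
    Num.sqrt (ip g (c t) (derive1 c t) (derive1 c t)).

Definition rdist g x y : R :=
  inf [set L | exists s, joins x s y /\ L = \sum_(c <- s) curve_length g c].

Definition complete_metric g : Prop :=
  forall a : nat -> 'rV[R]_n,
    (forall e : R, 0 < e -> exists N, forall i j, (N <= i)%N -> (N <= j)%N ->
       rdist g (a i) (a j) < e) ->
    exists l, rdist g (a i) l @[i --> \oo] --> (0 : R).

Definition isometric g (h : 'rV[R]_n -> 'M[R]_n) : Prop :=
  exists F F' : 'rV[R]_n -> 'rV[R]_n,
    [/\ forall i, smooth setT (fun x => F x ord0 i),
        forall i, smooth setT (fun x => F' x ord0 i),
        cancel F F', cancel F' F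
      & forall x u v, ip h (F x) ('D_u F x) ('D_v F x) = ip g x u v].

Definition gradient g (f : 'rV[R]_n -> R) x : 'rV[R]_n :=
  \row_i \sum_j invmx (g x) i j * pderiv j f x.

Definition normsq_gradient g (f : 'rV[R]_n -> R) x : R :=
  ip g x (gradient g f x) (gradient g f x).

Definition vol_density g x : R := Num.sqrt (\det (g x)).

Definition divergence g (X : 'rV[R]_n -> 'rV[R]_n) x : R :=
  (vol_density g x)^-1 *
  \sum_i pderiv i (fun y => vol_density g y * X y ord0 i) x.

Definition laplacian g (f : 'rV[R]_n -> R) : 'rV[R]_n -> R :=
  divergence g (gradient g f).

End metric.

Arguments euclidean_metric : clear implicits.

(* The sigma-algebra on [n.-tuple R] is the product one, and the measure is
   the n-fold product of the Lebesgue measure of R. *)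

Section lebesgue_step.
Context (R : realType) (n : nat).
Local Notation T := (measurableTypeR R).
Variable mu : {sigma_finite_measure set (n.-tuple T) -> \bar R}.

Let cons_pair (z : T * n.-tuple T) : n.+1.-tuple T := [tuple of z.1 :: z.2].

Definition lebesgue_step : set (n.+1.-tuple T) -> \bar R :=
  pushforward (lebesgue_measure \x mu)%E cons_pair.

Let mcons : measurable_fun setT cons_pair.
Proof. exact: measurable_cons. Qed.

Let step0 : lebesgue_step set0 = 0%E.
Proof. by rewrite /lebesgue_step /pushforward preimage_set0 measure0. Qed.

Let step_ge0 A : (0 <= lebesgue_step A)%E.
Proof. exact: measure_ge0. Qed.

Let step_sigma_additive : semi_sigma_additive lebesgue_step.
Proof.
move=> F mF tF mUF; rewrite /lebesgue_step /pushforward preimage_bigcup.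
apply: measure_semi_sigma_additive.
- by move=> k; rewrite -[X in measurable X]setTI; exact: mcons.
- apply/trivIsetP => /= i j _ _ ij; rewrite -preimage_setI.
  by move/trivIsetP : tF => /(_ _ _ _ _ ij) ->//; rewrite preimage_set0.
- by rewrite -preimage_bigcup -[X in measurable X]setTI; exact: mcons.
Qed.

HB.instance Definition _ := isMeasure.Build _ _ _ lebesgue_step
  step0 step_ge0 step_sigma_additive.

Let step_sigma_finite : sigma_finite setT lebesgue_step.
Proof.
have /sigma_finiteP[A [TA ndA Aoo]] := sigma_finiteT (@lebesgue_measure R).
have /sigma_finiteP[B [TB ndB Boo]] := sigma_finiteT mu.
pose F k := A k `*` B k.
have TF : setT = \bigcup_k F k.
  rewrite -setXTT TA TB predeqE => -[x y]; split.
    move=> [/= [i _ Aix] [k _ Bky]]; exists (maxn i k) => //; split.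
    - by move: x Aix; exact/subsetPset/ndA/leq_maxl.
    - by move: y Bky; exact/subsetPset/ndB/leq_maxr.
  by move=> [k _ []/= ? ?]; split; exists k.
have Foo k : measurable (F k) /\ ((lebesgue_measure \x mu) (F k) < +oo)%E.
  have [? ?] := Aoo k; have [? ?] := Boo k.
  split; first exact: measurableX.
  by rewrite product_measure1E// lte_mul_pinfty// ge0_fin_numE.
pose f (t : n.+1.-tuple T) : T * n.-tuple T := (thead t, [tuple of behead t]).
have fK : cancel f cons_pair by move=> t; rewrite /f /cons_pair -tuple_eta.
have Kf : cancel cons_pair f.
  by move=> [x t]; congr pair; apply: val_inj.
exists (fun k => f @^-1` F k).
  by rewrite -preimage_bigcup -TF preimage_setT.
move=> k; have [mFk Fkoo] := Foo k; split.
  have mf : measurable_fun setT f.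
    apply/measurable_fun_pairP; split; last exact: measurable_behead.
    exact: (measurable_tnth ord0).
  by rewrite -[X in measurable X]setTI; exact: mf.
rewrite /lebesgue_step /pushforward -comp_preimage.
by rewrite (_ : f \o cons_pair = id) ?preimage_id//; exact/funext.
Qed.

HB.instance Definition _ := Measure_isSigmaFinite.Build _ _ _ lebesgue_step
  step_sigma_finite.

End lebesgue_step.

Fixpoint lebesgue_tuple (R : realType) (n : nat) :
    {sigma_finite_measure set (n.-tuple (measurableTypeR R)) -> \bar R} :=
  if n is m.+1 then lebesgue_step (lebesgue_tuple R m)
  else \d_([tuple] : 0.-tuple (measurableTypeR R)).

Definition rv_of_tuple (R : realType) (n : nat)
    (t : n.-tuple (measurableTypeR R)) : 'rV[R]_n := \row_i (tnth t i : R).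

(* The total surface measure of the unit sphere S^(n-1), where the surface
   measure of E is n times the volume of the cone {r w | w in E, 0 <= r <= 1}. *)
Definition sphere_area (R : realType) (n : nat) : R :=
  n%:R * fine (lebesgue_tuple R n
    [set t | \sum_i (rv_of_tuple t ord0 i) ^+ 2 <= 1]).

Section green.
Context (R : realType) (n : nat).
Implicit Types (g : 'rV[R]_n -> 'M[R]_n) (p : 'rV[R]_n) (G : 'rV[R]_n -> R).
Local Notation leb := (lebesgue_tuple R n).

Definition locally_dvol_integrable g G : Prop :=
  forall K : set 'rV[R]_n, compact K ->
    leb.-integrable (@rv_of_tuple R n @^-1` K)
      (fun t => (G (rv_of_tuple t) * vol_density g (rv_of_tuple t))%:E).

(* - Delta G = c delta_p in the sense of distributions. *)
Definition distributional_pole g p (c : R) G : Prop :=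
  locally_dvol_integrable g G /\
  forall f, test_function f ->
    (- (\int[leb]_t (let x := rv_of_tuple t in
                     G x * laplacian g f x * vol_density g x)%:E)
     = (c * f p)%:E)%E.

(* The value [G p] is irrelevant. *)
Definition positive_green g p G : Prop :=
  [/\ forall x, x != p -> 0 < G x,
      smooth [set x | x != p] G,
      distributional_pole g p ((n%:R - 2) * sphere_area R n) G
    & G x / (rdist g p x) ^- (n - 2) @[x --> p^'] --> (1 : R)].

Definition minimal_positive_green g p G : Prop :=
  positive_green g p G /\
  forall H, positive_green g p H -> forall x, x != p -> G x <= H x.

Definition green_b G : 'rV[R]_n -> R := fun x => G x `^ (2 - n%:R)^-1.

Definition is_extension_normsq_grad_b g p G (F : 'rV[R]_n -> R) : Prop :=
  (forall x, x != p -> F x = normsq_gradient g (green_b G) x) /\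
  {for p, continuous F}.

End green.

(* Main.v *)
Require Import Defs.
From mathcomp Require Import all_boot all_order all_algebra.
From mathcomp Require Import all_classical all_reals all_analysis.
From mathcomp Require Import measurable_realfun ring lra.
Set Implicit Arguments.
Unset Strict Implicit.
Unset Printing Implicit Defensive.
Import Order.TTheory GRing.Theory Num.Theory.
Import numFieldNormedType.Exports.
Local Open Scope classical_set_scope.
Local Open Scope ring_scope.

(** Write [m = n - 2], [rho = |x|] and [y = rho ^ 2], and take the pole at the
    origin. The metric is [g = delta + kappa(y) x x^T]: it keeps the spheres
    centred at the origin round and stretches the radial direction by a factor
    [s] with [s ^ 2 = 1 + kappa y]. Its volume density is [s], so a radial
    function [G] is harmonic with the Euclidean flux of [rho ^ -m] as soon as
    [dG / d rho = - m s rho ^ (- m - 1)]. Put [v = 1 - rho ^ -m] and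
    [s = 1 + E'(v)], where [E t = t exp (1 - 1 / t)] for [t > 0] and [E t = 0]
    for [t <= 0]. Then the equation integrates explicitly, and
    [G = rho ^ -m + 1 - E v] tends to [0] at infinity because [E 1 = 1].
    Since [E] is flat at [0], [s = 1] on the unit ball; since [E] is convex, [s]
    increases with [rho], which makes the curvature nonnegative; and
    [1 <= s <= 3], which makes [g] complete.

    On the unit ball [g] is Euclidean and [G = rho ^ -m + 1]. The constant [1] is
    the whole point: it gives [b = rho (1 + rho ^ m) ^ (- 1 / m)] and
    [|grad b| ^ 2 = (1 + rho ^ m) ^ (- 2 (m + 1) / m) = 1 - c rho ^ m + ...]
    with [c <> 0] ([normsq_green_b]). For odd [m] the function [rho ^ m] is of
    class [C ^ (m - 1, 1)] but not [C ^ m], and the remaining terms do not repair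
    this. The positive statement rests on estimates [O (rho ^ (m - |a|))] for the
    derivatives [d^a] of [|grad b| ^ 2 - 1], stable under products and
    compositions ([Sym], [Sym_Ck1]); the negative one on the Taylor expansion at
    [0] along a line through the pole, which for a [C ^ m] function would have
    a leading term of odd degree [m], while the function is even
    ([phi_rho_not_Ck]).

    It remains to see that [G] is the minimal positive Green function. That it
    has the right mass at the pole ([green_pole]) follows from the divergence
    theorem for compactly supported fields alone, without integration over
    spheres: one regularises [rho ^ -m] to [(rho ^ 2 + c ^ 2) ^ (- m / 2)] and
    adds to the obvious field a multiple of [x] times the test function, so that
    the singular term becomes an approximate identity with explicit mass.
    Conversely every positive Green function [H] is harmonic off the pole
    ([green_harmonic]). For every [c > 0] the function
    [(1 + c) H - G + c sqrt G] is a strict supersolution, it is positive near the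
    pole because [H] and [G] have the same asymptotics there, and it is
    nonnegative far away because [G] tends to [0]; by the maximum principle it is
    nonnegative ([barrier_ge0]), and [c -> 0] gives [G <= H] ([Gf_minimal]).

    Finally [g] is not flat, as planes tangent to spheres outside the unit ball
    have positive curvature, and a metric isometric to the Euclidean one is flat
    because the Jacobian of the isometry is parallel ([isometric_flat]). *)

(** * Derivatives along directions and classes of differentiability *)

Section derivation_rules.
Context {R : realType} {V : normedModType R}.
Implicit Types (f g : V -> R) (x v : V).

Lemma isdD f g x v a b : is_derive x v f a -> is_derive x v g b ->
  is_derive x v (fun z => f z + g z) (a + b).
Proof. by move=> fa gb; exact: is_deriveD. Qed.

Lemma isdN f x v a : is_derive x v f a -> is_derive x v (fun z => - f z) (- a).
Proof. by move=> fa; exact: is_deriveN. Qed.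

Lemma isdB f g x v a b : is_derive x v f a -> is_derive x v g b ->
  is_derive x v (fun z => f z - g z) (a - b).
Proof. by move=> fa gb; exact: is_deriveB. Qed.

Lemma isdM f g x v a b : is_derive x v f a -> is_derive x v g b ->
  is_derive x v (fun z => f z * g z) (a * g x + f x * b).
Proof.
move=> fa gb; apply: is_derive_eq (is_deriveM fa gb) _.
by rewrite /GRing.scale /= addrC mulrC; congr (_ + _); rewrite mulrC.
Qed.

Lemma isdC (c : R) x v : is_derive x v (fun=> c) 0.
Proof. exact: is_derive_cst. Qed.

Lemma isdMl (c : R) f x v a : is_derive x v f a ->
  is_derive x v (fun z => c * f z) (c * a).
Proof.
move=> fa; apply: is_derive_eq (isdM (isdC c x v) fa) _.
by rewrite mul0r add0r.
Qed.

Lemma isd_sum (I : Type) (r : seq I) (h : I -> V -> R) x v (dh : I -> R) :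
  (forall i, is_derive x v (h i) (dh i)) ->
  is_derive x v (fun z => \sum_(i <- r) h i z) (\sum_(i <- r) dh i).
Proof.
move=> H; elim: r => [|i r IH].
  rewrite big_nil; under eq_fun do rewrite big_nil; exact: isdC.
rewrite big_cons; under eq_fun do rewrite big_cons.
exact: isdD.
Qed.

(** Reduces a directional derivative to a derivative in one variable. *)
Lemma isd_line_at f x v (s a : R) :
  is_derive (s *: v + x) v f a <->
  is_derive (s : R) 1 (fun t : R => f (t *: v + x)) a.
Proof.
set h := fun t : R => _.
have E : (fun t : R => t^-1 *: (f (t *: v + (s *: v + x)) - f (s *: v + x))) =
    (fun t : R => t^-1 *: (h (t *: (1 : R) + s) - h s)).
  rewrite funeqE => t /=; congr (_ *: (f _ - _)).
  by rewrite addrA -scalerDl [t%:A]mulr1.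
by split=> -[d <-]; split; rewrite /derivable /derive;
  first [rewrite E|rewrite -E].
Qed.

Lemma isd_line f x v a :
  is_derive x v f a <-> is_derive (0 : R) 1 (fun t : R => f (t *: v + x)) a.
Proof. by have := isd_line_at f x v 0 a; rewrite scale0r add0r. Qed.

Lemma isd_comp (phi : R -> R) f x v a b :
  is_derive (f x) 1 phi b -> is_derive x v f a ->
  is_derive x v (fun z => phi (f z)) (b * a).
Proof.
move=> hphi /isd_line hf; apply/isd_line.
apply: (@is_derive1_comp _ phi (fun t : R => f (t *: v + x)) 0).
by move: hphi; rewrite scale0r add0r.
Qed.

Lemma isdX f n x v a : is_derive x v f a ->
  is_derive x v (fun z => f z ^+ n) (n%:R * f x ^+ n.-1 * a).
Proof.
move=> fa.
have : is_derive (f x) 1 (fun t : R => t ^+ n) (n%:R * f x ^+ n.-1).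
  apply: DeriveDef; first exact: exprn_derivable.
  by rewrite exp_derive /GRing.scale /= mulr1.
by move=> H; have := isd_comp H fa.
Qed.

Lemma isdV f x v a : f x != 0 -> is_derive x v f a ->
  is_derive x v (fun z => (f z)^-1) (- (f x) ^- 2 * a).
Proof.
move=> f0 [df <-]; split; first exact: (derivableV f0 df).
by have := deriveV f0 df.
Qed.

Lemma isd_sqrt f x v a : 0 < f x -> is_derive x v f a ->
  is_derive x v (fun z => Num.sqrt (f z)) (a / (2 * Num.sqrt (f x))).
Proof.
move=> f0 fa.
apply: is_derive_eq (isd_comp (is_derive1_sqrt f0) fa) _.
by rewrite mulrC.
Qed.

Lemma isd_near f g x v a : (\forall z \near x, f z = g z) ->
  is_derive x v f a -> is_derive x v g a.
Proof. exact: near_eq_is_derive. Qed.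

Lemma isd_val f x v a : is_derive x v f a -> 'D_v f x = a.
Proof. by move=> H; rewrite derive_val. Qed.

Lemma isd_ex f x v a : is_derive x v f a -> derivable f x v.
Proof. by move=> H; exact: ex_derive. Qed.

End derivation_rules.

Section continuity_rules.
Context {R : realType} {T : topologicalType}.
Implicit Types (f g : T -> R) (x : T).

Lemma contD f g x : {for x, continuous f} -> {for x, continuous g} ->
  {for x, continuous (fun z => f z + g z)}.
Proof. by move=> cf cg; exact: cvgD cf cg. Qed.

Lemma contM f g x : {for x, continuous f} -> {for x, continuous g} ->
  {for x, continuous (fun z => f z * g z)}.
Proof. by move=> cf cg; exact: cvgM cf cg. Qed.

Lemma cont_near f g x : (\forall z \near x, f z = g z) ->
  {for x, continuous f} -> {for x, continuous g}.
Proof.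
move=> fg cf; rewrite /prop_for /continuous_at -(nbhs_singleton fg).
by move=> P /cf; apply: filterS2 fg => z; rewrite /= => <-.
Qed.

End continuity_rules.

Section coordinates.
Context {R : realType} {n : nat}.
Local Notation V := 'rV[R]_n.
Local Notation e i := (delta_mx ord0 i : V).

Lemma isd_coord (j : 'I_n) (x v : V) :
  is_derive x v (fun z : V => z ord0 j) (v ord0 j).
Proof.
apply/isd_line.
have : is_derive (0 : R) 1 (fun t : R => t * v ord0 j + x ord0 j) (v ord0 j).
  apply: is_derive_eq
    (isdD (isdM (is_derive_id (0 : R) 1) (isdC (v ord0 j) _ _))
          (isdC (x ord0 j) _ _)) _.
  by rewrite mul1r mul0r !addr0.
by under [X in _ -> is_derive _ _ X _]eq_fun do rewrite !mxE.
Qed.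

Definition sqn (x : V) : R := \sum_j x ord0 j ^+ 2.

Definition dotp (x v : V) : R := \sum_j x ord0 j * v ord0 j.

Lemma isd_sqn (x v : V) : is_derive x v sqn (2 * dotp x v).
Proof.
apply: is_derive_eq (isd_sum _ (fun j => isdX 2 (isd_coord j x v))) _.
by rewrite /dotp mulr_sumr; apply: eq_bigr => j _; rewrite expr1 mulrA.
Qed.

Lemma dotp_e (x : V) i : dotp x (e i) = x ord0 i.
Proof.
rewrite /dotp (bigD1 i)//= big1 ?addr0 ?mxE ?eqxx ?mulr1// => j ji.
by rewrite mxE eqxx (negbTE ji) mulr0.
Qed.

Lemma continuous_coord (j : 'I_n) : continuous (fun x : V => x ord0 j).
Proof. exact: coord_continuous. Qed.

Lemma continuous_sumf (T : topologicalType) (I : Type) (r : seq I)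
    (h : I -> T -> R) (x : T) : (forall i, {for x, continuous (h i)}) ->
  {for x, continuous (fun z => \sum_(i <- r) h i z)}.
Proof.
move=> H; elim: r => [|i r IH].
  rewrite (_ : (fun z => _) = fun=> 0); first exact: cvg_cst.
  by apply/funext => z; rewrite big_nil.
rewrite (_ : (fun z => _) = fun z => h i z + \sum_(j <- r) h j z); last first.
  by apply/funext => z; rewrite big_cons.
exact: contD.
Qed.

Lemma continuous_sqn : continuous sqn.
Proof.
move=> x; apply: continuous_sumf => j.
rewrite (_ : (fun z => _) = fun z : V => z ord0 j * z ord0 j).
  by apply: contM; exact: continuous_coord.
by apply/funext => z; rewrite expr2.
Qed.

Lemma sqn_ge0 x : 0 <= sqn x.
Proof. by apply: sumr_ge0 => j _; exact: sqr_ge0. Qed.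

Lemma sqn_eq0 x : (sqn x == 0) = (x == 0).
Proof.
apply/idP/eqP => [|->]; last first.
  by rewrite /sqn big1// => j _; rewrite mxE expr0n.
rewrite psumr_eq0; last by move=> j _; exact: sqr_ge0.
move/allP => H; apply/rowP => j; rewrite mxE.
by have := H j (mem_index_enum _); rewrite /= sqrf_eq0 => /eqP.
Qed.

Lemma sqn_gt0 x : (0 < sqn x) = (x != 0).
Proof. by rewrite lt_def sqn_ge0 andbT sqn_eq0. Qed.

End coordinates.

Section derivation_class.
Context {R : realType} {n : nat}.
Local Notation V := 'rV[R]_n.
Local Notation e i := (delta_mx ord0 i : V).
Implicit Types (U : set V) (f g : V -> R).

(** The recursive form of [is_Ck], which peels off the innermost derivative. *)
Fixpoint Ck (k : nat) U f : Prop :=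
  (forall x, U x -> {for x, continuous f}) /\
  (if k is k'.+1 then
     forall i, (forall x, U x -> derivable f x (e i)) /\ Ck k' U (pderiv i f)
   else True).

Lemma pderivs_rcons s (i : 'I_n) f :
  pderivs (rcons s i) f = pderivs s (pderiv i f).
Proof. by rewrite /pderivs foldr_rcons. Qed.

Lemma is_CkP k U f : is_Ck k U f <-> Ck k U f.
Proof.
elim: k f => [|k IH] f.
  split=> [[_ H]|[H _]]; first by split=> // x Ux; exact: (H [::]).
  by split=> // -[|] // x _ Ux; exact: H.
split=> [[H1 H2]|[H1 H2]].
  split=> [x Ux|i]; first exact: (H2 [::]).
  split=> [x Ux|]; first exact: (H1 [::]).
  apply/IH; split=> [s j x sk Ux|s x sk Ux].
    by have := H1 (rcons s i) j x; rewrite size_rcons pderivs_rcons; exact.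
  by have := H2 (rcons s i) x; rewrite size_rcons pderivs_rcons; exact.
split=> [s i x|s x]; case/lastP: s => [|s j].
- by move=> _ Ux; exact: (H2 i).1.
- rewrite size_rcons pderivs_rcons => sk Ux.
  by have /IH[+ _] := (H2 j).2; exact.
- by move=> _ Ux; exact: H1.
- rewrite size_rcons pderivs_rcons => sk Ux.
  by have /IH[_] := (H2 j).2; exact.
Qed.

Lemma smoothP U f : smooth U f <-> forall k, Ck k U f.
Proof. by split=> H k; apply/is_CkP; exact: H. Qed.

Lemma Ck_cont k U f x : Ck k U f -> U x -> {for x, continuous f}.
Proof. by case: k => [|k] [H _]; exact: H. Qed.

Lemma Ck_der k U f : Ck k.+1 U f -> forall i x, U x ->
  is_derive x (e i) f (pderiv i f x).
Proof. by move=> [_ H] i x Ux; apply/derivableP; exact: (H i).1. Qed.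

Lemma Ck_pderiv k U f i : Ck k.+1 U f -> Ck k U (pderiv i f).
Proof. by move=> [_ H]; exact: (H i).2. Qed.

Lemma CkW k U f : Ck k.+1 U f -> Ck k U f.
Proof.
elim: k f => [|k IH] f [H1 H2]; first by split.
by split=> // i; split; [exact: (H2 i).1|apply: IH; exact: (H2 i).2].
Qed.

Lemma CkS k U U' f : U' `<=` U -> Ck k U f -> Ck k U' f.
Proof.
move=> UU; elim: k f => [|k IH] f [H1 H2]; split=> //.
- by move=> x /UU; exact: H1.
- by move=> x /UU; exact: H1.
- move=> i; split; last by apply: IH; exact: (H2 i).2.
  by move=> x /UU; exact: (H2 i).1.
Qed.

Lemma pderiv_eq (i : 'I_n) f g x : (\forall z \near x, f z = g z) ->
  pderiv i f x = pderiv i g x.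
Proof. by move=> fg; exact: near_eq_derive. Qed.

Lemma eq_Ck k U f g : open U -> (forall x, U x -> f x = g x) ->
  Ck k U f -> Ck k U g.
Proof.
move=> oU.
have near_fg f' g' x : (forall x, U x -> f' x = g' x) -> U x ->
    \forall z \near x, f' z = g' z.
  move=> H Ux; have /nbhs_singleton := open_nbhs_nbhs (conj oU Ux).
  by move=> _; apply: filterS (open_nbhs_nbhs (conj oU Ux)) => z; exact: H.
elim: k f g => [|k IH] f g fg [H1 H2]; split=> //.
- by move=> x Ux; apply: cont_near (H1 x Ux); exact: near_fg.
- by move=> x Ux; apply: cont_near (H1 x Ux); exact: near_fg.
- move=> i; split=> [x Ux|].
    apply: near_eq_derivable (near_fg f g x fg Ux) _; exact: (H2 i).1.
  apply: IH (H2 i).2 => x Ux; apply: pderiv_eq; exact: near_fg fg Ux.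
Qed.

(** The way to prove differentiability of a sum, a product or a composite: name
    its partial derivatives and recurse on them. *)
Lemma CkI k U f (df : 'I_n -> V -> R) : open U ->
  (forall x, U x -> {for x, continuous f}) ->
  (forall i x, U x -> is_derive x (e i) f (df i x)) ->
  (forall i, Ck k U (df i)) -> Ck k.+1 U f.
Proof.
move=> oU cf df1 df2; split=> // i; split=> [x Ux|].
  exact: isd_ex (df1 i x Ux).
by apply: eq_Ck (df2 i) => // x Ux; rewrite /pderiv (isd_val (df1 i x Ux)).
Qed.

Lemma CkU k U U' f : Ck k U f -> Ck k U' f -> Ck k (U `|` U') f.
Proof.
elim: k f => [|k IH] f [H1 H2] [H1' H2']; split=> //.
- by move=> x [] ; [exact: H1|exact: H1'].
- by move=> x [] ; [exact: H1|exact: H1'].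
- move=> i; split; last by apply: IH; [exact: (H2 i).2|exact: (H2' i).2].
  by move=> x []; [exact: (H2 i).1|exact: (H2' i).1].
Qed.

Lemma CkC k U (c : R) : open U -> Ck k U (fun=> c).
Proof.
move=> oU; elim: k c => [|k IH] c; first by split=> // x _; exact: cst_continuous.
apply: (@CkI _ _ _ (fun _ _ => 0)) => // x _; exact: cst_continuous.
Qed.

Lemma CkD k U f g : open U -> Ck k U f -> Ck k U g ->
  Ck k U (fun x => f x + g x).
Proof.
move=> oU; elim: k f g => [|k IH] f g Hf Hg.
  split=> // x Ux; apply: contD; [exact: (Hf.1 x Ux)|exact: (Hg.1 x Ux)].
apply: (@CkI _ _ _ (fun i x => pderiv i f x + pderiv i g x)) => //.
- by move=> x Ux; apply: contD; [exact: (Hf.1 x Ux)|exact: (Hg.1 x Ux)].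
- by move=> i x Ux; apply: isdD; [exact: Ck_der Hf i x Ux|exact: Ck_der Hg i x Ux].
- by move=> i; apply: IH; exact: Ck_pderiv.
Qed.

Lemma CkM k U f g : open U -> Ck k U f -> Ck k U g ->
  Ck k U (fun x => f x * g x).
Proof.
move=> oU; elim: k f g => [|k IH] f g Hf Hg.
  split=> // x Ux; apply: contM; [exact: (Hf.1 x Ux)|exact: (Hg.1 x Ux)].
apply: (@CkI _ _ _ (fun i x => pderiv i f x * g x + f x * pderiv i g x)) => //.
- by move=> x Ux; apply: contM; [exact: (Hf.1 x Ux)|exact: (Hg.1 x Ux)].
- by move=> i x Ux; apply: isdM; [exact: Ck_der Hf i x Ux|exact: Ck_der Hg i x Ux].
- move=> i; apply: CkD => //; apply: IH => //.
  + exact: Ck_pderiv.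
  + exact: CkW.
  + exact: CkW.
  + exact: Ck_pderiv.
Qed.

Lemma CkMl k U (c : R) f : open U -> Ck k U f -> Ck k U (fun x => c * f x).
Proof. by move=> oU Hf; apply: CkM => //; exact: CkC. Qed.

Lemma CkN k U f : open U -> Ck k U f -> Ck k U (fun x => - f x).
Proof.
move=> oU Hf; apply: (@eq_Ck _ _ (fun x => -1 * f x)) => //.
  by move=> x _; rewrite mulN1r.
exact: CkMl.
Qed.

Lemma CkB k U f g : open U -> Ck k U f -> Ck k U g ->
  Ck k U (fun x => f x - g x).
Proof. by move=> oU Hf Hg; apply: CkD => //; exact: CkN. Qed.

Lemma Ck_sum k U (I : Type) (r : seq I) (h : I -> V -> R) : open U ->
  (forall i, Ck k U (h i)) -> Ck k U (fun x => \sum_(i <- r) h i x).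
Proof.
move=> oU H; elim: r => [|i r IH].
  by under eq_fun do rewrite big_nil; exact: CkC.
by under eq_fun do rewrite big_cons; exact: CkD.
Qed.

Lemma CkX k U f m : open U -> Ck k U f -> Ck k U (fun x => f x ^+ m).
Proof.
move=> oU Hf; elim: m => [|m IH].
  by under eq_fun do rewrite expr0; exact: CkC.
by under eq_fun do rewrite exprS; exact: CkM.
Qed.

Lemma Ck_coord k U j : open U -> Ck k U (fun x => x ord0 j).
Proof.
move=> oU; case: k => [|k].
  by split=> // x _; exact: continuous_coord.
apply: (@CkI _ _ _ (fun i _ => (e i) ord0 j)) => //.
- by move=> x _; exact: continuous_coord.
- by move=> i x _; exact: isd_coord.
- by move=> i; exact: CkC.
Qed.

Lemma Ck_sqn k U : open U -> Ck k U sqn.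
Proof.
by move=> oU; apply: Ck_sum => // j; apply: CkX => //; exact: Ck_coord.
Qed.

(** The successive derivatives are data, and they need only be derivatives on
    [D], as for [w] on the positive reals. *)
Definition smooth1 (D : set R) (phi : R -> R) : Prop :=
  exists d : nat -> R -> R, (forall x, D x -> d 0 x = phi x) /\
    forall j x, D x -> is_derive x 1 (d j) (d j.+1 x).

Lemma Ck_comp k U (D : set R) (phi : R -> R) f : open U -> smooth1 D phi ->
  (forall x, U x -> D (f x)) -> Ck k U f -> Ck k U (fun x => phi (f x)).
Proof.
move=> oU [d [d0 ds]] UD Hf.
suff H : forall j, Ck k U (fun x => d j (f x)).
  by apply: eq_Ck (H 0) => // x Ux; apply: d0; exact: UD.
have cont j x : U x -> {for x, continuous (fun x => d j (f x))}.
  move=> Ux; apply: continuous_comp; first exact: Ck_cont Hf Ux.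
  apply: differentiable_continuous; apply/derivable1_diffP.
  exact: isd_ex (ds j _ (UD _ Ux)).
elim: k Hf => [|k IH] Hf j; first by split=> // x; exact: cont.
apply: (@CkI _ _ _ (fun i x => d j.+1 (f x) * pderiv i f x)) => //.
- exact: cont.
- move=> i x Ux; apply: isd_comp; first exact: ds (UD _ Ux).
  exact: Ck_der Hf i x Ux.
- move=> i; apply: CkM => //; last exact: Ck_pderiv.
  apply: IH; exact: CkW.
Qed.

End derivation_class.

(** * Mean values, mixed partials and interior minima *)

Section epsilon_forms.
Context {R : realType} {V : normedModType R}.
Implicit Types (f : V -> R) (x v : V).

Lemma cont_eps f x : {for x, continuous f} -> forall e : R, 0 < e ->
  exists2 r, 0 < r & forall y, `|y - x| < r -> `|f y - f x| < e.
Proof.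
move=> cf e e0; have /cvgrPdist_lt/(_ e e0) := cf.
rewrite nearE => /nbhs_normP[r /= r0 H]; exists r => // y yr.
rewrite distrC; apply: H; rewrite /= distrC; exact: yr.
Qed.

Lemma eps_cont f x : (forall e : R, 0 < e ->
  exists2 r, 0 < r & forall y, `|y - x| < r -> `|f y - f x| <= e) ->
  {for x, continuous f}.
Proof.
move=> H; apply/cvgrPdist_le => e e0; have [r r0 Hr] := H e e0.
rewrite nearE; apply/nbhs_normP; exists r => //= y yr.
rewrite distrC; apply: Hr; rewrite distrC; exact: yr.
Qed.

Lemma open_eps (U : set V) x : open U -> U x ->
  exists2 r : R, 0 < r & forall y, `|y - x| < r -> U y.
Proof.
move=> oU Ux; have /nbhs_normP[r /= r0 H] := open_nbhs_nbhs (conj oU Ux).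
by exists r => // y yr; apply: H; rewrite /= distrC.
Qed.

Lemma isd_eps f x v c : is_derive x v f c -> forall e : R, 0 < e ->
  exists2 r, 0 < r &
    forall t, `|t| < r -> `|f (t *: v + x) - f x - t * c| <= e * `|t|.
Proof.
move=> [df dc] e e0.
have /cvgrPdist_le/(_ e e0) :
    (h^-1 *: ((f \o shift x) (h *: v) - f x)) @[h --> 0^'] --> c.
  by rewrite -dc; exact: df.
rewrite near_withinE nearE => /nbhs_normP[r /= r0 H]; exists r => // t tr.
have [->|t0] := eqVneq t 0.
  by rewrite scale0r add0r subrr mul0r subrr !normr0 mulr0.
have := H t; rewrite /= sub0r normrN => /(_ tr t0) /= Ht.
rewrite -[X in `|X|](mulVKf t0) normrM mulrC ler_wpM2r//.
by rewrite mulrBr mulKf// distrC.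
Qed.

Lemma eps_isd f x v c : (forall e : R, 0 < e ->
  exists2 r, 0 < r &
    forall t, `|t| < r -> `|f (t *: v + x) - f x - t * c| <= e * `|t|) ->
  is_derive x v f c.
Proof.
move=> H.
have C : (h^-1 *: ((f \o shift x) (h *: v) - f x)) @[h --> 0^'] --> c.
  apply/cvgrPdist_le => e e0; have [r r0 Hr] := H e e0.
  rewrite near_withinE nearE; apply/nbhs_normP; exists r => //= t.
  rewrite /= sub0r normrN => tr t0; have := Hr t tr.
  rewrite -[X in `|X|](mulVKf t0) normrM mulrC ler_pM2r ?normr_gt0//.
  by rewrite mulrBr mulKf// distrC.
by apply: DeriveDef; [apply/cvg_ex; exists c|exact/cvg_lim].
Qed.

Lemma isd_descent f x v c : is_derive x v f c -> c < 0 ->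
  exists2 r, 0 < r & forall t, 0 < t < r -> f (t *: v + x) < f x.
Proof.
move=> /isd_eps/(_ (- c / 2)) H c0.
have [|r r0 Hr] := H; first by lra.
exists r => // t /andP[t0 tr].
have := Hr t; rewrite gtr0_norm// => /(_ tr).
rewrite ler_norml => /andP[_]; nra.
Qed.

(** The range of [s] is symmetric because [c] may be negative. *)
Lemma mvt_dir f (d : V -> R) x v (c : R) :
  (forall s : R, `|s| <= `|c| -> is_derive (s *: v + x) v f (d (s *: v + x))) ->
  exists2 s : R, `|s| <= `|c| & f (c *: v + x) - f x = c * d (s *: v + x).
Proof.
move=> H.
pose h (t : R) := f (t *: v + x).
have dh (t : R) : `|t| <= `|c| -> is_derive t 1 h (d (t *: v + x)).
  by move=> tc; exact: (isd_line_at f x v t _).1 (H t tc).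
have ch (t : R) : `|t| <= `|c| -> {for t, continuous h}.
  move=> /dh tc; apply: differentiable_continuous; apply/derivable1_diffP.
  exact: isd_ex tc.
have h0 : h 0 = f x by rewrite /h scale0r add0r.
have [c0|c0|->] := ltgtP c 0.
- have E t : t \in `[c, 0] -> `|t| <= `|c|.
    by rewrite in_itv /= => /andP[ct t0]; rewrite !ler0_norm//; lra.
  have [||s sc Es] := @MVT R h (fun t => d (t *: v + x)) c 0 c0.
  + move=> t; rewrite in_itv/= => /andP[ct t0]; apply: dh; apply: E.
    by rewrite in_itv/= !ltW.
  + apply: continuous_in_subspaceT => t; rewrite inE/= => tc.
    by apply: ch; exact: E.
  exists s; first by apply: E; move: sc; rewrite !in_itv/= => /andP[? ?]; rewrite !ltW.
  by move: Es; rewrite h0 /h => Es; lra.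
- have E t : t \in `[0, c] -> `|t| <= `|c|.
    by rewrite in_itv /= => /andP[ct t0]; rewrite !ger0_norm//; lra.
  have [||s sc Es] := @MVT R h (fun t => d (t *: v + x)) 0 c c0.
  + move=> t; rewrite in_itv/= => /andP[ct t0]; apply: dh; apply: E.
    by rewrite in_itv/= !ltW.
  + apply: continuous_in_subspaceT => t; rewrite inE/= => tc.
    by apply: ch; exact: E.
  exists s; first by apply: E; move: sc; rewrite !in_itv/= => /andP[? ?]; rewrite !ltW.
  by move: Es; rewrite h0 /h => Es; lra.
- by exists 0; rewrite ?normr0// scale0r add0r subrr mul0r.
Qed.

(** Derivatives along two directions add up when one of them is continuous: the
    increment along [u] is a derivative at a nearby point. By induction on the
    coordinates this makes a [C ^ 1] function differentiable in every direction. *)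
Lemma isd_addr f (d : V -> R) (U : set V) x u v (a c : R) : open U -> U x ->
  (forall z, U z -> is_derive z u f (d z)) -> {for x, continuous d} ->
  is_derive x v f a -> is_derive x (v + c *: u) f (a + c * d x).
Proof.
move=> oU Ux du cd dv; apply: eps_isd => e e0.
pose e' := e / (2 * (`|c| + 1)).
have c1 : 0 < `|c| + 1 by rewrite ltr_wpDl.
have e'0 : 0 < e' by rewrite divr_gt0// mulr_gt0.
have [r1 r10 H1] := open_eps oU Ux.
have [r2 r20 H2] := cont_eps cd e'0.
have [|r3 r30 H3] := isd_eps dv (_ : 0 < e / 2); first by rewrite divr_gt0.
pose M := `|v| + `|c| * `|u| + 1.
have M0 : 0 < M by rewrite /M ltr_wpDl// addr_ge0// mulr_ge0.
have M1 : 1 <= M by rewrite /M lerDr addr_ge0// mulr_ge0.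
exists (Num.min r3 (Num.min r1 r2 / M)).
  by rewrite lt_min r30 divr_gt0// lt_min r10.
move=> t; rewrite lt_min => /andP[tr3]; rewrite ltr_pdivlMr// lt_min.
move=> /andP[tr1 tr2].
have B s : `|s| <= `|t * c| -> `|s *: u + (t *: v + x) - x| <= `|t| * M.
  move=> sc; rewrite addrA addrK (le_trans (ler_normD _ _))// !normrZ.
  have : `|s| * `|u| <= `|t * c| * `|u| by rewrite ler_wpM2r.
  rewrite normrM /M => Hs; have := normr_ge0 t; nra.
have [s sc Es] := @mvt_dir f d (t *: v + x) u (t * c) (fun s sc =>
  du _ (H1 _ (le_lt_trans (B s sc) tr1))).
have := H2 _ (le_lt_trans (B s sc) tr2); set ds := d _ => Hds.
have := H3 _ tr3.
rewrite (_ : t *: (v + c *: u) + x = (t * c) *: u + (t *: v + x)); last first.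
  by rewrite scalerDr scalerA addrCA addrA.
move=> H; rewrite (_ : f _ - _ - _ = (f (t *: v + x) - f x - t * a) +
  t * c * (ds - d x)); last by rewrite mulrBr -Es; ring.
rewrite (le_trans (ler_normD _ _))// (splitr e) mulrDl lerD//.
rewrite !normrM -[`|t| * _ * _]mulrA mulrC ler_wpM2r//.
have : `|c| * `|ds - d x| <= `|c| * e' by rewrite ler_wpM2l// ltW.
move=> /le_trans; rewrite mulrC; apply.
have <- : e' * (`|c| + 1) = e / 2 by rewrite /e'; field; rewrite gt_eqF.
by rewrite mulrDr mulr1 lerDl ltW.
Qed.

End epsilon_forms.

Section partials.
Context {R : realType} {n : nat}.
Local Notation V := 'rV[R]_n.
Local Notation e i := (delta_mx ord0 i : V).
Implicit Types (U : set V) (f g : V -> R).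

Lemma row_sum_e (v : V) : v = \sum_i v ord0 i *: e i.
Proof. exact: row_sum_delta. Qed.

Lemma C1_dir U f x (v : V) : open U -> Ck 1 U f -> U x ->
  is_derive x v f (\sum_i v ord0 i * pderiv i f x).
Proof.
move=> oU Hf Ux; rewrite {1}(row_sum_e v).
elim: (index_enum _) => [|i r IH]; first by rewrite !big_nil; exact: is_derive0.
rewrite !big_cons addrC [X in is_derive _ _ _ X]addrC.
apply: (isd_addr _ oU Ux) => //.
- by move=> z Uz; exact: Ck_der Hf i z Uz.
- exact: Ck_cont (Ck_pderiv i Hf) Ux.
Qed.

Lemma norm_e i : `|e i| <= 1.
Proof.
rewrite [leLHS]/Num.Def.normr/= mx_normrE; apply: bigmax_le => // -[a b] _ /=.
by rewrite mxE; case: (_ && _); rewrite ?normr1 ?normr0.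
Qed.

Lemma norm_coord (x : V) i : `|x ord0 i| <= `|x|.
Proof.
rewrite [leRHS]/Num.Def.normr/= mx_normrE.
exact: (le_bigmax _ (fun ij : 'I_1 * 'I_n => `|x ij.1 ij.2|) (ord0, i)).
Qed.

(** Two applications of the mean value theorem, along [e i] and then along
    [e j]. The left-hand side is symmetric in [i] and [j], whence [schwarz]. *)
Lemma second_difference U f x i j (r t : R) : Ck 2 U f ->
  (forall y, `|y - x| < r -> U y) -> 0 < t -> 2 * t < r ->
  exists2 z, `|z - x| <= 2 * t &
    f (t *: e i + (t *: e j + x)) - f (t *: e j + x) - (f (t *: e i + x) - f x)
    = t * t * pderiv j (pderiv i f) z.
Proof.
move=> Hf Ur t0 tr.
have tt : `|t| = t by rewrite gtr0_norm.
have cA (u v w : V) : u + (v + w) = v + (u + w) by exact: addrCA.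
have B (a b : R) : `|a| <= `|t| -> `|b| <= `|t| ->
    `|a *: e i + (b *: e j + x) - x| <= 2 * t.
  rewrite tt => at_ bt; rewrite addrA addrK (le_trans (ler_normD _ _))// !normrZ.
  have := norm_e i; have := norm_e j; have := normr_ge0 a.
  have := normr_ge0 b; nra.
have Hi z : U z -> is_derive z (e i) f (pderiv i f z).
  by move=> Uz; exact: Ck_der Hf i z Uz.
pose h z := f (t *: e j + z) - f z.
pose dh z := pderiv i f (t *: e j + z) - pderiv i f z.
have [|s st Es] := @mvt_dir _ _ h dh x (e i) t.
  move=> s st; apply: isdB; last first.
    apply: Hi; apply: Ur; apply: le_lt_trans tr.
    by have := B s 0 st; rewrite scale0r add0r normr0; apply.
  have /isd_line_at : is_derive (s *: e i + (t *: e j + x)) (e i) f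
      (pderiv i f (s *: e i + (t *: e j + x))).
    apply: Hi; apply: Ur; apply: le_lt_trans tr.
    exact: B.
  rewrite [t *: e j + (s *: e i + x)]cA => H; apply/isd_line_at.
  rewrite (_ : (fun t1 : R => _) =
    fun t1 : R => f (t1 *: e i + (t *: e j + x))) //.
  by apply/funext => t1; rewrite cA.
have [|s' s't Es'] :=
  @mvt_dir _ _ (pderiv i f) (pderiv j (pderiv i f)) (s *: e i + x) (e j) t.
  move=> s' s't; have := Ck_der (Ck_pderiv i Hf) j; apply.
  apply: Ur; apply: le_lt_trans tr.
  by rewrite cA; apply: B.
exists (s' *: e j + (s *: e i + x)).
  by rewrite cA; apply: B.
move: Es; rewrite /h /dh Es' mulrA => <-.
by rewrite [t *: e j + (t *: e i + x)]cA; ring.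
Qed.

Lemma dist_half (a b c d : R) :
  `|c - a| < d / 2 -> `|c - b| < d / 2 -> `|b - a| <= d.
Proof.
by rewrite !ltr_norml ler_norml => /andP[? ?] /andP[? ?]; apply/andP; split; lra.
Qed.

Lemma schwarz U f x i j : open U -> Ck 2 U f -> U x ->
  pderiv j (pderiv i f) x = pderiv i (pderiv j f) x.
Proof.
move=> oU Hf Ux; apply/eqP; rewrite -subr_eq0 -normr_le0.
apply/ler_addgt0Pl => e0 ep; rewrite addr0.
have [r r0 Ur] := open_eps oU Ux.
have ep2 : 0 < e0 / 2 by rewrite divr_gt0.
have [r1 r10 H1] := cont_eps (Ck_cont (Ck_pderiv j (Ck_pderiv i Hf)) Ux) ep2.
have [r2 r20 H2] := cont_eps (Ck_cont (Ck_pderiv i (Ck_pderiv j Hf)) Ux) ep2.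
pose t := Num.min r (Num.min r1 r2) / 3.
have m0 : 0 < Num.min r (Num.min r1 r2) by rewrite !lt_min r0 r10.
have t0 : 0 < t by rewrite divr_gt0.
have m3 : 2 * t < Num.min r (Num.min r1 r2).
  by rewrite /t; move: m0; set m := Num.min _ _ => m0; lra.
move: (m3); rewrite !lt_min => /and3P[tr tr1 tr2].
have [z1 z1x E1] := second_difference i j Hf Ur t0 tr.
have [z2 z2x E2] := second_difference j i Hf Ur t0 tr.
have E : t * t * pderiv j (pderiv i f) z1 = t * t * pderiv i (pderiv j f) z2.
  rewrite -E1 -E2 (_ : t *: e i + (t *: e j + x) = t *: e j + (t *: e i + x)).
    by ring.
  exact: addrCA.
have {}E : pderiv j (pderiv i f) z1 = pderiv i (pderiv j f) z2.
  by apply: mulfI E; rewrite mulf_neq0// gt_eqF.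
have := H1 _ (le_lt_trans z1x tr1); have := H2 _ (le_lt_trans z2x tr2).
rewrite E; set a := pderiv i _ x; set b := pderiv j _ x; set c := pderiv _ _ z2.
exact: dist_half.
Qed.

Lemma min_pderiv U f x i : open U -> Ck 1 U f -> U x ->
  (forall z, U z -> f x <= f z) -> pderiv i f x = 0.
Proof.
move=> oU Hf Ux xmin; apply/eqP; apply/negPn/negP => d0.
have [r r0 Ur] := open_eps oU Ux.
have C s : is_derive x (s *: e i) f (s * pderiv i f x).
  apply: is_derive_eq (C1_dir (s *: e i) oU Hf Ux) _.
  rewrite (bigD1 i)//= big1 ?addr0 ?mxE ?eqxx ?mulr1// => j ji.
  by rewrite !mxE (negbTE ji) andbF mulr0 mul0r.
have [|r' r'0 H] := isd_descent (C (- pderiv i f x)).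
  by rewrite mulNr oppr_lt0 lt_def mulf_neq0//= -expr2 sqr_ge0.
pose M := `|- pderiv i f x *: e i| + 1.
have M0 : 0 < M by rewrite ltr_wpDl.
pose t := Num.min r' (r / M) / 2.
have m0 : 0 < Num.min r' (r / M) by rewrite lt_min r'0 divr_gt0.
have t0 : 0 < t by rewrite divr_gt0.
have : t < Num.min r' (r / M) by rewrite /t; move: m0; set m := Num.min _ _ => ?; lra.
rewrite lt_min => /andP[tr' tr].
have := H t; rewrite t0 tr' => /(_ isT); rewrite ltNge xmin//.
apply: Ur; rewrite addrK normrZ gtr0_norm//.
apply: le_lt_trans (_ : t * M < r); last by rewrite -ltr_pdivlMr.
by rewrite ler_wpM2l ?(ltW t0)// /M lerDl.
Qed.

(** If the form were negative at [v], the derivative of [f] along [v], which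
    vanishes at [x], would be negative just after [x], and [f] would decrease. *)
Lemma min_hessian U f x (v : V) : open U -> Ck 2 U f -> U x ->
  (forall z, U z -> f x <= f z) ->
  0 <= \sum_i \sum_j v ord0 i * v ord0 j * pderiv j (pderiv i f) x.
Proof.
move=> oU Hf Ux xmin; rewrite leNgt; apply/negP => neg.
pose D z := \sum_i v ord0 i * pderiv i f z.
have HD : Ck 1 U D.
  apply: Ck_sum => // i; apply: CkMl => //; exact: Ck_pderiv.
have D0 : D x = 0.
  rewrite /D big1// => i _.
  by rewrite (min_pderiv i oU (CkW Hf) Ux xmin) mulr0.
have dD : is_derive x v D (\sum_i \sum_j v ord0 i * v ord0 j *
    pderiv j (pderiv i f) x).
  apply: isd_sum => i.
  apply: is_derive_eq (isdMl _ (C1_dir v oU (Ck_pderiv i Hf) Ux)) _.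
  by rewrite mulr_sumr; apply: eq_bigr => j _; rewrite mulrA.
have [r' r'0 H] := isd_descent dD neg.
have [r r0 Ur] := open_eps oU Ux.
pose M := `|v| + 1.
have M0 : 0 < M by rewrite ltr_wpDl.
pose t := Num.min r' (r / M) / 2.
have m0 : 0 < Num.min r' (r / M) by rewrite lt_min r'0 divr_gt0.
have t0 : 0 < t by rewrite divr_gt0.
have : t < Num.min r' (r / M) by rewrite /t; move: m0; set m := Num.min _ _ => ?; lra.
rewrite lt_min => /andP[tr' tr].
have Us (s : R) : `|s| <= t -> U (s *: v + x).
  move=> st; apply: Ur; rewrite addrK normrZ.
  apply: le_lt_trans (_ : t * M < r); last by rewrite -ltr_pdivlMr.
  have := normr_ge0 v; have := normr_ge0 s; rewrite /M; nra.
have tt : `|t| = t by rewrite gtr0_norm.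
pose h (s : R) := f (s *: v + x).
have dh (s : R) : `|s| <= t -> is_derive s 1 h (D (s *: v + x)).
  move=> st; exact: (isd_line_at f x v s _).1
    (C1_dir v oU (CkW Hf) (Us _ st)).
have [||s] := @MVT R h (fun s => D (s *: v + x)) 0 t t0.
- move=> s; rewrite in_itv/= => /andP[s0 st]; apply: dh.
  by rewrite gtr0_norm// ltW.
- apply: continuous_in_subspaceT => s; rewrite inE/= in_itv/= => /andP[s0 st].
  apply: differentiable_continuous; apply/derivable1_diffP.
  by apply: isd_ex (dh s _); rewrite ger0_norm.
rewrite in_itv/= => /andP[s0 st]; rewrite subr0 /h scale0r add0r => E.
have := xmin _ (Us t _); rewrite tt lexx => /(_ isT).
have := H s; rewrite s0 (lt_trans st tr') D0 => /(_ isT).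
move: E; set a := f _ => E ? ?; nra.
Qed.

End partials.

(** * The flat convex function and the profile of the metric *)

Section flat_functions.
Context {R : realType}.
Implicit Types (p : {poly R}) (x y : R).

(** This class of functions contains its own derivatives ([isd_flat]), so all of
    them are smooth. *)
Definition flat_fun p x : R := if 0 < x then p.[x^-1] * expR (- x^-1) else 0.

Lemma flat_le0 p x : x <= 0 -> flat_fun p x = 0.
Proof. by rewrite /flat_fun leNgt => /negbTE ->. Qed.

Lemma flat_gt0 p x : 0 < x -> flat_fun p x = p.[x^-1] * expR (- x^-1).
Proof. by rewrite /flat_fun => ->. Qed.

(** Every power of [1/x] is beaten by [exp (-1/x)] at [0]. *)
Lemma flat_small p (e : R) : 0 < e ->
  exists2 r, 0 < r & forall t, `|t| < r -> `|flat_fun p t| <= e * `|t|.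
Proof.
(* The induction on [p] needs the statement for all multiples ['X^k * p]. *)
suff H : forall k : nat, forall e, 0 < e -> exists2 r, 0 < r &
    forall t, `|t| < r -> `|flat_fun ('X^k * p) t| <= e * `|t|.
  by move=> /(H 0); rewrite expr0 mul1r.
elim/poly_ind: p => [|p c IH] k e' e0.
  exists 1 => // t _; rewrite mulr0 /flat_fun; case: ifP => _.
    by rewrite horner0 mul0r normr0 mulr_ge0// ltW.
  by rewrite normr0 mulr_ge0// ltW.
have [r1 r10 H1] := IH k.+1 _ (divr_gt0 e0 (ltr0Sn _ 1)).
pose F : R := k.+2`!%:R.
have F0 : 0 < F by rewrite ltr0n fact_gt0.
have c0 : 0 < 2 * F * (`|c| + 1) by rewrite !mulr_gt0// ltr_wpDl.
exists (Num.min r1 (e' / (2 * F * (`|c| + 1)))).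
  by rewrite lt_min r10 divr_gt0.
move=> t; rewrite lt_min => /andP[tr1]; rewrite ltr_pdivlMr// => tr2.
have [t0|t0] := leP t 0.
  by rewrite flat_le0// normr0 mulr_ge0// ltW.
have := H1 _ tr1; rewrite !flat_gt0//; move: tr2; rewrite (gtr0_norm t0) => tr2 {}H1.
pose z := t^-1; have z0 : 0 < z by rewrite invr_gt0.
have tz : t * z = 1 by rewrite mulfV// gt_eqF.
move: H1; rewrite !(hornerM, hornerD, hornerC, hornerX, hornerXn) -/z => H1.
rewrite (_ : z ^+ k * (p.[z] * z + c) * expR (- z) =
  z ^+ k.+1 * p.[z] * expR (- z) + c * z ^+ k * expR (- z)); last first.
  by rewrite exprSr; ring.
rewrite (le_trans (ler_normD _ _))//.
rewrite (splitr e') mulrDl lerD//.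
have ez : z ^+ k.+2 / F <= expR z.
  by have := expR_ge1Dxn k.+1 (ltW z0); rewrite -/F => H; lra.
have ep : 0 < expR (- z) := expR_gt0 _.
have {}ez : z ^+ k * expR (- z) <= F * t ^+ 2.
  have E1 : expR z * expR (- z) = 1 := expRxMexpNx_1 z.
  have : z ^+ k.+2 / F * expR (- z) <= 1 by rewrite -E1 ler_pM2r.
  rewrite mulrAC ler_pdivrMr// mul1r => H.
  have : t ^+ 2 * (z ^+ k.+2 * expR (- z)) <= t ^+ 2 * F.
    by rewrite ler_wpM2l// sqr_ge0.
  have -> : t ^+ 2 * (z ^+ k.+2 * expR (- z)) =
      (t * z) ^+ 2 * (z ^+ k * expR (- z)) by rewrite !exprS; ring.
  by rewrite tz expr1n mul1r [F * _]mulrC.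
rewrite normrM normrM (gtr0_norm ep) (gtr0_norm (exprn_gt0 k z0)) -mulrA.
apply: (@le_trans _ _ (`|c| * (F * t ^+ 2))); first by rewrite ler_wpM2l.
rewrite expr2 !mulrA ler_pM2r//.
have := normr_ge0 c; have : 0 <= t * F by rewrite mulr_ge0// ltW.
nra.
Qed.

Lemma isd_flat p x : is_derive x 1 (flat_fun p) (flat_fun ('X^2 * (p - p^`())) x).
Proof.
have [x0|x0|->] := ltgtP x 0.
- rewrite (flat_le0 _ (ltW x0)); apply: isd_near (isdC 0 x 1).
  near=> z; rewrite flat_le0// ltW//; near: z; exact: lt_nbhsl.
- have x1 : x != 0 by rewrite gt_eqF.
  have di : is_derive x 1 (fun z : R => z^-1) (- x ^- 2).
    apply: is_derive_eq (isdV x1 (is_derive_id x 1)) _.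
    by rewrite mulr1.
  have dp := isd_comp (is_derive_poly p (x^-1)) di.
  have de := isd_comp (f := fun z : R => - z^-1) (is_derive_expR (- x^-1)) (isdN di).
  apply: (@isd_near _ _ (fun z : R => p.[z^-1] * expR (- z^-1))).
    near=> z; rewrite flat_gt0//; near: z; exact: lt_nbhsr.
  apply: is_derive_eq (isdM dp de) _.
  rewrite flat_gt0// hornerM hornerXn hornerD hornerN -exprVn; ring.
- rewrite flat_le0//; apply: eps_isd => e e0.
  have [r r0 H] := flat_small p e0; exists r => // t tr.
  rewrite (flat_le0 _ (lexx 0)) !addr0 mulr0 !subr0 [t *: 1]mulr1; exact: H.
Unshelve. all: by end_near. Qed.

Lemma smooth1_flat (c : R) p D : smooth1 D (fun x => c * flat_fun p x).
Proof.
exists (fun j x => c * flat_fun (iter j (fun q => 'X^2 * (q - q^`())) p) x).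
by split=> // j x _; apply: isdMl; exact: isd_flat.
Qed.

(** [E x = x exp (1 - 1/x)] is flat at [0], convex, and [E 1 = 1]. *)
Definition E x : R := x * (expR 1 * flat_fun 1 x).
Definition E1 x : R := expR 1 * flat_fun (1 + 'X) x.
Definition E2 x : R := expR 1 * flat_fun ('X^3) x.

Lemma isd_E x : is_derive x 1 E (E1 x).
Proof.
apply: is_derive_eq (isdM (is_derive_id x 1) (isdMl (expR 1) (isd_flat 1 x))) _.
have [x0|x0] := leP x 0; first by rewrite /E1 !flat_le0// !mulr0 addr0.
rewrite /E1 !flat_gt0// (_ : 1^`() = 0) ?subr0 ?mulr1; last exact: derivC.
rewrite hornerD hornerC hornerX hornerXn.
have : x * x^-1 = 1 by rewrite mulfV// gt_eqF.
move=> H; rewrite expr2 [X in _ + X](_ : _ = x * x^-1 *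
  (expR 1 * (x^-1 * expR (- x^-1)))); last by ring.
by rewrite H; ring.
Qed.

Lemma isd_E1 x : is_derive x 1 E1 (E2 x).
Proof.
apply: is_derive_eq (isdMl (expR 1) (isd_flat _ x)) _.
rewrite /E2; congr (_ * flat_fun _ _).
by rewrite derivD derivX (_ : 1^`() = 0); [ring|exact: derivC].
Qed.

Lemma smooth1_E1 D : smooth1 D E1.
Proof. exact: smooth1_flat. Qed.

Lemma E_le0 x : x <= 0 -> E x = 0.
Proof. by move=> x0; rewrite /E flat_le0// !mulr0. Qed.

Lemma E1_le0 x : x <= 0 -> E1 x = 0.
Proof. by move=> x0; rewrite /E1 flat_le0// !mulr0. Qed.

Lemma E2_le0 x : x <= 0 -> E2 x = 0.
Proof. by move=> x0; rewrite /E2 flat_le0// !mulr0. Qed.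

Lemma E_1 : E 1 = 1.
Proof.
by rewrite /E flat_gt0// invr1 hornerC !mul1r expRxMexpNx_1.
Qed.

Lemma E1_gt0 x : 0 < x -> 0 < E1 x.
Proof.
move=> x0; rewrite /E1 flat_gt0// hornerD hornerC hornerX.
by rewrite !mulr_gt0 ?expR_gt0// addr_gt0// invr_gt0.
Qed.

Lemma E1_ge0 x : 0 <= E1 x.
Proof. by have [/E1_le0->//|/E1_gt0/ltW] := leP x 0. Qed.

Lemma E2_ge0 x : 0 <= E2 x.
Proof.
rewrite /E2 mulr_ge0 ?expR_ge0//; have [/flat_le0->//|x0] := leP x 0.
by rewrite flat_gt0// hornerXn mulr_ge0 ?expR_ge0// exprn_ge0// invr_ge0 ltW.
Qed.

Lemma E_ge0 x : 0 <= E x.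
Proof.
have [/E_le0->//|x0] := leP x 0.
by rewrite /E flat_gt0// hornerC mul1r !mulr_ge0 ?expR_ge0// ltW.
Qed.

Lemma E_le1 x : x <= 1 -> E x <= 1.
Proof.
move=> x1; have [/E_le0->//|x0] := leP x 0.
rewrite /E flat_gt0// hornerC mul1r -expRD -[leRHS]mulr1.
rewrite ler_pM ?expR_ge0 ?(ltW x0)// expR_le1 subr_le0 -[leLHS]invr1.
by rewrite lef_pV2 ?posrE.
Qed.

Lemma E1_le2 x : x <= 1 -> E1 x <= 2.
Proof.
move=> x1; have [/E1_le0->//|x0] := leP x 0.
rewrite /E1 flat_gt0// hornerD hornerC hornerX.
set z := x^-1; have z1 : 1 <= z by rewrite /z invf_ge1.
have := expR_ge1Dx (z - 1); rewrite addrC subrK => Hz.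
have : expR (z - 1) * expR (1 - z) = 1 by rewrite -expRD addrC subrKA subrr expR0.
have : expR 1 * expR (- z) = expR (1 - z) by rewrite -expRD.
set a := expR 1; set b := expR (- z); set c := expR (1 - z); set d := expR (z - 1).
have c0 : 0 < c := expR_gt0 _.
move=> ab dc; rewrite mulrCA ab.
have : z * c <= d * c by rewrite ler_pM2r.
rewrite dc; nra.
Qed.

End flat_functions.

Section profile.
Context {R : realType} (m : nat).
Implicit Types (x y : R).

(** All these are functions of the squared radius [y]: [w] is the inverse of the
    radius, [sf] the radial stretching factor with derivative [sf1], [kf] the
    coefficient of [x^T x] in the metric with derivative [k1], and
    [w y ^+ m + Pf y] the Green function. *)
Definition w y : R := (Num.sqrt y)^-1.
Definition v y : R := if 0 < y then 1 - w y ^+ m else 0.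
Definition sf y : R := 1 + E1 (v y).
Definition sf1 y : R := E2 (v y) * (m%:R / 2 * w y ^+ m.+2).
Definition Pf y : R := 1 - E (v y).
Definition kf y : R := (sf y ^+ 2 - 1) * w y ^+ 2.
Definition k1 y : R := 2 * sf y * sf1 y * w y ^+ 2 - (sf y ^+ 2 - 1) * w y ^+ 4.

Lemma w_gt0 y : 0 < y -> 0 < w y.
Proof. by move=> y0; rewrite /w invr_gt0 sqrtr_gt0. Qed.

Lemma w_ge0 y : 0 <= w y.
Proof. by rewrite /w invr_ge0 sqrtr_ge0. Qed.

Lemma w_sqr y : 0 < y -> w y ^+ 2 * y = 1.
Proof. by move=> y0; rewrite /w exprVn sqr_sqrtr ?ltW// mulVf// gt_eqF. Qed.

Lemma w_le0 y : y <= 0 -> w y = 0.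
Proof. by move=> y0; rewrite /w ler0_sqrtr// invr0. Qed.

Lemma isd_w y : 0 < y -> is_derive y 1 w (- (2^-1) * w y ^+ 3).
Proof.
move=> y0; have s0 : 0 < Num.sqrt y by rewrite sqrtr_gt0.
apply: is_derive_eq (isdV _ (isd_sqrt y0 (is_derive_id y 1))) _.
  by rewrite gt_eqF.
by rewrite /w; field; rewrite gt_eqF.
Qed.

Lemma smooth1_w : smooth1 [set y | 0 < y] w.
Proof.
(* [w = y ^ (- 1 / 2)], so its derivatives are multiples of odd powers of [w]. *)
pose c := fix c j : R := if j is j'.+1 then
  c j' * (- (2^-1) * (j'.*2.+1)%:R) else 1.
exists (fun j y => c j * w y ^+ j.*2.+1); split=> [y _|j y y0].
  by rewrite mul1r expr1.
apply: is_derive_eq (isdMl _ (isdX _ (isd_w y0))) _.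
by rewrite /= doubleS [w y ^+ j.*2.+3](_ : _ = w y ^+ j.*2 * w y ^+ 3);
  [ring|rewrite -exprD addn3].
Qed.

Lemma isd_v y : 0 < y -> is_derive y 1 v (m%:R / 2 * w y ^+ m.+2).
Proof.
move=> y0.
apply: (@isd_near _ _ (fun z => 1 - w z ^+ m)).
  near=> z; rewrite /v ifT//; near: z; exact: lt_nbhsr.
apply: is_derive_eq (isdB (isdC 1 y 1) (isdX m (isd_w y0))) _.
have [->|] := posnP m; first by rewrite !mul0r subr0.
case: m => // k _; rewrite /= [w y ^+ k.+3](_ : _ = w y ^+ k * w y ^+ 3).
  by rewrite sub0r; field.
by rewrite -exprD addn3.
Unshelve. all: by end_near. Qed.

Lemma w_ge1 y : 0 < y <= 1 -> 1 <= w y.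
Proof.
move=> /andP[y0 y1]; rewrite /w invf_ge1 ?sqrtr_gt0//.
by rewrite -sqrtr1 ler_wsqrtr.
Qed.

Lemma v_le0 y : y <= 1 -> v y <= 0.
Proof.
move=> y1; rewrite /v; case: ifPn => // y0.
by rewrite subr_le0 exprn_ege1// w_ge1// y0.
Qed.

Lemma v_le1 y : v y <= 1.
Proof.
rewrite /v; case: ifPn => // _.
by rewrite gerBl exprn_ge0// w_ge0.
Qed.

Lemma v_gt0 y : (0 < m)%N -> 1 < y -> 0 < v y.
Proof.
move=> m0 y1; have y0 : 0 < y by exact: lt_trans y1.
rewrite /v y0 subr_gt0 exprn_ilt1 ?w_ge0 -?lt0n//.
by rewrite /w invf_lt1 ?sqrtr_gt0// -[ltLHS]sqrtr1 ltr_sqrt.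
Qed.

(* Near [y <= 0], where [v] is not differentiable, the composite is constant. *)
Lemma isd_flat_v (phi dphi : R -> R) y :
  (forall t, t <= 0 -> phi t = 0) -> (forall t, t <= 0 -> dphi t = 0) ->
  (forall t : R, is_derive t 1 phi (dphi t)) ->
  is_derive y 1 (fun z => phi (v z)) (dphi (v y) * (m%:R / 2 * w y ^+ m.+2)).
Proof.
move=> p0 d0 dp; have [y0|y0] := leP y 0; last exact: isd_comp (isd_v y0).
rewrite d0 ?mul0r; last by rewrite v_le0// (le_trans y0).
apply: isd_near (isdC 0 y 1).
near=> z; rewrite p0// v_le0// ltW//; near: z; apply: lt_nbhsl.
exact: le_lt_trans y0 _.
Unshelve. all: by end_near. Qed.

Lemma isd_sf y : is_derive y 1 sf (sf1 y).
Proof.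
apply: is_derive_eq (isdD (isdC 1 y 1) (isd_flat_v y E1_le0 E2_le0 isd_E1)) _.
by rewrite add0r.
Qed.

Lemma isd_Pf y : is_derive y 1 Pf (- ((sf y - 1) * (m%:R / 2 * w y ^+ m.+2))).
Proof.
apply: is_derive_eq (isdB (isdC 1 y 1) (isd_flat_v y E_le0 E1_le0 isd_E)) _.
by rewrite sub0r /sf addrAC subrr add0r.
Qed.

Lemma sf_le1 y : y <= 1 -> sf y = 1.
Proof. by move=> y1; rewrite /sf E1_le0 ?addr0// v_le0. Qed.

Lemma sf1_le1 y : y <= 1 -> sf1 y = 0.
Proof. by move=> y1; rewrite /sf1 E2_le0 ?mul0r// v_le0. Qed.

Lemma Pf_le1 y : y <= 1 -> Pf y = 1.
Proof. by move=> y1; rewrite /Pf E_le0 ?subr0// v_le0. Qed.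

Lemma kf_le1 y : y <= 1 -> kf y = 0.
Proof. by move=> y1; rewrite /kf sf_le1// expr1n subrr mul0r. Qed.

Lemma k1_le1 y : y <= 1 -> k1 y = 0.
Proof.
by move=> y1; rewrite /k1 sf_le1// sf1_le1// expr1n subrr mulr0 !mul0r subr0.
Qed.

Lemma sf_ge1 y : 1 <= sf y.
Proof. by rewrite /sf lerDl E1_ge0. Qed.

Lemma sf_gt0 y : 0 < sf y.
Proof. exact: lt_le_trans (sf_ge1 y). Qed.

Lemma sf_le3 y : sf y <= 3.
Proof. by have := E1_le2 (v_le1 y); rewrite /sf; lra. Qed.

Lemma sf1_ge0 y : 0 <= sf1 y.
Proof. by rewrite /sf1 mulr_ge0 ?E2_ge0// mulr_ge0 ?exprn_ge0 ?w_ge0// divr_ge0. Qed.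

Lemma Pf_ge0 y : 0 <= Pf y.
Proof. by rewrite /Pf subr_ge0 E_le1// v_le1. Qed.

Lemma Pf_leq1 y : Pf y <= 1.
Proof. by rewrite /Pf gerBl E_ge0. Qed.

Lemma kf_ge0 y : 0 <= kf y.
Proof.
rewrite /kf mulr_ge0 ?exprn_ge0 ?w_ge0// subr_ge0.
by rewrite exprn_ege1// sf_ge1.
Qed.

Lemma kfy y : 0 <= y -> 1 + kf y * y = sf y ^+ 2.
Proof.
rewrite le_eqVlt => /predU1P[<-|y0].
  by rewrite kf_le1// mul0r addr0 sf_le1// expr1n.
by rewrite /kf -mulrA w_sqr// mulr1 addrC subrK.
Qed.

Lemma isd_kf y : is_derive y 1 kf (k1 y).
Proof.
have [y0|y0] := leP y 0; last first.
  apply: is_derive_eq (isdM (isdB (isdX 2 (isd_sf y)) (isdC 1 y 1))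
    (isdX 2 (isd_w y0))) _.
  by rewrite /k1 subr0 !expr1; field.
rewrite k1_le1; last exact: le_trans y0 _.
apply: isd_near (isdC 0 y 1).
near=> z; rewrite kf_le1// ltW//; near: z; apply: lt_nbhsl.
exact: le_lt_trans y0 _.
Unshelve. all: by end_near. Qed.

End profile.

(** * Metrics of the form [delta + kappa x x^T] and their curvature *)

Section dot_product.
Context {R : realType} {n : nat}.
Local Notation V := 'rV[R]_n.
Local Notation e i := (delta_mx ord0 i : V).
Implicit Types (x u v w : V).

Lemma dotpE u v : (u *m v^T) ord0 ord0 = dotp u v.
Proof. by rewrite mxE; apply: eq_bigr => i _; rewrite !mxE. Qed.

Lemma dotpC u v : dotp u v = dotp v u.
Proof. by apply: eq_bigr => i _; rewrite mulrC. Qed.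

Lemma dotp_sqn u : dotp u u = sqn u.
Proof. by apply: eq_bigr => i _; rewrite expr2. Qed.

Lemma dotpDl u v w : dotp (u + v) w = dotp u w + dotp v w.
Proof.
by rewrite /dotp -big_split; apply: eq_bigr => i _; rewrite !mxE mulrDl.
Qed.

Lemma dotpZl (a : R) u v : dotp (a *: u) v = a * dotp u v.
Proof. by rewrite /dotp mulr_sumr; apply: eq_bigr => i _; rewrite !mxE mulrA. Qed.

Lemma dotpNl u v : dotp (- u) v = - dotp u v.
Proof. by rewrite -scaleN1r dotpZl mulN1r. Qed.

Lemma dotpDr u v w : dotp u (v + w) = dotp u v + dotp u w.
Proof. by rewrite dotpC dotpDl !(dotpC _ u). Qed.

Lemma dotpZr (a : R) u v : dotp u (a *: v) = a * dotp u v.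
Proof. by rewrite dotpC dotpZl dotpC. Qed.

Lemma cauchy_schwarz u v : dotp u v ^+ 2 <= sqn u * sqn v.
Proof.
have H : 0 <= sqn (sqn v *: u + (- dotp u v) *: v) by exact: sqn_ge0.
have [v0|v0] := eqVneq v 0.
  rewrite v0 /dotp big1 ?expr0n ?mulr_ge0 ?sqn_ge0// => i _.
  by rewrite mxE mulr0.
move: H; rewrite -dotp_sqn !(dotpDl, dotpDr, dotpZl, dotpZr) !dotp_sqn.
rewrite (dotpC v u); have := v0; rewrite -sqn_gt0.
set a := sqn u; set b := sqn v; set c := dotp u v => b0.
rewrite (_ : _ + _ = b * (a * b - c ^+ 2)); last by ring.
by rewrite pmulr_rge0// subr_ge0.
Qed.

(** This is the nonnegativity of the Gram determinant of [x], [u], [v]; it comes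
    from Cauchy-Schwarz for [x] and a multiple of its projection to the plane of [u]
    and [v]. *)
Lemma gram3_ge0 x u v :
  dotp x u ^+ 2 * sqn v + dotp x v ^+ 2 * sqn u -
    2 * dotp x u * dotp x v * dotp u v <=
  sqn x * (sqn u * sqn v - dotp u v ^+ 2).
Proof.
set a := dotp x u; set b := dotp x v; set c := dotp u v.
set A := sqn u * sqn v - c ^+ 2.
set B := _ - _.
have A0 : 0 <= A by rewrite subr_ge0 cauchy_schwarz.
pose q := (a * sqn v - b * c) *: u + (b * sqn u - a * c) *: v.
have xq : dotp x q = B.
  by rewrite /q dotpDr !dotpZr /B -/a -/b; ring.
have qq : sqn q = A * B.
  rewrite -dotp_sqn /q !(dotpDl, dotpDr, dotpZl, dotpZr) !dotp_sqn (dotpC v u).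
  by rewrite -/c /A /B; ring.
have := cauchy_schwarz x q; rewrite xq qq => H.
have [B0|B0] := leP B 0.
  by apply: le_trans B0 _; rewrite mulr_ge0// sqn_ge0.
by move: H; rewrite expr2 mulrA ler_pM2r.
Qed.

(** The expression is the squared norm of [<x, u> v - <x, v> u]. *)
Lemma mixed_sqr_ge0 x u v :
  0 <= dotp x u ^+ 2 * sqn v + dotp x v ^+ 2 * sqn u -
    2 * dotp x u * dotp x v * dotp u v.
Proof.
have : 0 <= sqn (dotp x u *: v + (- dotp x v) *: u) by exact: sqn_ge0.
rewrite -dotp_sqn !(dotpDl, dotpDr, dotpZl, dotpZr) !dotp_sqn (dotpC v u).
by congr (0 <= _); ring.
Qed.

Lemma sum_delta (l : 'I_n) (f : 'I_n -> R) :
  \sum_j (j == l)%:R * f j = f l.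
Proof.
rewrite (bigD1 l)//= eqxx mul1r big1 ?addr0// => j /negbTE ->.
by rewrite mul0r.
Qed.

Lemma lin3 (a b c : R) (p q v : V) (l : 'I_n) :
  \sum_j (a * p ord0 j + b * (j == l)%:R + c * q ord0 j) * v ord0 j =
  a * dotp p v + b * v ord0 l + c * dotp q v.
Proof.
rewrite -(sum_delta l (fun j => v ord0 j)) /dotp !mulr_sumr -!big_split.
by apply: eq_bigr => j _; rewrite /=; ring.
Qed.

End dot_product.

Section radial_perturbation.
Context {R : realType} {n : nat}.
Local Notation V := 'rV[R]_n.
Local Notation e i := (delta_mx ord0 i : V).
Implicit Types (x u v w : V).

Definition gk (k : V -> R) x : 'M[R]_n := 1%:M + k x *: (x^T *m x).

Lemma gkE k x i j : gk k x i j = (i == j)%:R + k x * (x ord0 i * x ord0 j).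
Proof. by rewrite /gk !mxE big_ord1 !mxE. Qed.

Lemma ip_gk k x u v : ip (gk k) x u v = dotp u v + k x * dotp x u * dotp x v.
Proof.
rewrite /ip /gk mulmxDr mulmxDl mulmx1 mxE dotpE; congr (_ + _).
rewrite -scalemxAr -scalemxAl mxE -mulrA; congr (_ * _).
rewrite (mulmxA u) -(mulmxA _ x) mxE big_ord1 !dotpE; congr (_ * _).
exact: dotpC.
Qed.

Lemma gk_sym k x : (gk k x)^T = gk k x.
Proof. by apply/matrixP => i j; rewrite mxE !gkE eq_sym [x _ _ * _]mulrC. Qed.

(** Both block factorisations of [M], by its two diagonal blocks, compute the
    same determinant. *)
Lemma det_1Dcolrow (c : 'cV[R]_n) (x : V) :
  \det (1%:M + c *m x) = 1 + (x *m c) ord0 ord0.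
Proof.
pose M := block_mx (1%:M : 'M[R]_1) (- x) c (1%:M : 'M[R]_n).
have E1 : M = block_mx 1%:M 0 c 1%:M *m block_mx 1%:M (- x) 0 (1%:M + c *m x).
  by rewrite mulmx_block !mul1mx !mul0mx !mulmx1 !addr0 mulmxN [- _ + _]addrC addrK.
have E2 : M = block_mx 1%:M (- x) 0 1%:M *m block_mx (1%:M + x *m c) 0 c 1%:M.
  by rewrite mulmx_block !mul1mx !mul0mx !mulmx1 !add0r mulNmx addrK.
have : \det M = \det (1%:M + c *m x).
  by rewrite E1 det_mulmx det_lblock det_ublock !det1 !mul1r.
move=> <-; rewrite E2 det_mulmx det_lblock det_ublock !det1 !mul1r mulr1.
by rewrite det_mx11 !mxE.
Qed.

Lemma det_gk k x : \det (gk k x) = 1 + k x * sqn x.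
Proof.
rewrite /gk scalemxAl det_1Dcolrow -scalemxAr mxE dotpE dotp_sqn.
by [].
Qed.

Lemma invmx_gk k x : 1 + k x * sqn x != 0 ->
  invmx (gk k x) = 1%:M - (k x / (1 + k x * sqn x)) *: (x^T *m x).
Proof.
move=> s0; set c := k x / _; set N := x^T *m x.
have NN : N *m N = sqn x *: N.
  rewrite /N mulmxA -[x^T *m x *m x^T]mulmxA.
  rewrite (_ : x *m x^T = (sqn x)%:M) ?mul_mx_scalar -?scalemxAl//.
  by rewrite [LHS]mx11_scalar dotpE dotp_sqn.
have H : gk k x *m (1%:M - c *: N) = 1%:M.
  rewrite /gk -/N mulmxBr mulmx1 mulmxDl mul1mx -scalemxAl -scalemxAr NN.
  rewrite !scalerA opprD addrA -[X in X - _]addrA -scalerBl -addrA -scalerBl.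
  rewrite (_ : _ - _ - _ = 0) ?scale0r ?addr0//.
  by rewrite /c; field.
have u := (mulmx1_unit H).1.
move/(congr1 (mulmx (invmx (gk k x)))): H.
by rewrite mulmxA mulVmx// mul1mx mulmx1.
Qed.

Lemma invmx_gkE k x i j : 1 + k x * sqn x != 0 ->
  invmx (gk k x) i j =
  (i == j)%:R - (k x / (1 + k x * sqn x)) * (x ord0 i * x ord0 j).
Proof. by move=> s0; rewrite invmx_gk// !mxE big_ord1 !mxE. Qed.

(* [k] is a function of the squared radius, and [k1], [k2] are its derivatives
   with respect to it. *)
Variables (k k1 k2 : V -> R).
Hypothesis dk : forall i x, is_derive x (e i) k (2 * k1 x * x ord0 i).
Hypothesis dk1 : forall i x, is_derive x (e i) k1 (2 * k2 x * x ord0 i).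
Hypothesis s_neq0 : forall x, 1 + k x * sqn x != 0.

Let S x := 1 + k x * sqn x.

Lemma isd_S i x : is_derive x (e i) S (2 * (k1 x * sqn x + k x) * x ord0 i).
Proof.
apply: is_derive_eq (isdD (isdC 1 x (e i)) (isdM (dk i x) (isd_sqn x (e i)))) _.
by rewrite dotp_e; ring.
Qed.

(** The Christoffel symbols are [x_l (al x_i x_j + be delta_ij)]; [al1] is the
    derivative of [al] with respect to the squared radius. *)
Definition al x := k1 x / S x.
Definition be x := k x / S x.

Lemma isd_be i x :
  is_derive x (e i) be (2 * ((k1 x - k x ^+ 2) / S x ^+ 2) * x ord0 i).
Proof.
apply: is_derive_eq (isdM (dk i x) (isdV (f := S) (s_neq0 x) (isd_S i x))) _.
by rewrite /S; field; exact: s_neq0.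
Qed.

Definition al1 x := (k2 x * S x - k1 x * (k1 x * sqn x + k x)) / S x ^+ 2.

Lemma isd_al i x : is_derive x (e i) al (2 * al1 x * x ord0 i).
Proof.
apply: is_derive_eq (isdM (dk1 i x) (isdV (f := S) (s_neq0 x) (isd_S i x))) _.
by rewrite /al1 /S; field; exact: s_neq0.
Qed.

Lemma pderiv_gk l i j x : pderiv l (fun y => gk k y i j) x =
  2 * k1 x * x ord0 l * (x ord0 i * x ord0 j) +
  k x * ((i == l)%:R * x ord0 j + x ord0 i * (j == l)%:R).
Proof.
have H : (fun y => gk k y i j) =
    (fun y => (i == j)%:R + k y * (y ord0 i * y ord0 j)).
  by apply/funext => y; rewrite gkE.
rewrite H; apply: isd_val.
apply: is_derive_eq (isdD (isdC _ _ _) (isdM (dk l x)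
  (isdM (isd_coord i x (e l)) (isd_coord j x (e l))))) _.
by rewrite !mxE eqxx/= add0r.
Qed.

Lemma christoffel_gk l i j x : christoffel (gk k) l i j x =
  x ord0 l * (al x * (x ord0 i * x ord0 j) + be x * (i == j)%:R).
Proof.
rewrite /christoffel.
have H p : pderiv i (fun y => gk k y j p) x + pderiv j (fun y => gk k y i p) x
     - pderiv p (fun y => gk k y i j) x =
   2 * (k1 x * (x ord0 i * x ord0 j) + k x * (i == j)%:R) * x ord0 p.
  by rewrite !pderiv_gk (eq_sym j i) (eq_sym p i) (eq_sym p j); ring.
under eq_bigr do rewrite H invmx_gkE//.
set c := k1 x * _ + _.
rewrite (eq_bigr (fun p => (((- (k x / S x) * x ord0 l * 2 * c) * x ord0 p
  + (2 * c) * (p == l)%:R + 0 * x ord0 p) * x ord0 p))); last first.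
  by move=> p _; rewrite (eq_sym p l) -/(S x); ring.
rewrite lin3 dotp_sqn mul0r addr0.
rewrite (_ : al x * _ + _ = c / S x); last first.
  by rewrite /al /be /c; field; exact: s_neq0.
by rewrite /S; field; exact: s_neq0.
Qed.

(** The terms with [al1] cancel, being symmetric in [i] and [j]. *)
Lemma riemann_coef_gk l i j p x : riemann_coef (gk k) l i j p x =
  (i == l)%:R * (al x * (x ord0 j * x ord0 p) + be x * (j == p)%:R)
  - (j == l)%:R * (al x * (x ord0 i * x ord0 p) + be x * (i == p)%:R)
  + x ord0 l * (al x - 2 * ((k1 x - k x ^+ 2) / S x ^+ 2)
                - be x * (al x * sqn x + be x)) *
     ((i == p)%:R * x ord0 j - (j == p)%:R * x ord0 i).
Proof.
rewrite /riemann_coef.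
have D a b c q : pderiv a (christoffel (gk k) q b c) x =
  (a == q)%:R * (al x * (x ord0 b * x ord0 c) + be x * (b == c)%:R) +
  x ord0 q * (2 * al1 x * x ord0 a * (x ord0 b * x ord0 c) +
   al x * ((a == b)%:R * x ord0 c + x ord0 b * (a == c)%:R) +
   2 * ((k1 x - k x ^+ 2) / S x ^+ 2) * x ord0 a * (b == c)%:R).
  rewrite (_ : christoffel (gk k) q b c = fun z => z ord0 q *
    (al z * (z ord0 b * z ord0 c) + be z * (b == c)%:R)); last first.
    by apply/funext => z; exact: christoffel_gk.
  apply: isd_val.
  apply: is_derive_eq (isdM (isd_coord q x (e a)) (isdD (isdM (isd_al a x)
    (isdM (isd_coord b x (e a)) (isd_coord c x (e a))))
    (isdM (isd_be a x) (isdC _ _ _)))) _.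
  by rewrite !mxE eqxx/= !(eq_sym a); ring.
have Q a b : \sum_q christoffel (gk k) q a p x * christoffel (gk k) l b q x =
    x ord0 l * (al x * (x ord0 a * x ord0 p) + be x * (a == p)%:R) *
    (al x * sqn x + be x) * x ord0 b.
  set c := al x * (x ord0 a * x ord0 p) + be x * (a == p)%:R.
  rewrite (eq_bigr (fun q => ((x ord0 l * c * al x * x ord0 b) * x ord0 q
    + (x ord0 l * c * be x) * (q == b)%:R + 0 * x ord0 q) * x ord0 q)).
    by rewrite lin3 dotp_sqn; ring.
  by move=> q _; rewrite !christoffel_gk -/c (eq_sym b q); ring.
rewrite sumrB !Q !D (eq_sym j i); ring.
Qed.

Lemma riemann_gk x u v w : riemann (gk k) x u v w =
  (al x * dotp x v * dotp x w + be x * dotp v w) *: u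
  - (al x * dotp x u * dotp x w + be x * dotp u w) *: v
  + ((al x - 2 * ((k1 x - k x ^+ 2) / S x ^+ 2)
                - be x * (al x * sqn x + be x)) *
     (dotp u w * dotp x v - dotp v w * dotp x u)) *: x.
Proof.
apply/rowP => l; rewrite !mxE.
set ga := al x - _ - _.
have H1 i j : \sum_p riemann_coef (gk k) l i j p x * u ord0 i * v ord0 j * w ord0 p =
   u ord0 i * (((i == l)%:R * al x * dotp x w + x ord0 l * ga * w ord0 i) * x ord0 j
   + (- (al x * x ord0 i * dotp x w + be x * w ord0 i)) * (j == l)%:R
   + ((i == l)%:R * be x - x ord0 l * ga * x ord0 i) * w ord0 j) * v ord0 j.
  rewrite (eq_bigr (fun p => ((u ord0 i * v ord0 j * ((i == l)%:R * al x * x ord0 j -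
     (j == l)%:R * al x * x ord0 i)) * x ord0 p
     + (u ord0 i * v ord0 j * ((i == l)%:R * be x - x ord0 l * ga * x ord0 i)) * (p == j)%:R
     + 0 * x ord0 p) * w ord0 p +
     (0 * x ord0 p
     + (u ord0 i * v ord0 j * (x ord0 l * ga * x ord0 j - (j == l)%:R * be x)) * (p == i)%:R
     + 0 * x ord0 p) * w ord0 p)); last first.
    move=> p _; rewrite riemann_coef_gk -/ga (eq_sym p j) (eq_sym p i); ring.
  by rewrite big_split /= !lin3; ring.
have H2 i : \sum_j \sum_p riemann_coef (gk k) l i j p x * u ord0 i * v ord0 j * w ord0 p =
   ((- (al x * v ord0 l * dotp x w + x ord0 l * ga * dotp v w)) * x ord0 i
    + (al x * dotp x v * dotp x w + be x * dotp v w) * (i == l)%:R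
    + (x ord0 l * ga * dotp x v - be x * v ord0 l) * w ord0 i) * u ord0 i.
  under eq_bigr do rewrite H1 -mulrA.
  by rewrite -mulr_sumr lin3 (dotpC w v); ring.
under eq_bigr do rewrite H2.
by rewrite lin3 (dotpC w u); ring.
Qed.

(** The first bracket measures the plane of [u] and [v], the second one its
    inclination towards the radial direction. *)
Lemma ip_riemann_gk x u v : ip (gk k) x (riemann (gk k) x u v v) u =
  (k x * (sqn u * sqn v - dotp u v ^+ 2) +
   k1 x * (dotp x u ^+ 2 * sqn v + dotp x v ^+ 2 * sqn u -
     2 * dotp x u * dotp x v * dotp u v)) / S x.
Proof.
rewrite ip_gk riemann_gk !(dotpC x) !(dotpDl, dotpNl, dotpZl, dotp_sqn).
rewrite !(dotpC x) (dotpC v u).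
rewrite /al /be /S; field; exact: s_neq0.
Qed.

End radial_perturbation.

(** * The metric: smoothness, curvature, and absence of Euclidean charts *)

Section open_sets.
Context {R : realType} {n : nat}.
Local Notation V := 'rV[R]_n.

Definition U0 : set V := [set x | x != 0].
Definition B1 : set V := [set x | sqn x < 1].

Lemma open_U0 : open U0.
Proof.
have -> : U0 = sqn @^-1` [set y | 0 < y].
  by apply/seteqP; split=> x; rewrite /U0 /= sqn_gt0.
by apply: open_comp; [move=> x _; exact: continuous_sqn|exact: open_gt].
Qed.

Lemma open_B1 : open B1.
Proof.
have -> : B1 = sqn @^-1` [set y | y < 1] by [].
by apply: open_comp; [move=> x _; exact: continuous_sqn|exact: open_lt].
Qed.

Lemma U0_B1 : U0 `|` B1 = setT.
Proof.
apply/seteqP; split=> // x _; have [->|] := eqVneq x 0; last by left.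
by right; rewrite /B1 /= (_ : sqn 0 = 0) ?ltr01//; apply/eqP; rewrite sqn_eq0.
Qed.

(** Radial functions that are constant on the unit ball need only be examined
    off the origin, where the radius is smooth. *)
Lemma Ck_glue k (f : V -> R) (c : R) : Ck k U0 f ->
  (forall x, sqn x < 1 -> f x = c) -> Ck k setT f.
Proof.
move=> Hf fc; rewrite -U0_B1; apply: CkU => //.
by apply: (@eq_Ck _ _ _ _ (fun=> c)); [exact: open_B1|move=> x /fc|exact: CkC open_B1].
Qed.

End open_sets.

Section isometry_flat.
Context {R : realType} {n : nat}.
Local Notation V := 'rV[R]_n.
Local Notation e i := (delta_mx ord0 i : V).

Lemma ip_e (g : V -> 'M[R]_n) x i j : ip g x (e i) (e j) = g x i j.
Proof.
by rewrite /ip -rowE trmx_delta -colE !mxE.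
Qed.

Lemma ip_euclidean x (u v : V) : ip (euclidean_metric R n) x u v = dotp u v.
Proof. by rewrite /ip /euclidean_metric mulmx1 dotpE. Qed.

(** If [g] is the pullback of the Euclidean metric by [F], then the Jacobian
    [J] of [F] is parallel, [d_i J = J Gamma_i], and the symmetry of
    [d_l d_i J] is the vanishing of the curvature. *)
Lemma isometric_flat (g : V -> 'M[R]_n) :
  (forall x, g x \in unitmx) ->
  (forall p i j l x, derivable (christoffel g p i j) x (e l)) ->
  isometric g (euclidean_metric R n) -> flat g.
Proof.
move=> gu dG [F [F' [sF _ _ _ isoF]]].
pose f a : V -> R := fun x => F x ord0 a.
have Cf k a : Ck k setT (f a) by apply/is_CkP; exact: sF.
pose J a i := pderiv i (f a).
pose H a i j := pderiv j (J a i).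
have DF x i a : ('D_(e i) F x) ord0 a = J a i x.
  have dF : derivable F x (e i).
    apply/derivable_mxP => b c; have -> : b = ord0 by apply/val_inj; case: b => [[]].
    exact: isd_ex (Ck_der (Cf 1%N c) i I).
  by rewrite derive_mx// mxE.
have gJ x i j : g x i j = \sum_a J a i x * J a j x.
  rewrite -ip_e -isoF ip_euclidean; apply: eq_bigr => a _.
  by rewrite !DF.
have dJ a i l x : is_derive x (e l) (J a i) (H a i l x).
  exact: Ck_der (Ck_pderiv i (Cf 2%N a)) l x I.
have Hs a i j x : H a i j x = H a j i x.
  exact: schwarz openT (Cf 2%N a) I.
have dg l i j x : pderiv l (fun y => g y i j) x =
    \sum_a (H a i l x * J a j x + J a i x * H a j l x).
  rewrite (_ : (fun y => g y i j) = fun y => \sum_a J a i y * J a j y).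
    by apply: isd_val; apply: isd_sum => a; exact: isdM.
  by apply/funext => y; exact: gJ.
pose Jm x : 'M[R]_n := \matrix_(a, i) J a i x.
have gJm x : g x = (Jm x)^T *m Jm x.
  by apply/matrixP => i j; rewrite gJ mxE; apply: eq_bigr => a _; rewrite !mxE.
have JJ x : Jm x *m (invmx (g x) *m (Jm x)^T) = 1%:M.
  by apply: mulmx1C; rewrite -mulmxA -gJm mulVmx.
(* As [g = J^T J], the Christoffel symbols are the Hessian of [F] in the
   frame [J]. *)
have Gam p i j x : christoffel g p i j x =
    \sum_a H a i j x * (invmx (g x) *m (Jm x)^T) p a.
  rewrite /christoffel.
  rewrite (eq_bigr (fun l => \sum_a 2 * (H a i j x * (invmx (g x) p l * J a l x)))).
    rewrite exchange_big mulr_sumr /=; apply: eq_bigr => a _.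
    rewrite -mulr_sumr mulKf ?pnatr_eq0// -mulr_sumr; congr (_ * _).
    by rewrite mxE; apply: eq_bigr => l _; rewrite !mxE.
  move=> l _; rewrite !dg -big_split -sumrB mulr_sumr; apply: eq_bigr => a _ /=.
  rewrite (Hs a j i x) (Hs a l i x) (Hs a l j x).
  move: (H a i j x) (H a i l x) (H a j l x) (J a i x) (J a j x) (J a l x).
  by move: (invmx (g x) p l) => *; ring.
have par b i j x : H b j i x = \sum_p J b p x * christoffel g p i j x.
  under eq_bigr do rewrite Gam mulr_sumr.
  rewrite exchange_big /=.
  rewrite (eq_bigr (fun a => (a == b)%:R * H a i j x)).
    by rewrite sum_delta Hs.
  move=> a _; under eq_bigr do rewrite mulrCA.
  rewrite -mulr_sumr mulrC; congr (_ * _).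
  have /matrixP/(_ b a) := JJ x; rewrite mxE eq_sym [RHS]mxE => <-.
  by apply: eq_bigr => p _; rewrite [Jm x b p]mxE.
have dH b i j l x : pderiv l (H b j i) x =
    \sum_q J b q x * (pderiv l (christoffel g q i j) x +
      \sum_p christoffel g p i j x * christoffel g q l p x).
  rewrite (_ : H b j i = fun z => \sum_p J b p z * christoffel g p i j z); last first.
    by apply/funext => z; exact: par.
  rewrite /pderiv (isd_val (isd_sum _ (fun p => isdM (dJ b p l x)
    (derivableP (dG p i j l x))))).
  under [RHS]eq_bigr do rewrite mulrDr.
  rewrite !big_split /= addrC; congr (_ + _).
  under eq_bigr do rewrite par mulr_suml.
  rewrite exchange_big; apply: eq_bigr => q _; rewrite mulr_sumr.
  by apply: eq_bigr => p _; ring.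
have R0 q l i j x : riemann_coef g q l i j x = 0.
  pose c : 'cV[R]_n := \col_q riemann_coef g q l i j x.
  have Jc : Jm x *m c = 0.
    apply/colP => b; rewrite !mxE.
    transitivity (pderiv l (H b j i) x - pderiv i (H b j l) x); last first.
      apply/eqP; rewrite subr_eq0; apply/eqP.
      exact: schwarz openT (Ck_pderiv j (Cf 3%N b)) I.
    rewrite !dH -sumrB; apply: eq_bigr => r _.
    rewrite [Jm x b r]mxE [c r 0]mxE /riemann_coef sumrB -mulrBr; congr (_ * _).
    by rewrite opprD addrACA addrA.
  have : invmx (g x) *m (Jm x)^T *m (Jm x *m c) = c.
    by rewrite mulmxA -[X in X *m c]mulmxA -gJm mulVmx// mul1mx.
  by rewrite Jc mulmx0 => /colP/(_ q); rewrite !mxE.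
move=> x u v z; apply/rowP => l; rewrite !mxE big1// => i _.
by rewrite big1// => j _; rewrite big1// => p _; rewrite R0 !mul0r.
Qed.

End isometry_flat.

Section the_metric.
Context {R : realType} (m : nat).
Hypothesis m_gt0 : (0 < m)%N.
Local Notation n := m.+2.
Local Notation V := 'rV[R]_n.
Local Notation e i := (delta_mx ord0 i : V).
Implicit Types (x u v : V).

Definition kx x : R := kf m (sqn x).
Definition sx x : R := sf m (sqn x).
Definition gm : V -> 'M[R]_n := gk kx.

Lemma isd_radial (phi dphi : R -> R) i x :
  is_derive (sqn x) 1 phi (dphi (sqn x)) ->
  is_derive x (e i) (fun z => phi (sqn z)) (2 * dphi (sqn x) * x ord0 i).
Proof.
move=> H; apply: is_derive_eq (isd_comp H (isd_sqn x (e i))) _.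
by rewrite dotp_e; ring.
Qed.

Lemma S_kx x : 1 + kx x * sqn x = sx x ^+ 2.
Proof. by rewrite /kx kfy// sqn_ge0. Qed.

Lemma sx_gt0 x : 0 < sx x.
Proof. exact: sf_gt0. Qed.

Lemma S_neq0 x : 1 + kx x * sqn x != 0.
Proof. by rewrite S_kx gt_eqF// exprn_gt0// sx_gt0. Qed.

Lemma isd_kx i x : is_derive x (e i) kx (2 * k1 m (sqn x) * x ord0 i).
Proof. exact: isd_radial (isd_kf m _). Qed.

(** This second derivative makes the Christoffel symbols differentiable. It
    cancels from the curvature, so that its existence is all that matters. *)
Lemma ex_derive_k1 (y : R) : exists d, is_derive y 1 (@k1 R m) d.
Proof.
have [y0|y0] := leP y 0.
  exists 0; apply: isd_near (isdC 0 y 1).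
  near=> z; rewrite k1_le1// ltW//; near: z; apply: lt_nbhsl.
  exact: le_lt_trans y0 _.
have dE2 := isdMl (expR 1) (isd_flat ('X^3) (v m y)).
have ds1 := isdM (isd_comp (phi := E2) dE2 (isd_v m y0))
  (isdMl (m%:R / 2) (isdX m.+2 (isd_w y0))).
have H := isdB (isdM (isdM (isdMl 2 (isd_sf m y)) ds1) (isdX 2 (isd_w y0)))
  (isdM (isdB (isdX 2 (isd_sf m y)) (isdC 1 y 1)) (isdX 4 (isd_w y0))).
by eexists; exact: H.
Unshelve. all: by end_near. Qed.

Definition k2 (y : R) : R := projT1 (cid (ex_derive_k1 y)).

Lemma isd_k1 (y : R) : is_derive y 1 (@k1 R m) (k2 y).
Proof. exact: projT2 (cid (ex_derive_k1 y)). Qed.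

Lemma isd_k1x i x : is_derive x (e i) (fun z => k1 m (sqn z))
  (2 * k2 (sqn x) * x ord0 i).
Proof. exact: isd_radial (isd_k1 _). Qed.

Lemma Ck_w k : Ck k U0 (fun x : V => w (sqn x)).
Proof.
apply: Ck_comp smooth1_w _ (Ck_sqn _ open_U0); first exact: open_U0.
by move=> x; rewrite /U0 /= sqn_gt0.
Qed.

Lemma Ck_v k : Ck k U0 (fun x : V => v m (sqn x)).
Proof.
apply: (@eq_Ck _ _ _ _ (fun x => 1 - w (sqn x) ^+ m)); first exact: open_U0.
  by move=> x; rewrite /U0 /= -sqn_gt0 /v => ->.
by apply: CkB (CkC _ _ _) (CkX _ _ (Ck_w k)); exact: open_U0.
Qed.

Lemma Ck_sx0 k : Ck k U0 sx.
Proof.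
apply: CkD open_U0 (CkC _ _ open_U0) _.
exact: Ck_comp open_U0 (smooth1_E1 setT) _ (Ck_v k).
Qed.

Lemma Ck_sx k : Ck k setT sx.
Proof.
by apply: (Ck_glue (c := 1) (Ck_sx0 k)) => x x1; rewrite /sx sf_le1// ltW.
Qed.

Lemma Ck_kx k : Ck k setT kx.
Proof.
apply: (Ck_glue (c := 0)); last by move=> x x1; rewrite /kx kf_le1// ltW.
apply: CkM open_U0 _ (CkX _ open_U0 (Ck_w k)).
exact: CkB open_U0 (CkX _ open_U0 (Ck_sx0 k)) (CkC _ _ open_U0).
Qed.

Lemma Ck_gm k i j : Ck k setT (fun x => gm x i j).
Proof.
rewrite (_ : (fun x => _) = fun x => (i == j)%:R + kx x * (x ord0 i * x ord0 j)).
  apply: CkD openT (CkC _ _ openT) _; apply: CkM openT (Ck_kx k) _.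
  by apply: CkM openT _ _; exact: Ck_coord openT.
by apply/funext => x; rewrite /gm gkE.
Qed.

Lemma ip_gm x u v : ip gm x u v = dotp u v + kx x * dotp x u * dotp x v.
Proof. exact: ip_gk. Qed.

Lemma kx_ge0 x : 0 <= kx x.
Proof. exact: kf_ge0. Qed.

Lemma gm_riemannian : riemannian_metric gm.
Proof.
split=> [x|x u u0|i j]; first exact: gk_sym.
  rewrite ip_gm dotp_sqn ltr_pwDl ?sqn_gt0//.
  by rewrite -mulrA mulr_ge0 ?kx_ge0// -expr2 sqr_ge0.
by apply/smoothP => k; exact: Ck_gm.
Qed.

Lemma gm_euclidean_near : \forall x \near (0 : V), gm x = euclidean_metric R n x.
Proof.
near=> x; apply/matrixP => i j; rewrite /gm gkE /kx kf_le1 ?mul0r ?addr0 ?mxE//.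
apply: ltW; near: x.
apply: open_nbhs_nbhs; split; first exact: open_B1.
by rewrite /B1 /= (_ : sqn 0 = 0) ?ltr01//; apply/eqP; rewrite sqn_eq0.
Unshelve. all: by end_near. Qed.

Lemma ip_riemann_gm x u v : ip gm x (riemann gm x u v v) u =
  (kx x * (sqn u * sqn v - dotp u v ^+ 2) +
   k1 m (sqn x) * (dotp x u ^+ 2 * sqn v + dotp x v ^+ 2 * sqn u -
     2 * dotp x u * dotp x v * dotp u v)) / sx x ^+ 2.
Proof. by rewrite -S_kx; exact: ip_riemann_gk isd_kx isd_k1x S_neq0 x u v. Qed.

Lemma gm_nonneg_sectional : nonneg_sectional gm.
Proof.
move=> x u v _; rewrite /sectional ip_riemann_gm.
have B0 := mixed_sqr_ge0 x u v; have AB := gram3_ge0 x u v.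
have CS := cauchy_schwarz u v.
set B := _ - 2 * _ * _ * _ in B0 AB *; set A := sqn u * sqn v - _ in AB *.
have A0 : 0 <= A by rewrite subr_ge0.
apply: divr_ge0.
  apply: divr_ge0; last by rewrite exprn_ge0// ltW// sx_gt0.
  have [->|x0] := eqVneq x 0.
    have s0 : sqn (0 : V) = 0 by apply/eqP; rewrite sqn_eq0.
    by rewrite /kx s0 kf_le1// k1_le1// !mul0r addr0.
  have y0 : 0 < sqn x by rewrite sqn_gt0.
  have wy := w_sqr y0.
  rewrite /kx /kf /k1; set s := sf m _; set s1 := sf1 m _; set W := w _ in wy *.
  have s_ge1 : 1 <= s := sf_ge1 _ _; have s_ge0 := le_trans ler01 s_ge1.
  have s10 : 0 <= s1 := sf1_ge0 _ _.
  (* Since [W ^ 2 * sqn x = 1], this separates the curvature of the tangential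
     planes, with [sqn x * A - B >= 0], from that of the radial ones. *)
  have -> : (s ^+ 2 - 1) * W ^+ 2 * A +
     (2 * s * s1 * W ^+ 2 - (s ^+ 2 - 1) * W ^+ 4) * B =
     (s ^+ 2 - 1) * W ^+ 4 * (sqn x * A - B) + 2 * s * s1 * W ^+ 2 * B +
     (s ^+ 2 - 1) * W ^+ 2 * A * (1 - W ^+ 2 * sqn x) by ring.
  rewrite wy subrr mulr0 addr0 addr_ge0// mulr_ge0//.
  - by rewrite mulr_ge0 ?exprn_ge0 ?w_ge0// subr_ge0 exprn_ege1.
  - by rewrite subr_ge0.
  - by rewrite mulr_ge0 ?exprn_ge0 ?w_ge0// mulr_ge0// mulr_ge0.
rewrite !ip_gm !dotp_sqn.
rewrite (_ : _ - _ = A + kx x * B); last by rewrite /A /B; ring.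
by rewrite addr_ge0// mulr_ge0// kx_ge0.
Qed.

Lemma gm_not_flat : ~ flat gm.
Proof.
have [k Ek] : exists k, m = k.+1 by exists m.-1; rewrite prednK.
pose i0 : 'I_n := ord0; pose i1 : 'I_n := inord 1; pose i2 : 'I_n := inord 2.
have d01 : i0 != i1 by rewrite -val_eqE /= inordK.
have d02 : i0 != i2 by rewrite -val_eqE /= inordK// Ek.
have d12 : i1 != i2 by rewrite -val_eqE /= !inordK// Ek.
have dd i j : dotp (e i) (e j) = (i == j)%:R by rewrite dotp_e mxE eqxx eq_sym.
(* The plane of [e i1] and [e i2] is tangent to the sphere at [2 e i0]. *)
move=> /(_ (2 *: e i0) (e i1) (e i2) (e i2)) H.
have := ip_riemann_gm (2 *: e i0) (e i1) (e i2); rewrite H.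
have d0 (z : V) : dotp 0 z = 0 by rewrite -(scale0r 0) dotpZl mul0r.
have x1 : dotp (2 *: e i0) (e i1) = 0 by rewrite dotpZl dd (negbTE d01) mulr0.
have x2 : dotp (2 *: e i0) (e i2) = 0 by rewrite dotpZl dd (negbTE d02) mulr0.
have y1 : 1 < sqn (2 *: e i0).
  by rewrite -dotp_sqn dotpZl dotpZr dd eqxx /=; lra.
rewrite ip_gm d0 (dotpC _ 0) d0 -(dotp_sqn (e i1)) -(dotp_sqn (e i2)) !dd.
rewrite x1 x2 !eqxx (negbTE d12) /=.
have k0 : 0 < kx (2 *: e i0).
  rewrite /kx /kf mulr_gt0 ?(exprn_gt0, w_gt0, lt_trans ltr01 y1)//.
  rewrite subr_gt0.
  by rewrite exprn_egt1// /sf ltrDl E1_gt0// v_gt0.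
have s0 := exprn_gt0 2 (sx_gt0 (2 *: e i0)).
move=> Ek2; have := divr_gt0 k0 s0.
have -> : kx (2 *: e i0) / sx (2 *: e i0) ^+ 2 = 0; last by rewrite ltxx.
by apply: etrans (etrans (esym Ek2) _); [congr (_ / _); ring|ring].
Qed.

Lemma gm_not_isometric : ~ isometric gm (euclidean_metric R n).
Proof.
move=> iso; apply: gm_not_flat; apply: isometric_flat iso => [x|p i j l x].
  rewrite unitmxE unitfE det_gk; exact: S_neq0.
rewrite (_ : christoffel gm p i j = fun z => z ord0 p *
    (al kx (fun z => k1 m (sqn z)) z * (z ord0 i * z ord0 j) +
     be kx z * (i == j)%:R)); last first.
  by apply/funext => z; exact: christoffel_gk isd_kx S_neq0 p i j z.
exact: isd_ex (isdM (isd_coord p x (e l)) (isdD (isdM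
  (isd_al isd_kx isd_k1x S_neq0 l x)
  (isdM (isd_coord i x (e l)) (isd_coord j x (e l))))
  (isdM (isd_be isd_kx S_neq0 l x) (isdC _ _ _)))).
Qed.

End the_metric.

(** * Lengths of curves, the distance, and completeness *)

Section one_variable_integrals.
Context {R : realType}.
Local Notation mu := (@lebesgue_measure R).

Lemma isd_cont (F : R -> R) (t a : R) :
  is_derive t 1 F a -> {for t, continuous F}.
Proof.
move=> H; apply: differentiable_continuous; apply/derivable1_diffP.
exact: isd_ex H.
Qed.

Lemma FTC2_everywhere (f F : R -> R) (a b : R) : a < b -> continuous f ->
  (forall t : R, is_derive t 1 F (f t)) ->
  (\int[mu]_(x in `[a, b]) (f x)%:E = (F b - F a)%:E)%E.
Proof.
move=> ab cf dF; rewrite (@continuous_FTC2 _ f F)//.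
- exact: continuous_subspaceT.
- split=> [x _||].
  + exact: isd_ex (dF x).
  + by apply: cvg_at_right_filter; exact: isd_cont (dF a).
  + by apply: cvg_at_left_filter; exact: isd_cont (dF b).
- by move=> x _; rewrite derive1E (isd_val (dF x)).
Qed.

Lemma continuous_integrable (f : R -> R) (a b : R) : continuous f ->
  mu.-integrable `[a, b] (EFin \o f).
Proof.
move=> cf; apply: continuous_compact_integrable; first exact: segment_compact.
exact: continuous_subspaceT.
Qed.

End one_variable_integrals.

Section curves.
Context {R : realType} {n : nat}.
Local Notation V := 'rV[R]_n.
Local Notation mu := (@lebesgue_measure R).
Implicit Types (g : V -> 'M[R]_n) (c : R -> V) (u v x y : V).

Lemma C1_coord c (t : R) j : derivable c t 1 ->
  is_derive t 1 (fun z => c z ord0 j) (derive1 c t ord0 j).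
Proof.
move=> dc; have /derivable_mxP/(_ ord0 j) dj := dc.
apply: DeriveDef; first exact: dj.
by rewrite derive1E derive_mx// mxE.
Qed.

Lemma isd_dotp c u (t : R) : derivable c t 1 ->
  is_derive t 1 (fun z => dotp (c z) u) (dotp (derive1 c t) u).
Proof.
move=> dc; apply: isd_sum => j.
apply: is_derive_eq (isdM (C1_coord j dc) (isdC _ _ _)) _.
by rewrite mulr0 addr0.
Qed.

Lemma cvg_sumf (T I : Type) (F : set_system T) (FF : Filter F) (r : seq I)
    (h : I -> T -> R) (l : I -> R) : (forall i, h i z @[z --> F] --> l i) ->
  \sum_(i <- r) h i z @[z --> F] --> \sum_(i <- r) l i.
Proof.
move=> H; elim: r => [|i r IH].
  rewrite big_nil (_ : (fun z => _) = fun=> 0); first exact: cvg_cst.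
  by apply/funext => z; rewrite big_nil.
rewrite big_cons (_ : (fun z => _) = fun z => h i z + \sum_(j <- r) h j z).
  by apply: cvgD.
by apply/funext => z; rewrite big_cons.
Qed.

Lemma cont_comp (T T' T'' : topologicalType) (h : T -> T') (f : T' -> T'') z :
  {for z, continuous h} -> {for h z, continuous f} ->
  {for z, continuous (fun t => f (h t))}.
Proof. exact: continuous_comp. Qed.

Lemma cont_comp_coord (T : topologicalType) (h : T -> V) j : continuous h ->
  continuous (fun z => h z ord0 j).
Proof. by move=> ch z; exact: (cont_comp (ch z) (@continuous_coord R n j (h z))). Qed.

Lemma ipE g x u v :
  ip g x u v = \sum_j (\sum_i u ord0 i * g x i j) * v ord0 j.
Proof. by rewrite /ip mxE; apply: eq_bigr => j _; rewrite !mxE. Qed.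

Section length_bounds.
Variable g : V -> 'M[R]_n.
Hypothesis cg : forall i j, continuous (fun x => g x i j).
Hypothesis g_ge : forall x v, sqn v <= ip g x v v.

Let speed c t := Num.sqrt (ip g (c t) (derive1 c t) (derive1 c t)).

Lemma continuous_speed c : C1_curve c -> continuous (speed c).
Proof.
move=> [dc cc] t; apply: continuous_comp; last exact: sqrt_continuous.
have ct : continuous c.
  by move=> s; apply: differentiable_continuous; apply/derivable1_diffP; exact: dc.
rewrite (_ : (fun t => _) = fun t => \sum_j (\sum_i derive1 c t ord0 i * g (c t) i j)
    * derive1 c t ord0 j); last by apply/funext => s; exact: ipE.
apply: continuous_sumf => j; apply: contM; last exact: cont_comp_coord.
apply: continuous_sumf => i; apply: contM; first exact: cont_comp_coord.
by apply: (@cont_comp _ _ _ c (fun x => g x i j) t); [exact: ct|exact: cg].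
Qed.

Lemma length_ge0 c : 0 <= curve_length g c.
Proof. by apply: Rintegral_ge0 => t _; exact: sqrtr_ge0. Qed.

(** The increment of the linear function [dotp _ u] is at most the Euclidean
    length, by Cauchy-Schwarz. *)
Lemma length_ge c u : C1_curve c -> sqn u <= 1 ->
  dotp (c 1 - c 0) u <= curve_length g c.
Proof.
move=> Hc u1; have [dc cc] := Hc.
have cd : continuous (fun t => dotp (derive1 c t) u).
  move=> t; apply: continuous_sumf => j; apply: contM; last exact: cst_continuous.
  exact: cont_comp_coord.
have -> : dotp (c 1 - c 0) u =
    \int[mu]_(t in `[0, 1]) dotp (derive1 c t) u.
  rewrite /Rintegral (FTC2_everywhere ltr01 cd (fun t => isd_dotp u (dc t))).
  by rewrite dotpDl dotpNl.
apply: le_Rintegral; first exact: measurable_itv.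
- exact: continuous_integrable.
- by apply: continuous_integrable; exact: continuous_speed.
- move=> t _; apply: le_trans (ler_norm _) _; rewrite -sqrtr_sqr.
  apply: ler_wsqrtr; apply: le_trans (cauchy_schwarz _ _) _.
  apply: le_trans (g_ge _ _); rewrite -[leRHS]mulr1.
  by rewrite ler_wpM2l// sqn_ge0.
Qed.

Lemma length_le c (M : R) : C1_curve c ->
  (forall t, 0 <= t <= 1 -> speed c t <= M) -> curve_length g c <= M.
Proof.
move=> Hc cM.
have -> : M = \int[mu]_(t in `[0, 1]) (fun=> M) t.
  by rewrite Rintegral_cst//= lebesgue_measure_itv/= lte_fin ltr01 oppr0 adde0 mulr1.
apply: le_Rintegral; first exact: measurable_itv.
- by apply: continuous_integrable; exact: continuous_speed.
- by apply: continuous_integrable; exact: cst_continuous.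
- by move=> t /=; rewrite in_itv/=; exact: cM.
Qed.

Lemma joins_ge x s y u : joins x s y -> sqn u <= 1 ->
  dotp (y - x) u <= \sum_(c <- s) curve_length g c.
Proof.
move=> + u1; elim: s x => [|c s IH] x /=.
  by move=> ->; rewrite subrr big_nil -(scale0r 0) dotpZl mul0r.
move=> [Hc <- /IH H]; rewrite big_cons.
rewrite (_ : y - c 0 = (c 1 - c 0) + (y - c 1)); last first.
  by rewrite [RHS]addrC addrA subrK.
by rewrite dotpDl lerD// length_ge.
Qed.

Definition segment x y : R -> V := fun t => x + t *: (y - x).

Lemma derive_segment x y (t : R) : is_derive t 1 (segment x y) (y - x).
Proof.
have H : is_derive t 1 (fun t : R => t *: (y - x)) (y - x).
  apply: DeriveDef; first exact/derivable1_diffP/differentiableZl.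
  by rewrite deriveE ?diff_val ?scale1r//; exact/differentiableZl.
have -> : segment x y = (cst x + (fun t : R => t *: (y - x))).
  by apply/funext.
exact: is_derive_eq (is_deriveD (is_derive_cst x t 1) H) (add0r _).
Qed.

Lemma derive1_segment x y : derive1 (segment x y) = fun=> y - x.
Proof.
by apply/funext => t; rewrite derive1E; have [_ ->] := derive_segment x y t.
Qed.

Lemma C1_segment x y : C1_curve (segment x y).
Proof.
split=> [t|]; first by have [+ _] := derive_segment x y t.
by rewrite derive1_segment => t; exact: cst_continuous.
Qed.

Lemma joins_segment x y : joins x [:: segment x y] y.
Proof.
split; first exact: C1_segment.
- by rewrite /segment scale0r addr0.
- by rewrite /segment /= scale1r addrC subrK.
Qed.

Lemma rdist_ge x y u : sqn u <= 1 -> dotp (y - x) u <= rdist g x y.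
Proof.
move=> u1; apply: lb_le_inf.
  by eexists; exists [:: segment x y]; split; [exact: joins_segment|].
by move=> L [s [Hs ->]]; exact: joins_ge.
Qed.

Lemma rdist_le x y (M : R) :
  (forall t, 0 <= t <= 1 ->
     Num.sqrt (ip g (segment x y t) (y - x) (y - x)) <= M) ->
  rdist g x y <= M.
Proof.
move=> H; apply: (@le_trans _ _ (curve_length g (segment x y))).
  apply: ge_inf.
    exists 0 => L [s [_ ->]]; apply: sumr_ge0 => c _; exact: length_ge0.
  by exists [:: segment x y]; rewrite big_seq1; split=> //; exact: joins_segment.
apply: length_le; first exact: C1_segment.
by move=> t t01; rewrite /speed derive1_segment; exact: H.
Qed.

Lemma sqn_e (i : 'I_n) : sqn (delta_mx ord0 i : V) = 1.
Proof. by rewrite -dotp_sqn dotp_e mxE !eqxx. Qed.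

Lemma sqnN u : sqn (- u) = sqn u.
Proof. by apply: eq_bigr => i _; rewrite mxE sqrrN. Qed.

Lemma rdist_ge_coord x y i : `|y ord0 i - x ord0 i| <= rdist g x y.
Proof.
rewrite ler_norml lerNl.
have H1 := @rdist_ge x y (delta_mx ord0 i); have H2 := @rdist_ge x y (- delta_mx ord0 i).
move: H1 H2; rewrite sqnN sqn_e lexx => /(_ isT) H1 /(_ isT) H2.
move: H1 H2; rewrite (dotpC _ (- _)) dotpNl (dotpC _ (y - x)) dotp_e !mxE.
by move=> -> ->.
Qed.

Lemma rdist_ge0 x y : 0 <= rdist g x y.
Proof.
have := @rdist_ge x y 0; rewrite -(scale0r 0) dotpZr mul0r; apply.
by rewrite scale0r -dotp_sqn -(scale0r 0) dotpZl mul0r ler01.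
Qed.

Lemma rdist_ge_norm x y : Num.sqrt (sqn (y - x)) <= rdist g x y.
Proof.
have [->|yx] := eqVneq (sqn (y - x)) 0; first by rewrite sqrtr0 rdist_ge0.
have s0 : 0 < sqn (y - x) by rewrite lt_def yx sqn_ge0.
have r0 : 0 < Num.sqrt (sqn (y - x)) by rewrite sqrtr_gt0.
have E : Num.sqrt (sqn (y - x)) ^+ 2 = sqn (y - x) by rewrite sqr_sqrtr ?ltW.
set r := Num.sqrt _ in r0 E *.
have := @rdist_ge x y (r^-1 *: (y - x)).
rewrite -dotp_sqn dotpZl !dotpZr dotp_sqn -E expr2 mulKf ?gt_eqF//.
by rewrite mulVf ?gt_eqF// lexx => /(_ isT).
Qed.

End length_bounds.

(** The coordinates are 1-Lipschitz for the distance, so a Cauchy sequence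
    converges coordinatewise; along segments the distance to the limit is at most
    [C] times the Euclidean one. *)
Lemma pinched_complete g (C : R) : 0 <= C ->
  (forall i j, continuous (fun x => g x i j)) ->
  (forall x v, sqn v <= ip g x v v) ->
  (forall x v, ip g x v v <= C ^+ 2 * sqn v) -> complete_metric g.
Proof.
move=> C0 cg g_ge g_le a Ca.
have cvj j : cvgn (fun i => a i ord0 j).
  apply/cauchy_cvgP; apply: cauchy_exP => e e0.
  have [N HN] := Ca e e0; exists (a N ord0 j).
  exists N => // i /= Ni; rewrite /ball /= distrC.
  exact: le_lt_trans (rdist_ge_coord cg g_ge _ _ _) (HN N i (leqnn N) Ni).
pose l : V := \row_j limn (fun i => a i ord0 j); exists l.
have sl : sqn (l - a i) @[i --> \oo] --> (0 : R).
  rewrite /sqn [X in _ --> X](_ : 0 = \sum_(j < n) (0 : R)); last by rewrite big1.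
  apply: cvg_sumf => j.
  have H : limn (fun i => a i ord0 j) - a i ord0 j @[i --> \oo] --> (0 : R).
    rewrite -[X in _ --> X](subrr (limn (fun i => a i ord0 j))).
    by apply: cvgB; [exact: cvg_cst|exact: cvj].
  rewrite (_ : (fun i => _) = fun i => (limn (fun i => a i ord0 j) - a i ord0 j) *
    (limn (fun i => a i ord0 j) - a i ord0 j)).
    by rewrite -[X in _ --> X](mulr0 (0 : R)); exact: cvgM.
  by apply/funext => i; rewrite !mxE expr2.
have cl : C * Num.sqrt (sqn (l - a i)) @[i --> \oo] --> (0 : R).
  rewrite -[X in _ --> X](mulr0 C); apply: cvgM; first exact: cvg_cst.
  rewrite -[X in _ --> X]sqrtr0; apply: cvg_comp sl _; exact: sqrt_continuous.
apply: (@squeeze_cvgr _ _ _ _ (fun=> 0) (fun i => C * Num.sqrt (sqn (l - a i)))).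
- near=> i; rewrite (rdist_ge0 cg g_ge)/=; apply: rdist_le => // t _.
  rewrite -[X in X * _](ger0_norm C0) -sqrtr_sqr -sqrtrM ?sqr_ge0//.
  by apply: ler_wsqrtr; exact: g_le.
- exact: cvg_cst.
- exact: cl.
Unshelve. all: by end_near. Qed.

End curves.

(** * Lebesgue integration on tuples *)

Section tuple_measurability.
Context {R : realType} {n : nat}.
Local Notation V := 'rV[R]_n.
Local Notation T := (measurableTypeR R).
Local Notation rv := (@rv_of_tuple R n).

Lemma measurable_countable_range d (X : measurableType d) (Z : countType)
    (phi : X -> Z) (g : Z -> T) :
  (forall z, measurable (phi @^-1` [set z])) ->
  measurable_fun setT (fun x => g (phi x)).
Proof.
move=> H _ B mB; rewrite setTI.
rewrite (_ : _ @^-1` B = \bigcup_(z : Z)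
    (if `[< B (g z) >] then phi @^-1` [set z] else set0)).
  apply: countable_bigcupT_measurable; first exact: countableP.
  by move=> z; case: ifP => _.
apply/seteqP; split=> [x Bx|x [z _]] /=.
  by exists (phi x) => //; case: asboolP.
by case: asboolP => // Bz ->.
Qed.

(** The cell of side [(k + 1)^-1] that contains [t]; [ungrid] is its corner.
    There are countably many cells and they are measurable for the product
    sigma-algebra, which need not be compared with a topology. *)
Definition grid (k : nat) (t : n.-tuple T) : n.-tuple int :=
  [tuple Num.floor (k.+1%:R * (tnth t j : R)) | j < n].

Definition ungrid (k : nat) (z : n.-tuple int) : V :=
  \row_j ((tnth z j)%:~R / k.+1%:R).

Lemma measurable_grid k z : measurable (grid k @^-1` [set z]).
Proof.
rewrite (_ : _ @^-1` _ = \bigcap_(j in [set: 'I_n])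
    ((@tnth n T ^~ j) @^-1` [set` `[(tnth z j)%:~R / k.+1%:R,
       ((tnth z j)%:~R + 1) / k.+1%:R[%R])).
  apply: fin_bigcap_measurable; first exact: finite_finset.
  move=> j _; rewrite -[X in measurable X]setTI.
  by apply: measurable_tnth => //; exact: measurable_itv.
have k0 : (0 : R) < k.+1%:R by rewrite ltr0n.
apply/seteqP; split=> [t /= <- j _|t H].
  rewrite /= in_itv/= tnth_mktuple.
  rewrite ler_pdivrMr// ltr_pdivlMr// [_ * k.+1%:R]mulrC.
  rewrite floor_le_tmp/=.
  by have := floorD1_gt (k.+1%:R * (tnth t j : R)); rewrite intrD.
apply: eq_from_tnth => j; rewrite tnth_mktuple.
have := H j I; rewrite /= in_itv/= ler_pdivrMr// ltr_pdivlMr//.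
by rewrite [_ * k.+1%:R]mulrC => Hj; apply: floor_def; rewrite intrD.
Qed.

Lemma grid_near k t j :
  `|(ungrid k (grid k t) - rv t) ord0 j| <= k.+1%:R^-1.
Proof.
have k0 : (0 : R) < k.+1%:R by rewrite ltr0n.
rewrite !mxE tnth_mktuple; set a := k.+1%:R * _.
have -> : (tnth t j : R) = a / k.+1%:R by rewrite /a mulrC mulKf// gt_eqF.
rewrite -mulrBl normrM [`|_^-1|]gtr0_norm ?invr_gt0// ler_piMl ?invr_ge0 ?(ltW k0)//.
have := floorD1_gt a; have := floor_le_tmp a; rewrite intrD ler_norml.
by move=> ? ?; apply/andP; split; lra.
Qed.

(** [f] is the pointwise limit of its values at the corners of the cells. The
    origin is a corner of every grid, so the value there is always exact. *)
Lemma measurable_rv (f : V -> R) : (forall x, x != 0 -> {for x, continuous f}) ->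
  measurable_fun setT (fun t => f (rv t) : T).
Proof.
move=> cf.
apply: (@measurable_fun_cvg _ _ _ setT (fun k t => f (ungrid k (grid k t)))).
  move=> k; exact: (measurable_countable_range (fun z => f (ungrid k z))
    (measurable_grid k)).
move=> t _; have [t0|t0] := eqVneq (rv t) 0.
  have E k : ungrid k (grid k t) = rv t.
    apply/rowP => j; have /rowP/(_ j) := t0; rewrite !mxE tnth_mktuple => ->.
    by rewrite mulr0 floor0 mul0r.
  by under eq_fun do rewrite E; exact: cvg_cst.
apply/cvgrPdist_lt => e e0; have [r r0 H] := cont_eps (cf _ t0) e0.
near=> k; rewrite distrC; apply: H.
apply: (@le_lt_trans _ _ (k.+1%:R^-1)).
  rewrite [leLHS]/Num.Def.normr/= mx_normrE; apply: bigmax_le => // -[a b] _ /=.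
  by rewrite (ord1 a); exact: grid_near.
by near: k; exact: near_infty_natSinv_lt (PosNum r0).
Unshelve. all: by end_near. Qed.

End tuple_measurability.

Section tuple_fubini.
Context {R : realType} {n : nat}.
Local Notation T := (measurableTypeR R).
Local Notation leb1 := (@lebesgue_measure R).
Local Notation leb := (lebesgue_tuple R).
Local Open Scope ereal_scope.

Definition ct (a : T) (t : n.-tuple T) : n.+1.-tuple T := [tuple of a :: t].

Lemma measurable_ct : measurable_fun setT (fun z : T * n.-tuple T => ct z.1 z.2).
Proof. exact: measurable_cons. Qed.

Lemma ge0_fubini1 (h : n.+1.-tuple T -> \bar R) : measurable_fun setT h ->
  (forall t, 0 <= h t) ->
  \int[leb n.+1]_t h t = \int[leb1]_a \int[leb n]_t h (ct a t).
Proof.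
move=> mh h0.
rewrite [LHS](ge0_integral_pushforward measurable_ct)//= preimage_setT.
rewrite (fubini_tonelli1 (fun z => h (ct z.1 z.2)))//.
by apply: measurableT_comp mh measurable_ct.
Qed.

Lemma integrable_ct (h : n.+1.-tuple T -> \bar R) :
  (leb n.+1).-integrable setT h ->
  (leb1 \x leb n).-integrable setT (fun z => h (ct z.1 z.2)).
Proof.
move=> /integrableP[mh hoo]; apply/integrableP; split.
  by apply: measurableT_comp mh measurable_ct.
move: hoo; rewrite [X in X < _](ge0_integral_pushforward measurable_ct)//=.
by apply: measurableT_comp.
Qed.

Lemma tuple_fubini1 (h : n.+1.-tuple T -> \bar R) : (leb n.+1).-integrable setT h ->
  \int[leb n.+1]_t h t = \int[leb1]_a \int[leb n]_t h (ct a t).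
Proof.
move=> ih; have ih' := integrable_ct ih.
rewrite [LHS](integral_pushforward measurable_ct)//=; last exact: measurable_int ih.
by rewrite -(integral12_prod_meas1 ih').
Qed.

Lemma tuple_fubini2 (h : n.+1.-tuple T -> \bar R) : (leb n.+1).-integrable setT h ->
  \int[leb n.+1]_t h t = \int[leb n]_t \int[leb1]_a h (ct a t).
Proof.
move=> ih; have ih' := integrable_ct ih.
rewrite [LHS](integral_pushforward measurable_ct)//=; last exact: measurable_int ih.
by rewrite -(integral21_prod_meas1 ih').
Qed.

End tuple_fubini.

Section boxes.
Context {R : realType}.
Local Notation T := (measurableTypeR R).
Local Notation leb := (lebesgue_tuple R).

Definition box n (c : n.-tuple T) (r : R) : set (n.-tuple T) :=
  [set t | forall j, `|(tnth t j : R) - tnth c j| <= r].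

Lemma measurable_box n (c : n.-tuple T) r : measurable (box c r).
Proof.
rewrite (_ : box c r = \bigcap_(j in [set: 'I_n])
    ((@tnth n T ^~ j) @^-1` [set` `[(tnth c j : R) - r, (tnth c j : R) + r]%R])).
  apply: fin_bigcap_measurable; first exact: finite_finset.
  move=> j _; rewrite -[X in measurable X]setTI.
  by apply: measurable_tnth => //; exact: measurable_itv.
apply/seteqP; split=> [t H j _|t H j]; first by rewrite /= in_itv/= -ler_distl.
by have := H j I; rewrite /= in_itv/= -ler_distl.
Qed.

Lemma measure_box n (c : n.-tuple T) (r : R) : 0 < r ->
  leb n (box c r) = ((2 * r) ^+ n)%:E.
Proof.
move=> r0; elim: n c => [|n IH] c.
  by rewrite expr0 /= diracE mem_set//; case.
have E : (fun z : T * n.-tuple T => ct z.1 z.2) @^-1` box c r =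
    [set` `[(thead c : R) - r, (thead c : R) + r]%R] `*` box [tuple of behead c] r.
  apply/seteqP; split=> [[a t] /= H|[a t] /= [Ha Ht] j].
    split; first by rewrite in_itv/= -ler_distl; exact: (H ord0).
    move=> j; have := H (lift ord0 j).
    by rewrite !(tnth_nth (0 : R))/= nth_behead.
  case: (unliftP ord0 j) => [j'|] ->; last first.
    by move: Ha; rewrite in_itv/= -ler_distl.
  by have := Ht j'; rewrite !(tnth_nth (0 : R))/= nth_behead.
rewrite /= /lebesgue_step /pushforward E product_measure1E//; last first.
  exact: measurable_box.
rewrite IH exprS EFinM; congr (_ * _)%E.
apply: etrans (lebesgue_measure_itv _) _.
rewrite /= lte_fin ltrD2l gtrN// -EFinD; congr (_%:E); ring.
Qed.

End boxes.

Section scaling.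
Context {R : realType}.
Local Notation T := (measurableTypeR R).
Local Notation leb1 := (@lebesgue_measure R).
Local Notation leb := (lebesgue_tuple R).
Local Open Scope ereal_scope.

Lemma measurable_scale (r : R) : measurable_fun setT (fun a : T => (r * a)%R : T).
Proof. exact: mulrl_measurable. Qed.

(* [a |-> r * a] carries Lebesgue measure to [r^-1] times itself. *)
Let scaled_measure (r : R) : {measure set T -> \bar R} :=
  measure_function_pushforward__canonical__measure_function_Measure
    leb1 (measurable_scale r).

(** By uniqueness of the Lebesgue measure it is enough to compare intervals. *)
Lemma lebesgue_scale (r : R) (r0 : (0 < r)%R) (A : set T) : measurable A ->
  leb1 A = mscale (NngNum (ltW r0)) (scaled_measure r) A.
Proof.
move=> mA; apply: lebesgue_measure_unique => //.
move=> _ [[a b] _ <-].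
rewrite -[RHS]/(r%:E * leb1 ((fun a : T => (r * a)%R : T) @^-1` `]a, b]%classic)).
have -> : (fun a : T => (r * a)%R : T) @^-1` `]a, b]%classic =
    `](a / r)%R, (b / r)%R]%classic.
  apply/seteqP; split=> z /=; rewrite !in_itv/= ltr_pdivrMr// ler_pdivlMr//;
    by rewrite [(z * r)%R]mulrC.
rewrite !lebesgue_measure_itv/= !lte_fin ltr_pM2r ?invr_gt0//.
case: ifP => _; last by rewrite mule0.
rewrite -!EFinD -EFinM; congr (_%:E); field.
by rewrite gt_eqF.
Qed.

Lemma integral_scale1 (r : R) (h : T -> \bar R) : (0 < r)%R ->
  measurable_fun setT h -> (forall a, 0 <= h a) ->
  r%:E * \int[leb1]_a h (r * a)%R = \int[leb1]_a h a.
Proof.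
move=> r0 mh h0.
rewrite [RHS](eq_measure_integral (mscale (NngNum (ltW r0)) (scaled_measure r))).
  rewrite ge0_integral_mscale//=; congr (_ * _).
  by rewrite (ge0_integral_pushforward (measurable_scale r)).
by move=> A mA _; exact: lebesgue_scale.
Qed.

Definition scale n (r : R) (t : n.-tuple T) : n.-tuple T :=
  [tuple (r * (tnth t j : R))%R : T | j < n].

Lemma measurable_scalet n r : measurable_fun setT (@scale n r).
Proof.
apply/measurable_fun_tnthP => j.
rewrite (_ : _ \o _ = fun t => (r * (tnth t j : R))%R).
  by apply: measurableT_comp (measurable_scale r) (measurable_tnth j).
by apply/funext => t /=; rewrite tnth_mktuple.
Qed.

Lemma scale_ct n r (a : T) (t : n.-tuple T) :
  scale r (ct a t) = ct (r * a)%R (scale r t).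
Proof.
apply: eq_from_tnth => j; rewrite tnth_mktuple.
case: (unliftP ord0 j) => [j'|] -> //.
by rewrite /ct !tnthS tnth_mktuple.
Qed.

Lemma integral_scale n (r : R) (h : n.-tuple T -> \bar R) : (0 < r)%R ->
  measurable_fun setT h -> (forall t, 0 <= h t) ->
  (r ^+ n)%:E * \int[leb n]_t h (scale r t) = \int[leb n]_t h t.
Proof.
move=> r0; elim: n h => [|n IH] h mh h0.
  rewrite expr0 mul1e; apply: eq_integral => t _; congr h.
  by apply: eq_from_tnth => -[].
have mhs : measurable_fun setT (fun t => h (scale r t)).
  by apply: measurableT_comp mh (measurable_scalet r).
have mF : measurable_fun setT (fun a => \int[leb n]_t h (ct a t)).
  apply: (measurable_fun_fubini_tonelli_F (fun z => h (ct z.1 z.2))) => //.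
  by apply: measurableT_comp mh measurable_ct.
have mFs : measurable_fun setT (fun a => \int[leb n]_t h (scale r (ct a t))).
  apply: (measurable_fun_fubini_tonelli_F (fun z => h (scale r (ct z.1 z.2)))) => //.
  by apply: measurableT_comp mhs measurable_ct.
rewrite ge0_fubini1// exprS EFinM -muleA -ge0_integralZl//; last 2 first.
- by move=> a _; exact: integral_ge0.
- by rewrite lee_fin exprn_ge0// ltW.
rewrite ge0_fubini1// -(integral_scale1 r0)//; last by move=> a; exact: integral_ge0.
congr (_ * _); apply: eq_integral => a _.
under [X in _ * X]eq_integral do rewrite scale_ct.
apply: (IH (fun t => h (ct (r * a)%R t))) => //.
have mp := measurableT_comp (@measurable_ct R n) (pair1_measurable (r * a)%R).
exact: measurableT_comp mh mp.
Qed.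

End scaling.

(** * Integration by parts and radial integrals *)

Section compact_boxes.
Context {R : realType} {n : nat}.
Local Notation V := 'rV[R]_n.

Definition cube (K : R) : set V := [set x | forall j, `|x ord0 j| <= K].

Lemma compact_cube K : compact (cube K).
Proof.
have -> : cube K = [set x : V | forall j, `[(- K)%R, K]%classic (x ord0 j)].
  by apply/seteqP; split=> x H j; have := H j; rewrite /= in_itv/= ler_norml.
exact: (@rV_compact R n (fun=> `[(- K)%R, K]%classic) (fun=> @segment_compact R _ _)).
Qed.

Definition supp_in (K : R) (f : V -> R) : Prop :=
  forall x : V, (exists j, K < `|x ord0 j|) -> f x = 0.

Lemma cube_or K (x : V) : cube K x \/ exists j, K < `|x ord0 j|.
Proof.
have [H|H] := boolP [forall j, `|x ord0 j| <= K].
  by left => j; exact: (forallP H).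
by right; move: H => /forallPn[j]; rewrite -ltNge => ?; exists j.
Qed.

Lemma supp_bounded K (f : V -> R) : continuous f -> supp_in K f ->
  exists M, forall x, `|f x| <= M.
Proof.
move=> cf sf.
have [[x0 Kx0]|Ke] := pselect (cube K !=set0); last first.
  exists 0 => x; case: (cube_or K x) => [Kx|/sf ->]; last by rewrite normr0.
  by exfalso; apply: Ke; exists x.
have [|c _ Hc] := @EVT_max_rV R n (fun x => `|f x|) (cube K) (ex_intro _ x0 Kx0)
  (@compact_cube K).
  apply: continuous_subspaceT => x; apply: cont_comp (cf x) _.
  exact: norm_continuous.
exists `|f c| => x; case: (cube_or K x) => [Kx|/sf ->]; last by rewrite normr0.
by apply: Hc; rewrite inE.
Qed.

Lemma open_out K j : open [set x : V | K < `|x ord0 j|].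
Proof.
have -> : [set x : V | K < `|x ord0 j|] =
    (fun x : V => `|x ord0 j|) @^-1` [set y | K < y] by [].
apply: open_comp; last exact: open_gt.
move=> x _; apply: (@cont_comp _ _ _ (fun x : V => x ord0 j)).
  exact: continuous_coord.
exact: norm_continuous.
Qed.

Lemma supp_pderiv K (f : V -> R) i : supp_in K f -> supp_in K (pderiv i f).
Proof.
move=> sf x [j Kx].
have -> : pderiv i f x = pderiv i (fun=> 0) x.
  apply: pderiv_eq.
  apply: filterS (open_nbhs_nbhs (conj (@open_out K j) Kx)) => z Kz.
  by apply: sf; exists j.
exact: isd_val (isdC 0 x _).
Qed.

End compact_boxes.

Section parts_on_tuples.
Context {R : realType}.
Local Notation T := (measurableTypeR R).
Local Notation leb1 := (@lebesgue_measure R).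
Local Notation leb := (lebesgue_tuple R).

Definition upd n (t : n.-tuple T) (i : 'I_n) (b : R) : n.-tuple T :=
  [tuple if j == i then (b : T) else tnth t j | j < n].

Lemma upd_ct0 n a b (t : n.-tuple T) : upd (ct a t) ord0 b = ct b t.
Proof.
apply: eq_from_tnth => j; rewrite tnth_mktuple.
by case: (unliftP ord0 j) => [j'|] -> //=; rewrite /ct !tnthS.
Qed.

Lemma upd_ctS n a b (t : n.-tuple T) j :
  upd (ct a t) (lift ord0 j) b = ct a (upd t j b).
Proof.
apply: eq_from_tnth => l; rewrite tnth_mktuple.
case: (unliftP ord0 l) => [l'|] -> //=; rewrite /ct !tnthS tnth_mktuple.
by rewrite (inj_eq lift_inj).
Qed.

Definition tsupp n (K : R) (d : n.-tuple T -> R) : Prop :=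
  forall t, (exists j, K < `|(tnth t j : R)|) -> d t = 0.

Lemma integrable_tsupp n (K M : R) (d : n.-tuple T -> R) : 0 < K ->
  measurable_fun setT (d : _ -> T) -> (forall t, `|d t| <= M) -> tsupp K d ->
  (leb n).-integrable setT (EFin \o d).
Proof.
move=> K0 md dM sd.
pose B := box ([tuple (0 : T) | j < n]) K.
have mB : measurable B by exact: measurable_box.
have E : (EFin \o d) = ((EFin \o d) \_ B).
  apply/funext => t; rewrite /= patchE; case: ifPn => // /negP tB.
  congr (_%:E); apply: sd; apply: contrapT => H; apply: tB; rewrite inE => j.
  rewrite tnth_mktuple subr0 leNgt; apply/negP => Hj; apply: H; by exists j.
rewrite E; apply/(integrable_mkcond _ mB).
apply: measurable_bounded_integrable => //.
- suff : (leb n B < +oo)%E by [].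
  by rewrite measure_box// ltry.
- exact: measurable_funTS.
- exists M; split; first exact: num_real.
  by move=> x Mx t _ /=; apply: le_trans (dM t) (ltW Mx).
Qed.

(** Integrating first in the coordinate [i] gives the increment of [h] over an
    interval whose endpoints lie outside its support. The boundedness and the
    measurability of [d] are what allows the order of integration to change. *)
Lemma integral_deriv0 n (i : 'I_n) (K M : R) (h d : n.-tuple T -> R) : 0 < K ->
  measurable_fun setT (d : _ -> T) -> (forall t, `|d t| <= M) -> tsupp K d ->
  tsupp K h ->
  (forall t (a : R), is_derive a 1 (fun b => h (upd t i b)) (d (upd t i a))) ->
  (forall t, continuous (fun b => d (upd t i b))) ->
  (\int[leb n]_t (d t)%:E = 0)%E.
Proof.
move=> K0; elim: n i h d => [[]//|n IH] i h d md dM sd sh dh cd.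
have hid := integrable_tsupp K0 md dM sd.
case: (unliftP ord0 i) => [j|] Ei; subst i.
  rewrite (tuple_fubini1 hid); rewrite integral0_eq// => a _.
  apply: (IH j (fun t => h (ct a t)) (fun t => d (ct a t))) => [|t|t|t|t b|t].
  - have mp := measurableT_comp (@measurable_ct R n) (pair1_measurable a).
    exact: measurableT_comp md mp.
  - exact: dM.
  - by move=> [l Kl]; apply: sd; exists (lift ord0 l); rewrite /ct tnthS.
  - by move=> [l Kl]; apply: sh; exists (lift ord0 l); rewrite /ct tnthS.
  - have := dh (ct a t) b; rewrite upd_ctS.
    by under [X in is_derive _ _ X _]eq_fun do rewrite upd_ctS.
  - move: (cd (ct a t)); rewrite (_ : (fun b => _) = fun b => d (ct a (upd t j b)))//.
    by apply/funext => b; rewrite upd_ctS.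
rewrite (tuple_fubini2 hid) integral0_eq// => t _.
have out a : a \notin `[(- (K + 1)), K + 1]%R -> K < `|a|.
  by rewrite in_itv/= -ler_norml -ltNge; apply: lt_trans; rewrite ltrDl.
transitivity (\int[leb1]_(a in `[(- (K + 1))%R, (K + 1)%R]) (d (ct a t))%:E)%E.
  rewrite [RHS]integral_mkcond; apply: eq_integral => a _; rewrite patchE.
  case: ifPn => //; rewrite notin_setE /= => /negP /out Ka.
  by congr (_%:E); apply: sd; exists ord0.
have cdt : continuous (fun a => d (ct a t)).
  move: (cd (ct 0 t)); rewrite (_ : (fun b => _) = fun b => d (ct b t))//.
  by apply/funext => b; rewrite upd_ct0.
have dht (a : R) : is_derive a 1 (fun a => h (ct a t)) (d (ct a t)).
  have := dh (ct 0 t) a; rewrite upd_ct0.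
  by under [X in is_derive _ _ X _]eq_fun do rewrite upd_ct0.
have K1 : - (K + 1) < K + 1 by lra.
rewrite (FTC2_everywhere K1 cdt dht).
congr (_%:E); rewrite !sh ?subrr//; exists ord0; rewrite /ct /=.
- by rewrite -[tnth _ _]/(- (K + 1)) ltr0_norm ?opprK; lra.
- by rewrite -[tnth _ _]/(K + 1) gtr0_norm; lra.
Qed.

Section on_vectors.
Variable n : nat.
Local Notation V := 'rV[R]_n.
Local Notation e i := (delta_mx ord0 i : V).
Local Notation rv := (@rv_of_tuple R n).

Lemma rv_upd t i b : rv (upd t i b) = b *: e i + (rv t - (tnth t i : R) *: e i).
Proof.
apply/rowP => j; rewrite !mxE tnth_mktuple eqxx /=.
case: eqVneq => [->|_]; first by rewrite !mulr1 subrr addr0.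
by rewrite !mulr0 add0r subr0.
Qed.

Lemma supp_tsupp K (f : V -> R) : supp_in K f -> tsupp K (fun t => f (rv t)).
Proof. by move=> sf t [j Kj]; apply: sf; exists j; rewrite mxE. Qed.

Lemma measurable_rv_cont (f : V -> R) : continuous f ->
  measurable_fun setT (fun t => f (rv t) : T).
Proof. by move=> cf; apply: measurable_rv => x _; exact: cf. Qed.

Lemma integrable_supp K (f : V -> R) : 0 < K -> continuous f -> supp_in K f ->
  (leb n).-integrable setT (fun t => (f (rv t))%:E).
Proof.
move=> K0 cf sf; have [M HM] := supp_bounded cf sf.
apply: (integrable_tsupp K0 (measurable_rv_cont cf) (M := M)) => //.
exact: supp_tsupp.
Qed.

Lemma integral_pderiv0 K (f : V -> R) i : 0 < K -> Ck 1 setT f -> supp_in K f ->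
  (\int[leb n]_t (pderiv i f (rv t))%:E = 0)%E.
Proof.
move=> K0 Hf sf.
have cf x : {for x, continuous f} by exact: Ck_cont Hf I.
have cd : continuous (pderiv i f) by move=> x; exact: Ck_cont (Ck_pderiv i Hf) I.
have sd := supp_pderiv i sf.
have [M HM] := supp_bounded cd sd.
have cu t : continuous (fun b => rv (upd t i b)).
  rewrite (_ : (fun b => _) = fun b => b *: e i + (rv t - (tnth t i : R) *: e i)).
    move=> b; apply: cvgD; last exact: cvg_cst.
    exact: scalel_continuous.
  by apply/funext => b; exact: rv_upd.
apply: (@integral_deriv0 n i K M (fun t => f (rv t))) => //.
- exact: measurable_rv_cont.
- exact: supp_tsupp.
- exact: supp_tsupp.
- move=> t a; rewrite rv_upd.
  have := (isd_line_at f (rv t - (tnth t i : R) *: e i) (e i) a _).1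
    (Ck_der Hf i I).
  by under [X in _ -> is_derive _ _ X _]eq_fun do rewrite rv_upd.
- by move=> t b; apply: cont_comp (cu t b) _; exact: cd.
Qed.

End on_vectors.
End parts_on_tuples.

Section radial_integrals.
Context {R : realType} {n : nat}.
Local Notation T := (measurableTypeR R).
Local Notation V := 'rV[R]_n.
Local Notation leb1 := (@lebesgue_measure R).
Local Notation leb := (lebesgue_tuple R n).
Local Notation rv := (@rv_of_tuple R n).
Local Open Scope ereal_scope.

Definition sq (t : n.-tuple T) : R := sqn (rv t).

Lemma measurable_sq : measurable_fun setT (sq : _ -> T).
Proof. by apply: measurable_rv_cont => x; exact: continuous_sqn. Qed.

Definition tball (r : R) : set (n.-tuple T) := [set t | (sq t <= r ^+ 2)%R].

Lemma measurable_tball r : measurable (tball r).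
Proof.
rewrite (_ : tball r = sq @^-1` `]-oo, (r ^+ 2)%R]%classic).
  by rewrite -[X in measurable X]setTI; exact: measurable_sq.
by apply/seteqP; split=> t; rewrite /tball /= in_itv.
Qed.

(** The volume of the unit ball. *)
Definition omega : R := fine (leb (tball 1)).

Lemma tball_box r : (0 <= r)%R -> tball r `<=` box ([tuple (0%R : T) | j < n]) r.
Proof.
move=> r0 t tr j; rewrite tnth_mktuple subr0.
rewrite -(ler_pXn2r (n := 2))// ?nnegrE// real_normK ?num_real//.
apply: le_trans tr; rewrite /sq /sqn (bigD1 j)//= mxE lerDl.
by apply: sumr_ge0 => i _; exact: sqr_ge0.
Qed.

Lemma omegaE : leb (tball 1) = omega%:E.
Proof.
rewrite /omega fineK// ge0_fin_numE ?measure_ge0//.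
apply: le_lt_trans (_ : leb (box ([tuple (0%R : T) | j < n]) 1) < +oo).
  by apply: le_measure; rewrite ?inE//; [exact: measurable_tball|
    exact: measurable_box|exact: tball_box].
by rewrite measure_box// ltry.
Qed.

Lemma omega_ge0 : (0 <= omega)%R.
Proof. by rewrite /omega fine_ge0// measure_ge0. Qed.

Lemma rv_scale r t : rv (scale r t) = r *: rv t.
Proof. by apply/rowP => j; rewrite !mxE tnth_mktuple. Qed.

Lemma sq_scale r t : sq (scale r t) = (r ^+ 2 * sq t)%R.
Proof.
by rewrite /sq rv_scale -!dotp_sqn dotpZl dotpZr mulrA.
Qed.

Lemma measure_tball r : (0 < r)%R -> leb (tball r) = (r ^+ n * omega)%:E.
Proof.
move=> r0; have mr := measurable_tball r.
have E A : measurable A -> leb A = \int[leb]_t (\1_A t)%:E.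
  by move=> mA; rewrite integral_indic// setIT.
rewrite EFinM -omegaE E// -(integral_scale r0)//; last first.
  by apply/measurable_EFinP; exact: measurable_indic.
rewrite E; last exact: measurable_tball.
congr (_ * _); apply: eq_integral => t _; congr (_%:E); rewrite !indicE.
have Er : (r ^+ 2 * sq t <= r ^+ 2 = (sq t <= 1))%R.
  by rewrite -[X in (_ <= X)%R]mulr1 ler_pM2l// exprn_gt0.
congr (nat_of_bool _)%:R; apply/idP/idP; rewrite !inE /tball /= sq_scale expr1n;
  by rewrite Er.
Qed.

(** [annular f (r, t)] is [f r] if [t] lies in the ball of radius [r > 0]: a
    superposition of indicators of balls, from which radial integrals are
    computed without polar coordinates. *)
Definition annular (f : R -> R) (z : T * n.-tuple T) : R :=
  (if (0 < z.1)%R && (sq z.2 <= z.1 ^+ 2)%R then f z.1 else 0)%R.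

Lemma measurable_annular (f : R -> R) : measurable_fun setT (f : _ -> T) ->
  measurable_fun setT (fun z => (annular f z)%:E).
Proof.
move=> mf; apply/measurable_EFinP.
have m1 : measurable_fun setT (fun z : T * n.-tuple T => z.1) by exact: measurable_fst.
have m2 : measurable_fun setT (fun z : T * n.-tuple T => sq z.2 : T).
  exact: measurableT_comp measurable_sq (@measurable_snd _ _ _ _).
apply: measurable_fun_ifT; last exact: measurable_cst.
- apply: measurable_and.
    by apply: measurable_fun_ltr; [exact: measurable_cst|exact: m1].
  by apply: measurable_fun_ler; [exact: m2|exact: measurable_funX].
- exact: measurableT_comp mf m1.
Qed.

(** Integrate first in [t]: the ball of radius [r] has volume [omega r ^ n]. *)
Lemma radial_tonelli (f : R -> R) : measurable_fun setT (f : _ -> T) ->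
  (forall r, 0 < r -> 0 <= f r)%R ->
  \int[leb]_t \int[leb1]_r (annular f (r, t))%:E =
  omega%:E * \int[leb1]_r (if (0 < r)%R then f r * r ^+ n else 0%R)%:E.
Proof.
move=> mf f0; pose h := annular f.
have h0 z : 0 <= (h z)%:E.
  by rewrite lee_fin /h /annular; case: ifP => // /andP[z0 _]; exact: f0.
have mhE : measurable_fun setT (fun z => (h z)%:E) by exact: measurable_annular.
rewrite -(fubini_tonelli (fun z => (h z)%:E) mhE h0) -ge0_integralZl//=; last 3 first.
- apply/measurable_EFinP; apply: measurable_fun_ifT; last exact: measurable_cst.
    by apply: measurable_fun_ltr; [exact: measurable_cst|exact: measurable_id].
  by apply: measurable_funM => //; exact: measurable_funX.
- move=> r _; rewrite lee_fin; case: ifP => // r0.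
  by rewrite mulr_ge0 ?f0// exprn_ge0// ltW.
- by rewrite lee_fin omega_ge0.
apply: eq_integral => r _; rewrite /h /annular /=; case: ifPn => [r0|_] /=; last first.
  by rewrite integral0 mule0.
transitivity ((f r)%:E * \int[leb]_t (\1_(tball r) t)%:E).
  rewrite -ge0_integralZl//=; last 2 first.
  - by apply/measurable_EFinP; apply: measurable_indic; exact: measurable_tball.
  - by rewrite lee_fin f0.
  apply: eq_integral => t _; rewrite -EFinM indicE; congr (_%:E).
  case: ifPn => tr; first by rewrite mem_set// mulr1.
  by rewrite memNset ?mulr0//; exact/negP.
rewrite integral_indic//; last exact: measurable_tball.
rewrite setIT; transitivity ((f r)%:E * (r ^+ n * omega)%:E).
  by congr (_ * _); exact: measure_tball.
by rewrite -!EFinM; congr (_%:E); ring.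
Qed.

End radial_integrals.

(** * A mollifier with explicit mass, and integrability of the singularity *)

Section everywhere_continuous.
Context {R : realType} {T : topologicalType}.
Implicit Types f g : T -> R.

Lemma contDg f g : continuous f -> continuous g -> continuous (fun z => f z + g z).
Proof. by move=> cf cg x; exact: cvgD (cf x) (cg x). Qed.

Lemma contMg f g : continuous f -> continuous g -> continuous (fun z => f z * g z).
Proof. by move=> cf cg x; exact: cvgM (cf x) (cg x). Qed.

Lemma contNg f : continuous f -> continuous (fun z => - f z).
Proof. by move=> cf x; exact: cvgN (cf x). Qed.

Lemma contCg (c : R) : continuous (fun _ : T => c).
Proof. by move=> x; exact: cvg_cst. Qed.

Lemma contXg f k : continuous f -> continuous (fun z => f z ^+ k).
Proof.
move=> cf x; apply: (@continuous_comp _ _ _ f (fun z => z ^+ k)); first exact: cf.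
exact: exprn_continuous.
Qed.

Lemma contVg f : (forall x, f x != 0) -> continuous f ->
  continuous (fun z => (f z)^-1).
Proof. by move=> f0 cf x; exact: cvgV (f0 x) (cf x). Qed.

Lemma cont_compg (S S' : topologicalType) (h : S -> T) (f : T -> S') :
  continuous f -> continuous h -> continuous (fun t => f (h t)).
Proof. by move=> cf ch x; apply: continuous_comp; [exact: ch|exact: cf]. Qed.

End everywhere_continuous.

Section kernel_profile.
Context {R : realType}.
Local Notation leb1 := (@lebesgue_measure R).

(** The function [(1 + r ^ 2) ^ (- 1 / 2)]; its derivative and that of its
    product with [r] are monomials in [r] and [bracketV r], which makes the mass
    of the mollifier computable. *)
Definition bracketV (r : R) : R := (Num.sqrt (1 + r ^+ 2))^-1.

Lemma bracketV_arg_gt0 (r : R) : 0 < 1 + r ^+ 2.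
Proof. by rewrite ltr_pwDl// sqr_ge0. Qed.

Lemma bracketV_gt0 (r : R) : 0 < bracketV r.
Proof. by rewrite /bracketV invr_gt0 sqrtr_gt0 bracketV_arg_gt0. Qed.

Lemma bracketV_sqr (r : R) : bracketV r ^+ 2 * (1 + r ^+ 2) = 1.
Proof.
rewrite /bracketV exprVn sqr_sqrtr ?ltW ?bracketV_arg_gt0// mulVf// gt_eqF//.
exact: bracketV_arg_gt0.
Qed.

Lemma isd_bracketV (r : R) : is_derive r 1 bracketV (- r * bracketV r ^+ 3).
Proof.
have s0 : 0 < Num.sqrt (1 + r ^+ 2) by rewrite sqrtr_gt0 bracketV_arg_gt0.
have H := @isd_sqrt R R (fun r : R => 1 + r ^+ 2) r 1 _ (bracketV_arg_gt0 r)
  (isdD (isdC 1 r 1) (isdX 2 (is_derive_id r 1))).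
apply: is_derive_eq (isdV _ H) _; first by rewrite gt_eqF.
rewrite /bracketV /=; field; rewrite gt_eqF//.
Qed.

Lemma isd_rbracketV (r : R) : is_derive r 1 (fun r => r * bracketV r) (bracketV r ^+ 3).
Proof.
apply: is_derive_eq (isdM (is_derive_id r 1) (isd_bracketV r)) _.
have -> : 1 * bracketV r = bracketV r * (bracketV r ^+ 2 * (1 + r ^+ 2)) by rewrite bracketV_sqr mul1r mulr1.
rewrite /=; ring.
Qed.

Lemma cvg_bracketV : bracketV r @[r --> +oo] --> (0 : R).
Proof.
apply/cvgrPdist_lt => e e0; near=> r.
have r0 : 0 < r by near: r; apply: nbhs_pinfty_gt; exact: num_real.
have re : e^-1 < r by near: r; apply: nbhs_pinfty_gt; exact: num_real.
rewrite sub0r normrN gtr0_norm ?bracketV_gt0// /bracketV.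
rewrite invf_plt ?posrE ?sqrtr_gt0 ?bracketV_arg_gt0//.
apply: lt_trans re _; rewrite -[ltLHS](gtr0_norm r0) -sqrtr_sqr.
by rewrite ltr_sqrt ?bracketV_arg_gt0// ltrDr.
Unshelve. all: by end_near. Qed.

Lemma cvg_rbracketV : r * bracketV r @[r --> +oo] --> (1 : R).
Proof.
have H : Num.sqrt (1 - bracketV r * bracketV r) @[r --> +oo] --> (1 : R).
  rewrite -[X in _ --> X]sqrtr1 -[X in _ --> Num.sqrt X]subr0.
  rewrite -[X in _ --> Num.sqrt (_ - X)](mulr0 (0 : R)).
  apply: (@cvg_comp _ _ _ (fun r : R => 1 - bracketV r * bracketV r) Num.sqrt).
    apply: cvgB; first exact: cvg_cst.
    by apply: cvgM; exact: cvg_bracketV.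
  exact: sqrt_continuous.
apply: cvg_trans H; apply: near_eq_cvg; near=> r.
have r0 : 0 < r by near: r; apply: nbhs_pinfty_gt; exact: num_real.
rewrite -[RHS](gtr0_norm (mulr_gt0 r0 (bracketV_gt0 r))) -sqrtr_sqr; congr Num.sqrt.
by rewrite -[X in X - _](bracketV_sqr r); ring.
Unshelve. all: by end_near. Qed.

Lemma FTC2y_everywhere (f F : R -> R) (a l : R) : continuous f ->
  (forall t : R, is_derive t 1 F (f t)) -> (forall t, a <= t -> 0 <= f t) ->
  F t @[t --> +oo] --> l ->
  (\int[leb1]_(x in `[a, +oo[) (f x)%:E = (l - F a)%:E)%E.
Proof.
move=> cf dF f0 Fl; rewrite (@ge0_continuous_FTC2y _ f F a l) //.
- exact: continuous_subspaceT.
- by apply: cvg_at_right_filter; exact: isd_cont (dF a).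
- by move=> x _; rewrite derive1E (isd_val (dF x)).
Qed.

Lemma continuous_bracketV : continuous bracketV.
Proof. by move=> r; exact: isd_cont (isd_bracketV r). Qed.

End kernel_profile.

Section kernel_mass.
Context {R : realType} {n : nat}.
Local Notation T := (measurableTypeR R).
Local Notation V := 'rV[R]_n.
Local Notation leb1 := (@lebesgue_measure R).
Local Notation leb := (lebesgue_tuple R n).
Local Notation rv := (@rv_of_tuple R n).
Local Notation sq := (@sq R n).
Local Notation omega := (@omega R n).

Lemma sq_ge0 t : 0 <= sq t.
Proof. exact: sqn_ge0. Qed.

(** The kernel [(1 + |x| ^ 2) ^ (- n / 2 - 1)], the one that arises from the
    regularisation of [rho ^ -m]. *)
Definition bump (t : n.-tuple T) : R := bracketV (Num.sqrt (sq t)) ^+ n.+2.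

Lemma bump_ge0 t : 0 <= bump t.
Proof. by rewrite exprn_ge0// ltW// bracketV_gt0. Qed.

Lemma measurable_bump : measurable_fun setT (bump : _ -> T).
Proof.
apply: (@measurable_rv_cont R n (fun x => bracketV (Num.sqrt (sqn x)) ^+ n.+2)).
apply: contXg; apply: (cont_compg (f := bracketV)); first exact: continuous_bracketV.
by apply: (cont_compg (f := Num.sqrt)); [exact: sqrt_continuous|exact: continuous_sqn].
Qed.

(** Both sides of Tonelli have explicit primitives, [- bracketV ^ (n+2)] for the
    profile and [(r bracketV r) ^ (n+2)] for the radial density. *)
Lemma mass_bump : (\int[leb]_t (bump t)%:E = omega%:E)%E.
Proof.
pose f (r : R) : R := n.+2%:R * (r * bracketV r ^+ n.+4).
have cf : continuous f.
  apply: contMg; first exact: contCg.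
  by apply: contMg; [move=> r P; exact|apply: contXg; exact: continuous_bracketV].
have f0 (r : R) : 0 <= r -> 0 <= f r.
  move=> r0; rewrite /f mulr_ge0//; apply: mulr_ge0 => //.
  by apply: exprn_ge0; rewrite ltW// bracketV_gt0.
have mf : measurable_fun setT (f : R -> T) by exact: continuous_measurable_fun.
have := radial_tonelli (n := n) mf (fun r r0 => f0 r (ltW r0)).
have -> : (\int[leb1]_r (if (0 < r)%R then f r * r ^+ n else 0%R)%:E = 1)%E.
  pose g (r : R) := n.+2%:R * ((r * bracketV r) ^+ n.+1 * bracketV r ^+ 3).
  pose G (r : R) := (r * bracketV r) ^+ n.+2.
  have cg : continuous g.
    apply: contMg; first exact: contCg.
    apply: contMg; apply: contXg; last exact: continuous_bracketV.
    by move=> r; exact: isd_cont (isd_rbracketV r).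
  have dG (r : R) : is_derive r 1 G (g r).
    by apply: is_derive_eq (isdX n.+2 (isd_rbracketV r)) _; rewrite /g mulrA.
  have g0 (r : R) : 0 <= r -> 0 <= g r.
    move=> r0; rewrite mulr_ge0// mulr_ge0 ?exprn_ge0 ?mulr_ge0 //;
      by rewrite ltW// bracketV_gt0.
  have Gl : G r @[r --> +oo] --> (1 : R).
    rewrite -[X in _ --> X](expr1n R n.+2).
    apply: (@cvg_comp _ _ _ (fun r : R => r * bracketV r) (fun z => z ^+ n.+2)).
      exact: cvg_rbracketV.
    exact: exprn_continuous.
  have := FTC2y_everywhere cg dG g0 Gl.
  rewrite /G mul0r expr0n/= subr0 => <-.
  rewrite [RHS]integral_mkcond; apply: eq_integral => r _.
  rewrite patchE mem_setE in_itv/= andbT; case: ifPn => r0.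
    rewrite (ltW r0); congr (_%:E); rewrite /f /g exprMn !exprS; ring.
  case: ifPn => // r0'; have -> : r = 0 by apply/eqP; rewrite eq_le r0' andbT leNgt.
  by congr (_%:E); rewrite /g mul0r expr0n/= mul0r mulr0.
rewrite mule1 => <-; apply: eq_integral => t _.
pose F (r : R) := - bracketV r ^+ n.+2.
have dF (r : R) : is_derive r 1 F (f r).
  apply: is_derive_eq (isdN (isdX n.+2 (isd_bracketV r))) _.
  by rewrite /f /= !exprS; ring.
have Fl : F r @[r --> +oo] --> (0 : R).
  rewrite -[X in _ --> X]oppr0; apply: cvgN.
  rewrite -[X in _ --> X](expr0n R n.+2).
  apply: (@cvg_comp _ _ _ bracketV (fun z => z ^+ n.+2)); first exact: cvg_bracketV.
  exact: exprn_continuous.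
have s0 : 0 <= Num.sqrt (sq t) by exact: sqrtr_ge0.
have := FTC2y_everywhere cf dF (fun r r0 => f0 r (le_trans s0 r0)) Fl.
rewrite /F sub0r opprK -/(bump t) => <-.
rewrite [LHS]integral_mkcond; apply: eq_integral => r _.
have st : Num.sqrt (sq t) ^+ 2 = sq t by rewrite sqr_sqrtr// sq_ge0.
rewrite patchE mem_setE in_itv/= andbT /annular /=; case: ifPn => r0.
  have r0' := le_trans s0 r0.
  have -> : sq t <= r ^+ 2 by rewrite -st ler_pXn2r ?nnegrE.
  rewrite andbT; case: ifPn => //; rewrite -leNgt => r0''.
  have -> : r = 0 by apply/eqP; rewrite eq_le r0' andbT.
  by rewrite /f mul0r mulr0.
case: ifPn => // /andP[r1 r2]; exfalso; move/negP: r0; apply.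
by rewrite -(ler_pXn2r (n := 2)) ?nnegrE ?st// ltW.
Qed.

Lemma integrable_bump : leb.-integrable setT (fun t => (bump t)%:E).
Proof.
apply/integrableP; split; first by apply/measurable_EFinP; exact: measurable_bump.
under eq_integral do rewrite /= ger0_norm ?bump_ge0//.
by rewrite mass_bump ltry.
Qed.

(** [mu_ e] is the bump concentrated at scale [e], of the same mass. *)
Definition mu_ (e y : R) : R := e ^+ 2 * (Num.sqrt (y + e ^+ 2))^-1 ^+ n.+2.

Lemma mu_scale (e : R) t : 0 < e -> e ^+ n * mu_ e (sq (scale e t)) = bump t.
Proof.
move=> e0; rewrite /mu_ sq_scale /bump /bracketV sqr_sqrtr ?sq_ge0//.
rewrite (_ : _ * sq t + _ = e ^+ 2 * (1 + sq t)); last by ring.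
rewrite sqrtrM ?sqr_ge0// sqrtr_sqr gtr0_norm// invfM exprMn.
rewrite mulrA -(exprD e n 2) addn2 [LHS]mulrA -exprMn mulfV ?expr1n ?mul1r// gt_eqF//.
Qed.

Lemma mu_ge0 e y : 0 <= mu_ e y.
Proof. by rewrite mulr_ge0 ?sqr_ge0// exprn_ge0// invr_ge0 sqrtr_ge0. Qed.

Lemma cont_mu (e : R) : 0 < e -> continuous (fun x : V => mu_ e (sqn x)).
Proof.
move=> e0; apply: contMg; first exact: contCg.
have s0 (x : V) : 0 < sqn x + e ^+ 2 by rewrite ltr_wpDl ?sqn_ge0// exprn_gt0.
apply: contXg; apply: contVg; first by move=> x; rewrite gt_eqF// sqrtr_gt0.
apply: (cont_compg (f := Num.sqrt)); first exact: sqrt_continuous.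
by apply: contDg; [exact: continuous_sqn|exact: contCg].
Qed.

Lemma integral_mu_scale (e : R) (phi : V -> R) : 0 < e -> continuous phi ->
  (forall x, 0 <= phi x) ->
  (\int[leb]_t (phi (rv t) * mu_ e (sq t))%:E =
   \int[leb]_t (phi (e *: rv t) * bump t)%:E)%E.
Proof.
move=> e0 cphi phi0.
have mphi : measurable_fun setT (fun t => (phi (rv t) * mu_ e (sq t))%:E).
  apply/measurable_EFinP.
  apply: (@measurable_rv_cont R n (fun x => phi x * mu_ e (sqn x))).
  by apply: contMg; [exact: cphi|exact: cont_mu].
have p0 t : (0 <= (phi (rv t) * mu_ e (sq t))%:E)%E.
  by rewrite lee_fin mulr_ge0// mu_ge0.
rewrite -(integral_scale e0 mphi p0) -ge0_integralZl//; first last.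
- by rewrite lee_fin exprn_ge0// ltW.
- by apply: measurableT_comp mphi (@measurable_scalet R n e).
apply: eq_integral => t _; rewrite -EFinM rv_scale -(mu_scale t e0).
by congr (_%:E); ring.
Qed.

Definition eps (k : nat) : R := k.+1%:R^-1.

Lemma eps_gt0 k : 0 < eps k.
Proof. by rewrite invr_gt0 ltr0n. Qed.

Lemma cvg_eps : eps k @[k --> \oo] --> (0 : R).
Proof. exact: (@cvg_harmonic R). Qed.

(** After rescaling the kernel no longer depends on [k] and dominated
    convergence applies. Adding the bound [M] makes the integrands nonnegative,
    as the change of variables requires. *)
Lemma mu_cvg K (phi : V -> R) : 0 < K -> continuous phi -> supp_in K phi ->
  (\int[leb]_t (phi (rv t) * mu_ (eps k) (sq t))%:E)%E @[k --> \oo] -->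
  (phi 0 * omega)%:E.
Proof.
move=> K0 cphi sphi; have [M HM] := supp_bounded cphi sphi.
have M0 : 0 <= M by exact: le_trans (normr_ge0 _) (HM 0).
pose psi x := phi x + M.
have psi0 x : 0 <= psi x.
  by have := HM x; rewrite ler_norml => /andP[+ _]; rewrite /psi; lra.
have psiM x : psi x <= 2 * M.
  by have := HM x; rewrite ler_norml => /andP[_]; rewrite /psi; lra.
have cpsi : continuous psi.
  by apply: contDg; [exact: cphi|exact: contCg].
have H1 : (\int[leb]_t (psi (eps k *: rv t) * bump t)%:E)%E @[k --> \oo] -->
    (\int[leb]_t (psi 0 * bump t)%:E)%E.
  apply: (@dominated_cvg _ _ _ _ _ _ _ _ (fun t => (2 * M * bump t)%:E)) => //.
  - move=> k; apply/measurable_EFinP; apply: measurable_funM measurable_bump.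
    apply: (@measurable_rv_cont R n (fun x => psi (eps k *: x))).
    by apply: (cont_compg (f := psi)); [exact: cpsi|exact: scaler_continuous].
  - move=> t _; apply: cvg_EFin; first by near=> k.
    apply: (@cvgM R _ _ _ (fun k => psi (eps k *: rv t)) (fun=> bump t)).
      rewrite -[X in _ --> psi X](scale0r (rv t)).
      apply: (@cvg_comp _ _ _ (fun k => eps k *: rv t) psi); last exact: cpsi.
      by apply: cvgZr_tmp; exact: cvg_eps.
    exact: cvg_cst.
  - under eq_fun do rewrite EFinM.
    by apply: integrableZl => //; exact: integrable_bump.
  - move=> k t _; rewrite lee_fin normrM (ger0_norm (psi0 _)).
    by rewrite (ger0_norm (bump_ge0 t)) ler_wpM2r// bump_ge0.
have I1 k : leb.-integrable setT (fun t => (phi (rv t) * mu_ (eps k) (sq t))%:E).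
  apply: (@integrable_supp _ _ K (fun x => phi x * mu_ (eps k) (sqn x))) => //.
    by apply: contMg; [exact: cphi|exact: cont_mu (eps_gt0 k)].
  by move=> x Kx; rewrite sphi// mul0r.
have I2 k : (\int[leb]_t (M * mu_ (eps k) (sq t))%:E = (M * omega)%:E)%E.
  rewrite (@integral_mu_scale _ (fun=> M))//; first last.
  - exact: contCg.
  - exact: eps_gt0.
  under eq_integral do rewrite EFinM.
  rewrite integralZl//; last exact: integrable_bump.
  by rewrite mass_bump.
have I3 k : leb.-integrable setT (fun t => (M * mu_ (eps k) (sq t))%:E).
  apply/integrableP; split.
    apply/measurable_EFinP; apply: (@measurable_rv_cont R n (fun x => M * mu_ (eps k) (sqn x))).
    by apply: contMg; [exact: contCg|exact: cont_mu (eps_gt0 k)].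
  rewrite [ltLHS](_ : _ = (M * omega)%:E) ?ltry// -(I2 k).
  by apply: eq_integral => t _; rewrite /= ger0_norm// mulr_ge0// mu_ge0.
have E1 k : (\int[leb]_t (phi (rv t) * mu_ (eps k) (sq t))%:E =
    \int[leb]_t (psi (eps k *: rv t) * bump t)%:E - (M * omega)%:E)%E.
  rewrite -(integral_mu_scale (eps_gt0 k) cpsi psi0) -(I2 k).
  rewrite -integralB//; last first.
    apply: eq_integrable (integrableD _ (I1 k) (I3 k)) => // t _.
    by rewrite -EFinD; congr (_%:E); rewrite /psi; ring.
  by apply: eq_integral => t _; rewrite -EFinB; congr (_%:E); rewrite /psi; ring.
rewrite (_ : (fun k => _) = fun k =>
   \int[leb]_t (psi (eps k *: rv t) * bump t)%:E - (M * omega)%:E)%E; last first.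
  by apply/funext => k; exact: E1.
rewrite (_ : (phi 0 * omega)%:E =
   \int[leb]_t (psi 0 * bump t)%:E - (M * omega)%:E)%E; last first.
  under eq_integral do rewrite EFinM.
  rewrite integralZl//; last exact: integrable_bump.
  by rewrite mass_bump -EFinM -EFinB; congr (_%:E); rewrite /psi; ring.
apply: cvgeB; [by rewrite fin_num_adde_defl|exact: H1|exact: cvg_cst].
Unshelve. all: by end_near. Qed.

End kernel_mass.

Section singularity.
Context {R : realType} {m : nat}.
Local Notation n := m.+2.
Local Notation T := (measurableTypeR R).
Local Notation V := 'rV[R]_n.
Local Notation leb1 := (@lebesgue_measure R).
Local Notation leb := (lebesgue_tuple R n).
Local Notation rv := (@rv_of_tuple R n).
Local Notation sq := (@sq R n).
Local Notation omega := (@omega R n).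

Lemma powVM (c r : R) k : 0 < r -> c * r^-1 ^+ k * r ^+ k.+1 = c * r.
Proof.
move=> r0; rewrite exprSr mulrA; congr (_ * _); rewrite -mulrA -exprMn.
by rewrite mulVf ?gt_eqF// expr1n mulr1.
Qed.

Lemma ler_cube_ball (c K : R) : 1 <= c -> 0 <= K -> c * K ^+ 2 <= (c * K + 1) ^+ 2.
Proof.
move=> c1 K0; have : 0 <= (c * c - c) * K ^+ 2 by rewrite mulr_ge0 ?sqr_ge0//; nra.
by have : 0 <= c * K; [rewrite mulr_ge0//; lra|nra].
Qed.

Lemma cont_w_sqn (x : V) : x != 0 -> {for x, continuous (fun z => w (sqn z))}.
Proof.
rewrite -sqn_gt0 => x0; have H := isd_cont (isd_w x0).
by apply: (@cont_comp V R R (@sqn R n) w); [exact: continuous_sqn|exact: H].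
Qed.

Lemma FTC2_pow (a b : R) : 0 < a -> a <= b ->
  (\int[leb1]_(r in `[a, b]) (m%:R * r^-1 ^+ m.+1)%:E = (a^-1 ^+ m - b^-1 ^+ m)%:E)%E.
Proof.
move=> a0; rewrite le_eqVlt => /predU1P[<-|ab].
  by rewrite subrr set_itv1 integral_set1.
pose F (r : R) := - (r^-1 ^+ m).
have dF (r : R) : 0 < r -> is_derive r 1 F (m%:R * r^-1 ^+ m.+1).
  move=> r0; apply: is_derive_eq (isdN (isdX m (isdV _ (is_derive_id r 1)))) _.
    by rewrite gt_eqF.
  have [->|] := posnP m; first by rewrite !mul0r oppr0.
  case: m => // k _; rewrite /= [r^-1 ^+ k.+2](_ : _ = r^-1 ^+ k * r^-1 ^+ 2).
    by field; rewrite gt_eqF.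
  by rewrite -exprD addn2.
rewrite (@continuous_FTC2 _ _ F) //.
- by rewrite /F -EFinB; congr (_%:E); ring.
- apply: continuous_in_subspaceT => r; rewrite inE/= in_itv/= => /andP[ar _].
  apply: (@cont_comp R R R (fun r => r^-1) (fun z => m%:R * z ^+ m.+1)).
    by apply: inv_continuous; rewrite gt_eqF// (lt_le_trans a0).
  by move: (r^-1); apply: contMg; [exact: contCg|apply: contXg => z P].
- split=> [x||].
  + by rewrite in_itv/= => /andP[ax _]; exact: isd_ex (dF _ (lt_trans a0 ax)).
  + by apply: cvg_at_right_filter; exact: isd_cont (dF _ a0).
  + by apply: cvg_at_left_filter; exact: isd_cont (dF _ (lt_trans a0 ab)).
- move=> x; rewrite in_itv/= => /andP[ax _].
  by rewrite derive1E (isd_val (dF _ (lt_trans a0 ax))).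
Qed.

(** [rho ^ -m] is, up to a constant, a superposition of indicators of balls
    whose total mass is [int_0^K m r dr], because [n = m + 2]. *)
Lemma integrable_sing_ball (K : R) : 0 < K ->
  leb.-integrable setT (fun t => (if sq t <= K ^+ 2 then w (sq t) ^+ m else 0)%:E).
Proof.
move=> K0.
have mw : measurable_fun setT (fun t => w (sq t) : T).
  apply: (@measurable_rv R n (fun x => w (sqn x))) => x x0.
  exact: cont_w_sqn.
have mh : measurable_fun setT
    (fun t => (if sq t <= K ^+ 2 then w (sq t) ^+ m else 0) : T).
  apply: measurable_fun_ifT; last exact: measurable_cst.
    by apply: measurable_fun_ler; [exact: measurable_sq|exact: measurable_cst].
  exact: measurable_funX.
apply/integrableP; split; first exact/measurable_EFinP.
(* [f = - d(r ^ -m) / dr] on [0, K]; the power function is used for [r^-1]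
   because it is known to be measurable. *)
pose f (r : R) : R := if (0 < r) && (r <= K) then m%:R * (r `^ (-1)) ^+ m.+1 else 0.
have f0 r : 0 <= f r by rewrite /f; case: ifP => // _; rewrite mulr_ge0// exprn_ge0// powR_ge0.
have mf : measurable_fun setT (f : R -> T).
  apply: measurable_fun_ifT; last exact: measurable_cst.
    apply: measurable_and; first by apply: measurable_fun_ltr.
    exact: measurable_fun_ler.
  by apply: measurable_funM => //; apply: measurable_funX; exact: measurable_powR.
have RT := radial_tonelli (n := n) mf (fun r _ => f0 r).
pose J (t : n.-tuple T) := (\int[leb1]_r (annular f (r, t))%:E)%E.
have a0 z : (0 <= (annular (n := n) f z)%:E)%E.
  by rewrite lee_fin /annular; case: ifP.
have J0 t : (0 <= J t)%E by apply: integral_ge0 => r _; exact: a0.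
have mJ : measurable_fun setT J.
  exact: measurable_fun_fubini_tonelli_G (measurable_annular mf) a0.
have JE t : 0 < sq t -> sq t <= K ^+ 2 -> J t = (w (sq t) ^+ m - K^-1 ^+ m)%:E.
  move=> t0 tK; pose rho := Num.sqrt (sq t).
  have r0 : 0 < rho by rewrite sqrtr_gt0.
  have rK : rho <= K by rewrite -(gtr0_norm K0) -sqrtr_sqr ler_wsqrtr.
  have rs : rho ^+ 2 = sq t by rewrite sqr_sqrtr// ltW.
  rewrite /w -(FTC2_pow r0 rK) integral_mkcond; apply: eq_integral => r _.
  rewrite patchE mem_setE in_itv/= /annular /f /= -rs.
  have [rr|rr] := leP r 0.
    by rewrite /= leNgt (le_lt_trans rr r0).
  rewrite /= ler_pXn2r ?nnegrE ?(ltW r0) ?(ltW rr)//.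
  case: ifPn => //= _; case: ifPn => // _.
  by rewrite powR_inv1// ltW.
have Jfin : (\int[leb]_t J t < +oo)%E.
  rewrite RT lte_mul_pinfty//; first by rewrite lee_fin omega_ge0.
  apply: (@le_lt_trans _ _ (\int[leb1]_r ((m%:R * K)%:E * (\1_`[0%R, K] r)%:E))%E).
    apply: ge0_le_integral => //=.
    - by move=> r _; rewrite lee_fin; case: ifP => // r0; rewrite mulr_ge0// exprn_ge0// ltW.
    - apply/measurable_EFinP; apply: measurable_fun_ifT; last exact: measurable_cst.
        by apply: measurable_fun_ltr.
      by apply: measurable_funM => //; exact: measurable_funX.
    - apply: measurable_funeM; apply/measurable_EFinP; exact: measurable_indic.
    - move=> r _; rewrite -EFinM lee_fin indicE mem_setE in_itv/= /f.
      have [r0|r0] := ltP 0 r; last by rewrite !mulr_ge0// ltW.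
      rewrite (ltW r0) /=; have [rK|rK] := leP r K; last by rewrite mul0r mulr0.
      rewrite mulr1 powR_inv1; last exact: ltW.
      by rewrite powVM// ler_wpM2l.
  rewrite ge0_integralZl//=; last 2 first.
  - by apply/measurable_EFinP; exact: measurable_indic.
  - by rewrite lee_fin mulr_ge0// ltW.
  have H : (leb1 `[0%R, K]%classic < +oo)%E.
    by rewrite lebesgue_measure_itv/= lte_fin K0 -EFinD ltry.
  rewrite integral_indic// setIT lte_mul_pinfty//.
  by rewrite lee_fin mulr_ge0// ltW.
have i1 : measurable_fun setT (fun t => (K^-1 ^+ m)%:E * (\1_(tball (n := n) K) t)%:E)%E.
  by apply: measurable_funeM; apply/measurable_EFinP; apply: measurable_indic; exact: measurable_tball.
have Kp : 0 <= K^-1 ^+ m by rewrite exprn_ge0// invr_ge0 ltW.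
have i0 t : (0 <= (K^-1 ^+ m)%:E * (\1_(tball (n := n) K) t)%:E)%E.
  by rewrite mule_ge0// lee_fin.
apply: (@le_lt_trans _ _
    (\int[leb]_t ((K^-1 ^+ m)%:E * (\1_(tball K) t)%:E + J t))%E).
  apply: ge0_le_integral => //=.
  - by do 2 apply: measurableT_comp => //.
  - exact: emeasurable_funD.
  - move=> t _; rewrite ger0_norm; last by case: ifP => // _; rewrite exprn_ge0// w_ge0.
    case: ifPn => [tK|_]; last by rewrite adde_ge0.
    have [t0|t0] := ltP 0 (sq t).
      rewrite (JE t t0 tK) indicE mem_set// mule1 -EFinD lee_fin.
      by rewrite addrC subrK.
    rewrite -[leLHS]adde0 leeD// indicE mem_set// mule1 lee_fin w_le0//.
    by rewrite lerXn2r ?nnegrE// invr_ge0 ltW.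
rewrite ge0_integralD//.
rewrite lte_add_pinfty// ge0_integralZl//=; last 1 first.
- by apply/measurable_EFinP; apply: measurable_indic; exact: measurable_tball.
rewrite integral_indic//; last exact: measurable_tball.
suff : (leb (tball K) < +oo)%E by move=> ?; rewrite setIT lte_mul_pinfty// lee_fin.
by rewrite measure_tball// ltry.
Qed.

(** The cube of half-side [K] lies in the ball of radius [n K + 1]. *)
Lemma integrable_sing (K : R) (phi : V -> R) : 0 < K -> continuous phi ->
  supp_in K phi -> leb.-integrable setT (fun t => (w (sq t) ^+ m * phi (rv t))%:E).
Proof.
move=> K0 cphi sphi; have [M HM] := supp_bounded cphi sphi.
have K'0 : 0 < n%:R * K + 1 by rewrite ltr_wpDl// mulr_ge0// ltW.
have M0 : 0 <= M by exact: le_trans (normr_ge0 _) (HM 0).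
have := integrableZl measurableT M (integrable_sing_ball K'0).
apply: le_integrable => //.
  apply/measurable_EFinP.
  apply: (@measurable_rv R n (fun x => w (sqn x) ^+ m * phi x)) => x x0.
  apply: contM; last exact: cphi.
  by apply: (@cont_comp V R R (fun x => w (sqn x)) (fun z => z ^+ m));
    [exact: cont_w_sqn|exact: exprn_continuous].
move=> t _; have w0 : `|w (sq t) ^+ m| = w (sq t) ^+ m.
  by rewrite ger0_norm// exprn_ge0// w_ge0.
suff : `|w (sq t) ^+ m * phi (rv t)| <=
    `|M * (if sq t <= (n%:R * K + 1) ^+ 2 then w (sq t) ^+ m else 0)| by [].
rewrite normrM w0.
have [t0|/sphi ->] := cube_or K (rv t); last by rewrite normr0 mulr0.
rewrite ifT; last first.
  apply: (@le_trans _ _ (\sum_(j < n) K ^+ 2)).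
    apply: ler_sum => j _; rewrite -(real_normK (num_real _)).
    by rewrite ler_pXn2r ?nnegrE ?t0// ltW.
  rewrite sumr_const card_ord -[leLHS]mulr_natl ler_cube_ball ?ler1n//.
  exact: ltW.
rewrite normrM (ger0_norm M0) w0 mulrC.
by rewrite ler_wpM2r// exprn_ge0// w_ge0.
Qed.

End singularity.

(** * Flux fields and the pole of the Green function *)

Section supports.
Context {R : realType} {n : nat}.
Local Notation T := (measurableTypeR R).
Local Notation V := 'rV[R]_n.
Local Notation e i := (delta_mx ord0 i : V).
Local Notation leb := (lebesgue_tuple R n).
Local Notation rv := (@rv_of_tuple R n).

Lemma compact_in_cube (A : set V) : compact A ->
  exists2 K : R, 0 < K & A `<=` cube K.
Proof.
move=> /compact_bounded[M [_ HM]]; exists (`|M| + 1); first by rewrite ltr_wpDl.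
move=> x Ax j; apply: le_trans (norm_coord x j) _; apply: HM => //.
by rewrite ltr_pwDr// ler_norm.
Qed.

Lemma test_function_supp (f : V -> R) : test_function f ->
  exists2 K, 0 < K & supp_in K f.
Proof.
move=> [_ /compact_in_cube[K K0 HK]]; exists K => // x [j Kj].
apply/eqP; apply: contraTT Kj => fx; rewrite -leNgt.
by apply: HK; exact: subset_closure.
Qed.

Lemma measurable_open_rv (U : set V) : open U -> measurable (rv @^-1` U).
Proof.
move=> oU.
rewrite (_ : _ @^-1` _ = \bigcup_(k in [set: nat]) \bigcup_(z in [set: n.-tuple int])
   (if `[< grid k @^-1` [set z] `<=` rv @^-1` U >]
    then grid k @^-1` [set z] else set0)).
  apply: bigcupT_measurable => k.
  apply: countable_bigcupT_measurable; first exact: countableP.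
  by move=> z; case: ifP => // _; exact: measurable_grid.
apply/seteqP; split=> [t Ut|t [k _ [z _]]]; last first.
  by case: asboolP => // H zt; exact: H.
have [r r0 Hr] := open_eps oU Ut.
have r20 : 0 < r / 2 by rewrite divr_gt0.
have [k Hk] : exists k : nat, (k.+1%:R)^-1 < r / 2.
  near \oo => k; exists k; near: k; exact: near_infty_natSinv_lt (PosNum r20).
exists k => //; exists (grid k t) => //; case: asboolP => // -[] t' /= tt'.
apply: Hr; apply: (@le_lt_trans _ _ (k.+1%:R^-1 + k.+1%:R^-1)); last first.
  by rewrite [ltRHS]splitr ltrD.
have k0 : 0 <= k.+1%:R^-1 :> R by rewrite invr_ge0.
rewrite [leLHS]/Num.Def.normr/= mx_normrE; apply: bigmax_le => [|[a j] _ /=].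
  by rewrite addr_ge0.
rewrite (ord1 a).
have -> : (rv t' - rv t) ord0 j = (ungrid k (grid k t) - rv t) ord0 j -
    (ungrid k (grid k t') - rv t') ord0 j by rewrite tt' !mxE; ring.
apply: le_trans (ler_normB _ _) _; apply: lerD; exact: grid_near.
Unshelve. all: by end_near. Qed.

Lemma measurable_closed_rv (A : set V) : closed A -> measurable (rv @^-1` A).
Proof.
move=> cA; have := measurableC (measurable_open_rv (closed_openC cA)).
by rewrite -preimage_setC setCK.
Qed.

Lemma supp_mull K (f h : V -> R) : supp_in K f -> supp_in K (fun x => h x * f x).
Proof. by move=> sf x /sf ->; rewrite mulr0. Qed.

Lemma supp_add K (f h : V -> R) : supp_in K f -> supp_in K h ->
  supp_in K (fun x => f x + h x).
Proof. by move=> sf sh x Kx; rewrite sf// sh// addr0. Qed.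

Lemma supp_sum K (I : Type) (r : seq I) (f : I -> V -> R) :
  (forall i, supp_in K (f i)) -> supp_in K (fun x => \sum_(i <- r) f i x).
Proof. by move=> sf x Kx; rewrite big1// => i _; exact: sf. Qed.

Lemma continuous_pderiv (f : V -> R) i : Ck 1 setT f -> continuous (pderiv i f).
Proof. by move=> Hf x; exact: Ck_cont (Ck_pderiv i Hf) I. Qed.

Lemma Ck_continuous k (f : V -> R) : Ck k setT f -> continuous f.
Proof. by move=> Hf x; exact: Ck_cont Hf I. Qed.

(** The divergence theorem for compactly supported fields. *)
Lemma integral_div0 K (X : 'I_n -> V -> R) : 0 < K ->
  (forall i, Ck 1 setT (X i)) -> (forall i, supp_in K (X i)) ->
  (\int[leb]_t (\sum_i pderiv i (X i) (rv t))%:E = 0)%E.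
Proof.
move=> K0 HX sX; under eq_integral do rewrite -sumEFin.
rewrite integral_sum//; last first.
  move=> i; apply: (integrable_supp K0); last exact: supp_pderiv.
  exact: continuous_pderiv.
by rewrite big1// => i _; exact: (integral_pderiv0 i K0).
Qed.

End supports.

Section inverse_smooth.
Context {R : realType}.

Lemma smooth1_inv : smooth1 [set y : R | 0 < y] (fun y => y^-1).
Proof.
pose c := fix c j : R := if j is j'.+1 then c j' * - (j'.+1)%:R else 1.
exists (fun j y => c j * y^-1 ^+ j.+1); split=> [y _|j y y0].
  by rewrite mul1r expr1.
have yn0 : y != 0 by rewrite gt_eqF.
apply: is_derive_eq (isdMl _ (isdX _ (isdV yn0 (is_derive_id y 1)))) _.
have E : y^-1 ^+ j.+2 = y^-1 ^+ j * y^-1 ^+ 2 by rewrite -[j.+2]addn2 exprD.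
rewrite E -[c j.+1]/(c j * - (j.+1)%:R) /= -exprVn.
by move: (c j) (j.+1)%:R (y^-1 ^+ j) (y^-1 ^+ 2) => *; ring.
Qed.

End inverse_smooth.

Section flux.
Context {R : realType} (m : nat).
Hypothesis m_gt0 : (0 < m)%N.
Local Notation n := m.+2.
Local Notation V := 'rV[R]_n.
Local Notation e i := (delta_mx ord0 i : V).
Implicit Types (x u v : V) (U : set V) (f h : V -> R).
Local Notation sx := (@sx R m).
Local Notation kx := (@kx R m).
Local Notation gm := (@gm R m).

(** The derivative of [f] along the Euler field [x]. *)
Definition euler f x : R := \sum_j x ord0 j * pderiv j f x.

(** The components of [vol_density * gradient f]. *)
Definition flux f i x : R :=
  sx x * pderiv i f x - kx x / sx x * x ord0 i * euler f x.

Lemma vol_densityE x : vol_density gm x = sx x.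
Proof.
rewrite /vol_density det_gk S_kx sqrtr_sqr gtr0_norm//; exact: sx_gt0.
Qed.

Lemma fluxE f i x : vol_density gm x * gradient gm f x ord0 i = flux f i x.
Proof.
have s0 := sx_gt0 x.
rewrite vol_densityE /gradient mxE /flux /euler.
under eq_bigr do rewrite invmx_gkE ?S_neq0// S_kx mulrBl.
rewrite sumrB; under eq_bigr do rewrite eq_sym.
rewrite sum_delta mulrBr; congr (_ - _); rewrite !mulr_sumr.
by apply: eq_bigr => j _; field; rewrite gt_eqF.
Qed.

Lemma laplacian_flux f x :
  laplacian gm f x * vol_density gm x = \sum_i pderiv i (flux f i) x.
Proof.
rewrite /laplacian /divergence mulrC mulrA mulfV ?mul1r; last first.
  by rewrite vol_densityE gt_eqF// sx_gt0.
apply: eq_bigr => i _; congr pderiv; apply/funext => z; exact: fluxE.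
Qed.

Lemma Ck_euler k U f : open U -> Ck k.+1 U f -> Ck k U (euler f).
Proof.
move=> oU Hf; apply: Ck_sum => // j; apply: CkM => //; first exact: Ck_coord.
exact: Ck_pderiv.
Qed.

Lemma Ck_sxV k U : open U -> Ck k U (fun x => (sx x)^-1).
Proof.
move=> oU; apply: Ck_comp oU smooth1_inv _ _ => [x _|]; first exact: sx_gt0.
exact: CkS (@subsetT _ U) (Ck_sx _ _).
Qed.

Lemma Ck_flux k U f i : open U -> Ck k.+1 U f -> Ck k U (flux f i).
Proof.
move=> oU Hf; apply: CkB => //.
  apply: CkM => //; last exact: Ck_pderiv.
  exact: CkS (@subsetT _ U) (Ck_sx _ _).
apply: CkM => //; last exact: Ck_euler.
apply: CkM => //; last exact: Ck_coord.
by apply: CkM => //; [exact: CkS (@subsetT _ U) (Ck_kx _ _)|exact: Ck_sxV].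
Qed.

Lemma supp_flux K f i : supp_in K f -> supp_in K (flux f i).
Proof.
move=> sf x Kx; rewrite /flux /euler (supp_pderiv i sf Kx) big1 ?mulr0 ?subr0//.
by move=> j _; rewrite (supp_pderiv j sf Kx) mulr0.
Qed.

(** The inverse metric sends [x] to [x / s ^ 2]. *)
Lemma dotp_flux f x : \sum_i x ord0 i * flux f i x = euler f x / sx x.
Proof.
have s0 := sx_gt0 x.
transitivity (sx x * euler f x - kx x / sx x * sqn x * euler f x).
  rewrite /flux; under eq_bigr do rewrite mulrBr.
  rewrite sumrB; congr (_ - _).
    by rewrite /euler mulr_sumr; apply: eq_bigr => i _; ring.
  rewrite /sqn !(mulr_sumr, mulr_suml); apply: eq_bigr => i _; ring.
have := S_kx x; move: (euler f x) (kx x) (sqn x) => E0 k y H.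
have -> : k / sx x * y * E0 = (k * y) * E0 / sx x by ring.
have -> : k * y = sx x ^+ 2 - 1 by rewrite -H; ring.
by field; rewrite gt_eqF.
Qed.

Definition fluxdot f h x : R := \sum_i flux f i x * pderiv i h x.

Lemma fluxdotE f h x : fluxdot f h x =
  sx x * (\sum_i pderiv i f x * pderiv i h x) - kx x / sx x * euler f x * euler h x.
Proof.
rewrite /fluxdot /flux; under eq_bigr do rewrite mulrBl.
rewrite sumrB; congr (_ - _).
  by rewrite mulr_sumr; apply: eq_bigr => i _; ring.
by rewrite [euler h x]/euler mulr_sumr; apply: eq_bigr => i _; ring.
Qed.

Lemma fluxdotC f h x : fluxdot f h x = fluxdot h f x.
Proof.
rewrite !fluxdotE mulrAC; congr (_ * _ - _).
by apply: eq_bigr => i _; rewrite mulrC.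
Qed.

End flux.

Section pole.
Context {R : realType} (m : nat).
Hypothesis m_gt0 : (0 < m)%N.
Local Notation n := m.+2.
Local Notation V := 'rV[R]_n.
Local Notation T := (measurableTypeR R).
Local Notation e i := (delta_mx ord0 i : V).
Implicit Types (x u v : V) (U : set V) (f h : V -> R).
Local Notation sx := (@sx R m).
Local Notation kx := (@kx R m).
Local Notation gm := (@gm R m).
Local Notation leb := (lebesgue_tuple R n).
Local Notation rv := (@rv_of_tuple R n).
Local Notation sq := (@sq R n).
Local Notation omega := (@omega R n).

Local Notation mu := (@mu_ R n).

Definition Gf x : R := w (sqn x) ^+ m + Pf m (sqn x).

(** The Laplacian times the volume density. *)
Definition Lap f x : R := \sum_i pderiv i (flux f i) x.

Lemma Ck_Pf k : Ck k setT (fun x : V => Pf m (sqn x)).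
Proof.
apply: (Ck_glue (c := 1)); last by move=> x x1; rewrite Pf_le1// ltW.
apply: CkB open_U0 (CkC _ _ open_U0) _.
apply: CkM open_U0 (Ck_v m k) _.
exact: Ck_comp open_U0 (smooth1_flat (expR 1) 1 setT) _ (Ck_v m k).
Qed.

Lemma Ck_Gf k : Ck k U0 Gf.
Proof.
apply: CkD open_U0 (CkX _ open_U0 (Ck_w m k)) _.
exact: CkS (@subsetT _ _) (Ck_Pf k).
Qed.

Lemma isd_Pfx i x : is_derive x (e i) (fun z => Pf m (sqn z))
  (- (m%:R * (sx x - 1) * w (sqn x) ^+ n * x ord0 i)).
Proof.
pose d (y : R) : R := - ((sf m y - 1) * (m%:R / 2 * w y ^+ n)).
apply: is_derive_eq (isd_radial (dphi := d) i (isd_Pf m _)) _.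
rewrite /sx /d; move: (w _ ^+ n) (sf m _) (m%:R : R) => *.
by field.
Qed.

(** Regularising [|x|^-1] by [(|x|^2 + c^2) ^ (-1/2)]. *)
Definition we (c : R) x : R := w (sqn x + c ^+ 2).

Lemma we_arg_gt0 (c : R) x : 0 < c -> 0 < sqn x + c ^+ 2.
Proof. by move=> c0; rewrite ltr_wpDl ?sqn_ge0// exprn_gt0. Qed.

Lemma Ck_we k (c : R) : 0 < c -> Ck k setT (we c).
Proof.
move=> c0; apply: Ck_comp openT smooth1_w _ _ => [x _|]; first exact: we_arg_gt0.
exact: CkD openT (Ck_sqn _ openT) (CkC _ _ openT).
Qed.

Lemma isd_weX (c : R) j i x : 0 < c -> is_derive x (e i) (fun z => we c z ^+ j)
  (- (j%:R * we c x ^+ j.+2 * x ord0 i)).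
Proof.
move=> c0; have H := isd_comp (phi := w) (f := fun z => sqn z + c ^+ 2) (isd_w (we_arg_gt0 x c0))
  (isdD (isd_sqn x (e i)) (isdC (c ^+ 2) x (e i))).
apply: is_derive_eq (isdX j H) _; rewrite dotp_e -/(we c x).
have [->|] := posnP j; first by rewrite !mul0r oppr0.
case: j => // j _; rewrite /= [we c x ^+ j.+3](_ : _ = we c x ^+ j * we c x ^+ 3).
  by field.
by rewrite -exprD addn3.
Qed.

(** What remains of the divergence of [pole_field] without the mollifier, as a
    function of [W = we c x]; at [W = w (sqn x)] it is [Gf x * Lap f x]. *)
Definition shell f x (W : R) : R := (Pf m (sqn x) + W ^+ m) * Lap f x +
  m%:R * ((sx x - 1) / sx x * (W ^+ n - w (sqn x) ^+ n)) * euler f x.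

Definition pole_field (c : R) f i x : R :=
  (Pf m (sqn x) + we c x ^+ m) * flux f i x + m%:R * (we c x ^+ n * (x ord0 i * f x)).

(** The divergence of [(P + q) X + m z f x], where [X] is the flux of [f],
    [q = we ^ m] and [z = we ^ n]: the second term cancels the only
    contribution of [grad q . X] that does not vanish as [c] tends to [0]. *)
Lemma div_pole_field (c : R) f x : 0 < c -> Ck 2 setT f ->
  \sum_i pderiv i (pole_field c f i) x =
  shell f x (we c x) + m%:R * n%:R * (f x * mu c (sqn x)).
Proof.
move=> c0 Hf; set W := we c x; set y := sqn x; set s := sx x.
have s0 : 0 < s := sx_gt0 x.
have W2 : W ^+ 2 * (y + c ^+ 2) = 1 by exact: w_sqr (we_arg_gt0 x c0).
have D i : pderiv i (pole_field c f i) x =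
    - (m%:R * (s - 1) * w y ^+ n + m%:R * W ^+ n) * (x ord0 i * flux f i x) +
    (Pf m y + W ^+ m) * pderiv i (flux f i) x +
    - (m%:R * n%:R * W ^+ n.+2 * f x) * x ord0 i ^+ 2 +
    m%:R * W ^+ n * (x ord0 i * pderiv i f x) + m%:R * W ^+ n * f x.
  have dX := Ck_der (Ck_flux i openT Hf) i (I : [set: V] x).
  have df := Ck_der (CkW Hf) i (I : [set: V] x).
  have dx := isd_coord i x (e i).
  have H := isdD (isdM (isdD (isd_Pfx i x) (isd_weX m i x c0)) dX)
    (isdMl m%:R (isdM (isd_weX n i x c0) (isdM dx df))).
  rewrite /pderiv (isd_val H) -/(pderiv i (flux f i) x) -/(pderiv i f x).
  have -> : (e i) ord0 i = 1 by rewrite mxE !eqxx.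
  rewrite -/W -/y -/s; move: (n%:R : R) (m%:R : R) (w y ^+ n) (W ^+ n) (W ^+ n.+2).
  by move=> *; ring.
rewrite (eq_bigr _ (fun i _ => D i)) !big_split /= -!mulr_sumr sumr_const card_ord.
rewrite dotp_flux// -/(Lap f x) -/(euler f x) -/s -[\sum_i x ord0 i ^+ 2]/y.
rewrite /shell -/s -/y -/W /mu_ -[(Num.sqrt _)^-1]/W.
have -> : W ^+ n = W ^+ n.+2 * (y + c ^+ 2) by rewrite -[n.+2]addn2 exprD -mulrA W2 mulr1.
rewrite -[f x *+ n]mulr_natl.
move: (W ^+ n.+2) (W ^+ m) (w y ^+ n) (Lap f x) (euler f x) (Pf m y) (n%:R : R) (m%:R : R) (f x).
by move=> *; field; rewrite gt_eqF.
Qed.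

Lemma we_le (c : R) x : x != 0 -> we c x <= w (sqn x).
Proof.
rewrite -sqn_gt0 => y0; rewrite /we /w lef_pV2 ?posrE ?sqrtr_gt0//.
  by rewrite ler_wsqrtr// lerDl sqr_ge0.
by rewrite ltr_wpDr// sqr_ge0.
Qed.

(** A bound uniform in [c] and integrable. The difference [W ^ n - w ^ n] is not
    integrable at the origin, but the factor [s - 1] vanishes there. *)
Lemma shell_le f x (W : R) : 0 <= W -> W <= w (sqn x) ->
  `|shell f x W| <= (1 + w (sqn x) ^+ m) * `|Lap f x| + 2 * m%:R * `|euler f x|.
Proof.
move=> W0 Ww; set y := sqn x in Ww *; have w0 := w_ge0 y.
apply: le_trans (ler_normD _ _) _; rewrite normrM [X in _ + X]normrM.
rewrite [`|m%:R * _|]normrM; apply: lerD.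
  rewrite ler_wpM2r// ger0_norm; last by rewrite addr_ge0 ?Pf_ge0 ?exprn_ge0.
  by rewrite lerD ?Pf_leq1// lerXn2r ?nnegrE.
rewrite ler_wpM2r// [`|m%:R|]ger0_norm// [leRHS]mulrC ler_wpM2l//.
have [y1|y1] := leP y 1.
  by rewrite /sx sf_le1// subrr !(mul0r, normr0).
have s1 : 1 <= sx x := sf_ge1 m y; have s3 : sx x <= 3 := sf_le3 m y.
have s0 : 0 < sx x := sx_gt0 x.
have ws : w y <= 1.
  by rewrite /w invf_le1 ?sqrtr_gt0 ?(lt_trans ltr01)// -sqrtr1 ler_wsqrtr// ltW.
rewrite normrM -[leRHS]mulr1 ler_pM//.
  rewrite ger0_norm; last by rewrite divr_ge0 ?subr_ge0// ltW.
  by rewrite ler_pdivrMr//; lra.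
have Wn : 0 <= W ^+ n by rewrite exprn_ge0.
have wn : W ^+ n <= w y ^+ n by rewrite lerXn2r ?nnegrE.
have w1 : w y ^+ n <= 1 by rewrite exprn_ile1.
rewrite ler_norml; apply/andP; split; lra.
Qed.

Lemma cont_shell f x : continuous (shell f x).
Proof.
have cid : continuous (fun W : R => W) by move=> W P.
apply: contDg; apply: contMg; try exact: contCg.
  by apply: contDg; [exact: contCg|exact: contXg].
apply: contMg; first exact: contCg.
apply: contMg; first exact: contCg.
by apply: contDg; [exact: contXg|exact: contCg].
Qed.

Lemma shell_w f x : shell f x (w (sqn x)) = Gf x * Lap f x.
Proof. by rewrite /shell subrr !mulr0 mul0r addr0 addrC. Qed.

Lemma cvg_we x : x != 0 -> we (eps k) x @[k --> \oo] --> w (sqn x).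
Proof.
rewrite -sqn_gt0 => y0; have cw := isd_cont (isd_w y0).
have H : sqn x + eps k ^+ 2 @[k --> \oo] --> sqn x.
  rewrite -[X in _ --> X]addr0; apply: cvgD; first exact: cvg_cst.
  rewrite -[X in _ --> X](expr0n R 2).
  apply: (@cvg_comp _ _ _ (@eps R) (fun z => z ^+ 2)); first exact: cvg_eps.
  exact: (@exprn_continuous R 2 0).
exact: (@cvg_comp _ _ _ (fun k => sqn x + eps k ^+ 2) w _ _ _ H cw).
Qed.

Lemma origin_negligible : leb.-negligible [set t | sq t <= 0].
Proof.
have mO : measurable [set t | sq t <= 0].
  rewrite (_ : [set t | _] = tball 0); first exact: measurable_tball.
  by apply/seteqP; split=> t; rewrite /tball /= expr0n.
exists [set t | sq t <= 0]; split=> //.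
apply/eqP; rewrite eq_le measure_ge0 andbT; apply/lee_addgt0Pr => c c0.
rewrite add0e; pose r := Num.min 1 (c / (omega + 1)).
have o1 : 0 < omega + 1 by rewrite ltr_wpDl// omega_ge0.
have r0 : 0 < r by rewrite lt_min ltr01 divr_gt0.
apply: (@le_trans _ _ (leb (tball r))).
  apply: le_measure; rewrite ?inE//; first exact: measurable_tball.
  by move=> t /= t0; rewrite /tball /= (le_trans t0)// sqr_ge0.
rewrite measure_tball// lee_fin.
apply: (@le_trans _ _ (r * (omega + 1))).
  apply: ler_pM; rewrite ?exprn_ge0 ?omega_ge0 ?(ltW r0)// ?lerDl//.
  rewrite exprS ler_piMr ?(ltW r0)// exprn_ile1 ?(ltW r0)//.
  by rewrite ge_min lexx.
by rewrite -ler_pdivlMr// ge_min lexx orbT.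
Qed.

Lemma ae_off_origin (P : n.-tuple T -> Prop) : (forall t, rv t != 0 -> P t) ->
  {ae leb, forall t, P t}.
Proof.
move=> H; apply: negligibleS origin_negligible => t /= nP.
rewrite leNgt /sq sqn_gt0; apply/negP => t0; apply: nP; exact: H.
Qed.

Lemma cont_Lap f : Ck 2 setT f -> continuous (Lap f).
Proof.
move=> Hf x; apply: continuous_sumf => i.
exact: Ck_cont (Ck_pderiv i (Ck_flux i openT Hf)) I.
Qed.

Lemma supp_Lap K f : supp_in K f -> supp_in K (Lap f).
Proof. by move=> sf; apply: supp_sum => i; apply: supp_pderiv; exact: supp_flux. Qed.

Lemma supp_euler K f : supp_in K f -> supp_in K (euler f).
Proof. by move=> sf; apply: supp_sum => i; apply: supp_mull; exact: supp_pderiv. Qed.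

Lemma supp_norm K f : supp_in K f -> supp_in K (fun x => `|f x|).
Proof. by move=> sf x /sf ->; rewrite normr0. Qed.

Lemma cont_normg f : continuous f -> continuous (fun x => `|f x|).
Proof. by apply: cont_compg; exact: norm_continuous. Qed.

(** The integral of the divergence of [pole_field] is zero; as [c] tends to [0] the
    two parts of [div_pole_field] converge to [Gf * Lap f] and to the mass at [0]. *)
Lemma green_pole f : test_function f ->
  (\int[leb]_t (Gf (rv t) * Lap f (rv t))%:E =
   (- (m%:R * n%:R * (f 0 * omega)))%:E)%E.
Proof.
move=> tf; have [K K0 sf] := test_function_supp tf.
have Hf k : Ck k setT f by have /smoothP := tf.1; exact.
pose A k t := shell f (rv t) (we (eps k) (rv t)).
pose B k t := m%:R * n%:R * (f (rv t) * mu (eps k) (sq t)).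
pose D k x := \sum_i pderiv i (pole_field (eps k) f i) x.
have e0 k : 0 < eps k :> R := eps_gt0 k.
have DE k t : D k (rv t) = A k t + B k t by exact: div_pole_field (e0 k) (Hf 2%N).
have HF k j i : Ck j setT (pole_field (eps k) f i).
  apply: CkD openT _ _.
    apply: CkM openT _ (Ck_flux i openT (Hf j.+1)).
    exact: CkD openT (Ck_Pf j) (CkX _ openT (Ck_we j (e0 k))).
  apply: CkMl openT _; apply: CkM openT (CkX _ openT (Ck_we j (e0 k))) _.
  exact: CkM openT (Ck_coord _ _ openT) (Hf j).
have sF k i : supp_in K (pole_field (eps k) f i).
  apply: supp_add; first by apply: supp_mull; exact: supp_flux.
  by do 3 apply: supp_mull.
have D0 k : (\int[leb]_t (D k (rv t))%:E = 0)%E.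
  by apply: (integral_div0 K0) => i; [exact: HF|exact: sF].
have cf : continuous f := Ck_continuous (Hf 0%N).
have cB k : continuous (fun x => f x * mu (eps k) (sqn x)).
  by apply: contMg => //; exact: cont_mu.
have sB k : supp_in K (fun x => f x * mu (eps k) (sqn x)).
  by move=> x /sf ->; rewrite mul0r.
have iB0 k := integrable_supp K0 (cB k) (sB k).
have iB k : leb.-integrable setT (fun t => (B k t)%:E).
  rewrite /B; under eq_fun do rewrite EFinM; exact: integrableZl.
have iD k : leb.-integrable setT (fun t => (D k (rv t))%:E).
  apply: (@integrable_supp _ _ K) => //.
    move=> x; apply: continuous_sumf => i; exact: continuous_pderiv (HF k 1%N i) x.
  by apply: supp_sum => i; apply: supp_pderiv; exact: sF.
have iA k : leb.-integrable setT (fun t => (A k t)%:E).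
  apply: eq_integrable (integrableB _ (iD k) (iB k)) => // t _.
  by rewrite -EFinB DE addrK.
have IA k : (\int[leb]_t (A k t)%:E = - (m%:R * n%:R)%:E *
    \int[leb]_t (f (rv t) * mu (eps k) (sq t))%:E)%E.
  rewrite -integralZl//.
  transitivity (\int[leb]_t ((D k (rv t))%:E - (B k t)%:E))%E.
    by apply: eq_integral => t _; rewrite -EFinB DE addrK.
  rewrite integralB// D0 sub0e -integralN; last exact: integrable_add_def.
  by apply: eq_integral => t _; rewrite -EFinN -EFinM mulNr.
pose g x := (1 + w (sqn x) ^+ m) * `|Lap f x| + 2 * m%:R * `|euler f x|.
have cL : continuous (Lap f) := cont_Lap (Hf 2%N).
have cE : continuous (euler f) := Ck_continuous (Ck_euler openT (Hf 1%N)).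
have ig : leb.-integrable setT (fun t => (g (rv t))%:E).
  have i1 := integrable_supp K0 (cont_normg cL) (supp_norm (supp_Lap sf)).
  have i2 := integrable_sing K0 (cont_normg cL) (supp_norm (supp_Lap sf)).
  have i3 := integrableZl measurableT (2 * m%:R)
    (integrable_supp K0 (cont_normg cE) (supp_norm (supp_euler sf))).
  apply: eq_integrable (integrableD _ (integrableD _ i1 i2) i3) => // t _.
  by rewrite -EFinM -!EFinD; congr (_%:E); rewrite /g /sq; ring.
have iG : leb.-integrable setT (fun t => (Gf (rv t) * Lap f (rv t))%:E).
  have cPL : continuous (fun x => Pf m (sqn x) * Lap f x).
    by apply: contMg => //; exact: Ck_continuous (Ck_Pf 0).
  have i1 := integrable_supp K0 cPL
    (supp_mull (fun x => Pf m (sqn x)) (supp_Lap sf)).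
  have i2 := integrable_sing K0 cL (supp_Lap sf).
  apply: eq_integrable (integrableD _ i2 i1) => // t _.
  by rewrite -EFinD; congr (_%:E); rewrite /Gf /sq; ring.
have [] := @dominated_convergence _ _ _ leb setT measurableT
  (fun k t => (A k t)%:E) (fun t => (Gf (rv t) * Lap f (rv t))%:E)
  (fun t => (g (rv t))%:E).
- by move=> k; exact: measurable_int (iA k).
- exact: measurable_int iG.
- apply: ae_off_origin => t t0 _; apply: cvg_EFin; first by near=> k.
  rewrite -shell_w.
  by apply: (@cvg_comp _ _ _ (fun k => we (eps k) (rv t)) (shell f (rv t)));
    [exact: cvg_we|exact: cont_shell].
- exact: ig.
- apply: ae_off_origin => t t0 k _; rewrite lee_fin /A; apply: shell_le; last exact: we_le.
  exact: w_ge0.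
move=> _ _ H; apply: (cvg_unique _ H) => //.
rewrite (_ : (fun k => _) = fun k => (- (m%:R * n%:R)%:E *
    \int[leb]_t (f (rv t) * mu (eps k) (sq t))%:E)%E); last first.
  by apply/funext => k; exact: IA.
rewrite (_ : (- _)%:E = (- (m%:R * n%:R)%:E * (f 0 * omega)%:E)%E); last first.
  by rewrite -EFinN -EFinM mulNr.
apply: cvgeZl => //; exact: mu_cvg K0 cf sf.
Unshelve. all: by end_near. Qed.

Lemma ip_gm_ge x v : sqn v <= ip gm x v v.
Proof.
rewrite ip_gm dotp_sqn lerDl -mulrA mulr_ge0 ?kx_ge0//.
by rewrite -expr2 sqr_ge0.
Qed.

Lemma cont_gm i j : continuous (fun x => gm x i j).
Proof. exact: Ck_continuous (Ck_gm 0 i j). Qed.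

Lemma gm_complete : complete_metric gm.
Proof.
apply: (pinched_complete (C := 3)) => //; [exact: cont_gm|exact: ip_gm_ge|].
move=> x v; apply: (@le_trans _ _ (sx x ^+ 2 * sqn v)).
  have := ler_wpM2l (kx_ge0 x) (cauchy_schwarz x v).
  rewrite ip_gm dotp_sqn -S_kx; move: (kx x) (dotp x v) => *; lra.
have s0 := sx_gt0 x; rewrite ler_wpM2r ?sqn_ge0// lerXn2r ?nnegrE ?(ltW s0)//.
exact: sf_le3.
Qed.

(** The segment from the origin stays in the region where [g] is Euclidean, and
    elsewhere [g] is at least Euclidean. *)
Lemma rdist_near0 x : sqn x < 1 -> rdist gm 0 x = Num.sqrt (sqn x).
Proof.
move=> x1; apply/eqP; rewrite eq_le; apply/andP; split; last first.
  by rewrite -[X in sqn X]subr0; apply: rdist_ge_norm; [exact: cont_gm|exact: ip_gm_ge].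
apply: rdist_le; [exact: cont_gm|move=> t /andP[t0 t1]].
rewrite subr0 ip_gm /kx kf_le1 ?mul0r ?addr0 ?dotp_sqn//.
rewrite /segment subr0 add0r -dotp_sqn dotpZl dotpZr mulrA dotp_sqn.
by rewrite mulr_ile1 ?sqn_ge0 ?mulr_ge0 ?mulr_ile1// ltW.
Qed.

Lemma Gf_gt0 x : x != 0 -> 0 < Gf x.
Proof.
by rewrite -sqn_gt0 => y0; rewrite ltr_pwDl ?Pf_ge0// exprn_gt0// w_gt0.
Qed.

Lemma sphere_areaE : sphere_area R n = n%:R * omega.
Proof.
rewrite /sphere_area /omega; congr (_ * fine (leb _)).
by apply/seteqP; split=> t; rewrite /tball /= expr1n.
Qed.

Lemma Gf_locally_integrable : locally_dvol_integrable gm Gf.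
Proof.
move=> K cK; have [C C0 KC] := compact_in_cube cK.
pose c : R := n%:R * C ^+ 2 + 1.
have nC : 0 <= n%:R * C ^+ 2 :> R by rewrite mulr_ge0// sqr_ge0.
have c0 : 0 < c by rewrite /c ltr_wpDl.
(* A continuous function of compact support that dominates the indicator
   of [K]. *)
pose phi x : R := Num.max 0 (c - sqn x).
have cphi : continuous phi.
  move=> x; apply: (@continuous_max R V (fun=> 0) (fun x => c - sqn x) x).
    exact: cst_continuous.
  by apply: contDg; [exact: contCg|apply: contNg; exact: continuous_sqn].
have phi0 x : 0 <= phi x by rewrite /phi le_max lexx.
have sphi : supp_in c phi.
  move=> x [j cj]; apply/max_idPl; rewrite subr_le0.
  apply: (@le_trans _ _ (c ^+ 2)); first by rewrite expr2 ler_peMr ?(ltW c0)// /c lerDr.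
  apply: (@le_trans _ _ (x ord0 j ^+ 2)).
    by rewrite -(real_normK (num_real (x ord0 j))) lerXn2r ?nnegrE ?(ltW c0)// ltW.
  by rewrite /sqn (bigD1 j)//= lerDl sumr_ge0// => i _; rewrite sqr_ge0.
have phi1 x : K x -> 1 <= phi x.
  move=> Kx; rewrite /phi le_max; apply/orP; right.
  suff : sqn x <= n%:R * C ^+ 2 by rewrite /c; lra.
  apply: (@le_trans _ _ (\sum_(j < n) C ^+ 2)).
    apply: ler_sum => j _; rewrite -(real_normK (num_real _)).
    by rewrite lerXn2r ?nnegrE ?(ltW C0)//; exact: KC.
  by rewrite sumr_const card_ord -[leLHS]mulr_natl.
have mK := measurable_closed_rv (compact_closed (@norm_hausdorff _ _) cK).
have i1 := integrable_supp c0 cphi sphi.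
have i2 := integrable_sing c0 cphi sphi.
have i3 := integrableZl measurableT 3 (integrableD measurableT i2 i1).
have i4 := integrableS measurableT mK (@subsetT _ _) i3.
apply: le_integrable i4 => //.
  apply: measurable_funTS; apply/measurable_EFinP.
  apply: (@measurable_rv R n (fun x => Gf x * vol_density gm x)) => x x0.
  apply: contM; first exact: Ck_cont (Ck_Gf 0) x0.
  rewrite (_ : vol_density gm = sx); last by apply/funext => z; exact: vol_densityE.
  exact: Ck_continuous (Ck_sx m 0) x.
move=> t Kt; rewrite vol_densityE.
have w0 : 0 <= w (sq t) ^+ m by rewrite exprn_ge0// w_ge0.
have G0 : 0 <= Gf (rv t) by rewrite addr_ge0// Pf_ge0.
have s0 : 0 <= sx (rv t) by rewrite ltW// sx_gt0.
suff : `|Gf (rv t) * sx (rv t)| <= `|3 * (w (sq t) ^+ m * phi (rv t) + phi (rv t))| by [].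
rewrite ger0_norm ?mulr_ge0// ger0_norm; last by rewrite mulr_ge0 ?addr_ge0 ?mulr_ge0.
rewrite [leLHS]mulrC ler_pM//; first exact: sf_le3.
have p1 := phi1 _ Kt; apply: lerD; first by rewrite ler_peMr.
exact: le_trans (Pf_leq1 _ _) p1.
Qed.

Lemma Gf_distributional : distributional_pole gm 0 ((n%:R - 2) * sphere_area R n) Gf.
Proof.
split=> [|f tf]; first exact: Gf_locally_integrable.
transitivity (- (\int[leb]_t (Gf (rv t) * Lap f (rv t))%:E))%E.
  by congr (- _)%E; apply: eq_integral => t _ /=; rewrite -mulrA laplacian_flux.
rewrite green_pole// -EFinN opprK sphere_areaE; congr (_%:E).
by rewrite (_ : n%:R = m%:R + 2 :> R) ?addrK ?mulrA//; [ring|rewrite -natrD addn2].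
Qed.

Lemma Gf_asymptotic : Gf x / (rdist gm 0 x) ^- (n - 2) @[x --> (0 : V)^'] --> (1 : R).
Proof.
have H : 1 + Num.sqrt (sqn x) ^+ m @[x --> (0 : V)] --> (1 : R).
  have cH : continuous (fun x : V => 1 + Num.sqrt (sqn x) ^+ m).
    apply: contDg; [exact: contCg|apply: contXg].
    by apply: (cont_compg (f := Num.sqrt)); [exact: sqrt_continuous|exact: continuous_sqn].
  have := cH 0; rewrite /continuous_at (_ : sqn 0 = 0) ?sqrtr0; last first.
    by apply/eqP; rewrite sqn_eq0.
  by rewrite expr0n eqn0Ngt m_gt0 addr0.
have H' : 1 + Num.sqrt (sqn x) ^+ m @[x --> (0 : V)^'] --> (1 : R).
  by apply: cvg_trans H; apply: cvg_app; exact: nbhs_dnbhs.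
apply: cvg_trans H'; apply: near_eq_cvg; near=> x.
have x0 : x != 0 by near: x; exact: nbhs_dnbhs_neq.
have x1 : sqn x < 1.
  near: x; apply: nbhs_dnbhs; apply: open_nbhs_nbhs; split; first exact: open_B1.
  by rewrite /B1 /= (_ : sqn 0 = 0) ?ltr01//; apply/eqP; rewrite sqn_eq0.
rewrite rdist_near0// subn2 /= /Gf Pf_le1 ?(ltW x1)//.
rewrite -sqn_gt0 in x0; have r0 : 0 < Num.sqrt (sqn x) by rewrite sqrtr_gt0.
rewrite /w; move: (Num.sqrt (sqn x)) r0 => r r0.
by rewrite invrK exprVn mulrDl mul1r mulVf// expf_neq0// gt_eqF.
Unshelve. all: by end_near. Qed.

Lemma Gf_positive_green : positive_green gm 0 Gf.
Proof.
split; [exact: Gf_gt0|by apply/smoothP => k; exact: Ck_Gf|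
  exact: Gf_distributional|exact: Gf_asymptotic].
Qed.

End pole.

(** * Harmonicity off the pole and minimality *)

Section positive_integral.
Context {R : realType} {n : nat}.
Local Notation T := (measurableTypeR R).
Local Notation V := 'rV[R]_n.
Local Notation leb := (lebesgue_tuple R n).
Local Notation rv := (@rv_of_tuple R n).

Lemma integral_gt0 K (f : V -> R) (x0 : V) : 0 < K -> continuous f -> supp_in K f ->
  (forall x, 0 <= f x) -> 0 < f x0 -> (0 < \int[leb]_t (f (rv t))%:E)%E.
Proof.
move=> K0 cf sf f0 fx0.
have fx2 : 0 < f x0 / 2 by rewrite divr_gt0.
have [r r0 Hr] := cont_eps (cf x0) fx2.
have r20 : 0 < r / 2 by rewrite divr_gt0.
pose B := box [tuple (x0 ord0 j : T) | j < n] (r / 2).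
have mB : measurable B by exact: measurable_box.
apply: (@lt_le_trans _ _ ((f x0 / 2)%:E * leb B)%E).
  by rewrite measure_box// -EFinM lte_fin mulr_gt0// exprn_gt0// mulr_gt0.
rewrite -[B]setIT -integral_indic// -ge0_integralZl//; last 2 first.
- by apply/measurable_EFinP; exact: measurable_indic.
- by rewrite lee_fin ltW.
apply: ge0_le_integral => //.
- by move=> t _; rewrite -EFinM lee_fin mulr_ge0// ltW.
- by apply: measurable_funeM; apply/measurable_EFinP; exact: measurable_indic.
- by apply/measurable_EFinP; exact: measurable_rv_cont.
move=> t _; rewrite -EFinM lee_fin indicE.
have [tB|tB] := boolP (t \in B); last by rewrite mulr0.
rewrite mulr1; have : `|f (rv t) - f x0| < f x0 / 2.
  apply: Hr; apply: le_lt_trans (_ : r / 2 < r); last by lra.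
  rewrite [leLHS]/Num.Def.normr/= mx_normrE; apply: bigmax_le => [|[a j] _ /=].
    exact: ltW.
  rewrite (ord1 a) !mxE; move: tB; rewrite inE => /(_ j).
  by rewrite tnth_mktuple.
by rewrite ltr_norml => /andP[+ _]; lra.
Qed.

Definition bumpf (x0 : V) (r : R) (x : V) : R := 1 * flat_fun 1 (r ^+ 2 - sqn (x - x0)).

Lemma integral_neq0 K (s : R) (f : V -> R) (x0 : V) : 0 < K -> continuous f ->
  supp_in K f -> (forall x, 0 <= s * f x) -> 0 < s * f x0 ->
  (\int[leb]_t (f (rv t))%:E <> 0)%E.
Proof.
move=> K0 cf sf f0 fx0 I0.
have := integral_gt0 K0 (contMg (contCg (c := s)) cf) (supp_mull (fun=> s) sf) f0 fx0.
under eq_integral do rewrite EFinM.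
rewrite integralZl//; last exact: integrable_supp K0 cf sf.
by rewrite I0 mule0 ltxx.
Qed.

Lemma sqn0 : sqn (0 : V) = 0.
Proof. by apply/eqP; rewrite sqn_eq0. Qed.

Lemma integral_eq_diff0 K (f g : V -> R) : 0 < K -> continuous f -> continuous g ->
  supp_in K f -> supp_in K g -> (\int[leb]_t (f (rv t) - g (rv t))%:E = 0)%E ->
  (\int[leb]_t (f (rv t))%:E = \int[leb]_t (g (rv t))%:E)%E.
Proof.
move=> K0 cf cg sf sg H0.
have I1 := integrable_supp K0 cg sg.
have I2 : leb.-integrable setT (fun t => (f (rv t) - g (rv t))%:E).
  apply: eq_integrable (integrableB _ (integrable_supp K0 cf sf) I1) => // t _.
transitivity (\int[leb]_t ((g (rv t))%:E + (f (rv t) - g (rv t))%:E))%E.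
  by apply: eq_integral => t _; rewrite -EFinD addrC subrK.
by rewrite integralD// H0 adde0.
Qed.

Lemma Ck_sqnB k (x0 : V) : Ck k setT (fun x => sqn (x - x0)).
Proof.
rewrite (_ : (fun x => _) = fun x : V => \sum_j (x ord0 j - x0 ord0 j) ^+ 2).
  apply: Ck_sum openT _ => j; apply: CkX openT _.
  exact: CkB openT (Ck_coord _ _ openT) (CkC _ _ openT).
by apply/funext => x; apply: eq_bigr => j _; rewrite !mxE.
Qed.

Lemma Ck_bumpf k x0 (r : R) : Ck k setT (bumpf x0 r).
Proof.
apply: Ck_comp openT (smooth1_flat 1 1 setT) _ _ => //.
exact: CkB openT (CkC _ _ openT) (Ck_sqnB k x0).
Qed.

Lemma bumpf_gt0 x0 r x : sqn (x - x0) < r ^+ 2 -> 0 < bumpf x0 r x.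
Proof.
by rewrite -subr_gt0 => H; rewrite /bumpf flat_gt0// hornerC !mul1r expR_gt0.
Qed.

Lemma bumpf_eq0 x0 r x : r ^+ 2 <= sqn (x - x0) -> bumpf x0 r x = 0.
Proof. by rewrite -subr_le0 => H; rewrite /bumpf flat_le0// mulr0. Qed.

Lemma bumpf_ge0 x0 r x : 0 <= bumpf x0 r x.
Proof.
have [H|/bumpf_eq0->//] := ltP (sqn (x - x0)) (r ^+ 2).
exact: ltW (bumpf_gt0 H).
Qed.

Lemma coord_sqn (x : V) j : x ord0 j ^+ 2 <= sqn x.
Proof. by rewrite /sqn (bigD1 j)//= lerDl sumr_ge0// => i _; rewrite sqr_ge0. Qed.

Lemma norm_lt_sqn (z : V) (r : R) : 0 < r -> sqn z < r ^+ 2 -> `|z| < r.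
Proof.
move=> r0 zr; rewrite [ltLHS]/Num.Def.normr/= mx_normrE.
apply/bigmax_ltP; split=> // -[a j] _ /=.
rewrite (ord1 a) -(ltr_pXn2r (n := 2)) ?nnegrE ?(ltW r0)//.
by rewrite real_normK ?num_real//; exact: le_lt_trans (coord_sqn _ _) zr.
Qed.

Lemma supp_bumpf x0 r : 0 < r -> supp_in (`|x0| + r) (bumpf x0 r).
Proof.
move=> r0 x [j Hj]; apply: bumpf_eq0; apply: le_trans (coord_sqn _ j).
rewrite -[leRHS](real_normK (num_real _)) lerXn2r ?nnegrE ?(ltW r0)//.
rewrite !mxE; have := norm_coord x0 j; have := ler_normB (x ord0 j) (- x0 ord0 j).
have := ler_normD (x ord0 j - x0 ord0 j) (x0 ord0 j); rewrite subrK.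
by move: Hj; lra.
Qed.

Lemma bumpf_test x0 r : 0 < r -> test_function (bumpf x0 r).
Proof.
move=> r0; split; first by apply/smoothP => k; exact: Ck_bumpf.
pose K := `|x0| + r; have cK := @compact_cube R n K.
apply: (subclosed_compact _ cK); first exact: closed_closure.
rewrite closureE => z Hz; apply: Hz; split.
  exact: (compact_closed (@norm_hausdorff _ _) cK).
move=> x /= xn0; case: (cube_or K x) => // /(supp_bumpf r0) E.
by rewrite E eqxx in xn0.
Qed.

End positive_integral.

Section harmonic.
Context {R : realType} (m : nat).
Hypothesis m_gt0 : (0 < m)%N.
Local Notation n := m.+2.
Local Notation V := 'rV[R]_n.
Local Notation T := (measurableTypeR R).
Local Notation e i := (delta_mx ord0 i : V).
Implicit Types (x u v : V) (U : set V) (f h : V -> R).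
Local Notation sx := (@sx R m).
Local Notation kx := (@kx R m).
Local Notation gm := (@gm R m).
Local Notation Gf := (@Gf R m).
Local Notation leb := (lebesgue_tuple R n).
Local Notation rv := (@rv_of_tuple R n).

Lemma flux_comb f g h (a b : R) i x :
  (forall j, pderiv j f x = a * pderiv j g x + b * pderiv j h x) ->
  flux f i x = a * flux g i x + b * flux h i x.
Proof.
move=> H; rewrite /flux H.
have -> : euler f x = a * euler g x + b * euler h x.
  rewrite /euler !mulr_sumr -big_split; apply: eq_bigr => j _ /=; rewrite H; ring.
ring.
Qed.

Lemma green_ring (a b c d f g h k : R) :
  f * g + c * h - (k * a + d * b) = c * h - d * b + (g * f - a * k).
Proof. ring. Qed.

Lemma green_sum (a b : R) (F G P Q : 'I_n -> R) : \sum_i P i = \sum_i Q i ->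
  \sum_i (a * F i - b * G i + (P i - Q i)) = a * (\sum_i F i) - b * (\sum_i G i).
Proof. by move=> PQ; rewrite big_split /= !sumrB -!mulr_sumr PQ subrr addr0. Qed.

Lemma near_same_sign (s L : R) : `|L - s| < `|s| -> 0 < s * L.
Proof.
rewrite ltr_norml => /andP[]; have [s0|s0] := leP 0 s.
  by rewrite ger0_norm// => *; rewrite mulr_gt0//; lra.
by rewrite ltr0_norm// => *; rewrite nmulr_rgt0//; lra.
Qed.

Lemma near_open U (P : V -> Prop) x : open U -> U x -> (forall z, U z -> P z) ->
  \forall z \near x, P z.
Proof.
by move=> oU Ux H; apply: filterS (open_nbhs_nbhs (conj oU Ux)).
Qed.

(** The field [H grad chi - chi grad H] extends by zero across the pole, and its
    divergence is the difference of the two integrands. *)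
Lemma green_identity (H chi : V -> R) K : 0 < K -> (forall k, Ck k U0 H) ->
  (forall k, Ck k setT chi) -> supp_in K chi -> (\forall z \near (0 : V), chi z = 0) ->
  continuous (fun x => chi x * Lap H x) /\
  (\int[leb]_t (H (rv t) * Lap chi (rv t))%:E =
   \int[leb]_t (chi (rv t) * Lap H (rv t))%:E)%E.
Proof.
move=> K0 HH Hc sc c0.
have [r r0 Br] : exists2 r : R, 0 < r & forall z : V, `|z| < r -> chi z = 0.
  move: c0 => /nbhs_normP[r /= r0 Hr]; exists r => // z zr.
  by apply: Hr; rewrite /= sub0r normrN.
pose B : set V := [set z | `|z| < r].
have oB : open B.
  rewrite (_ : B = (fun z : V => `|z|) @^-1` [set y | y < r])//.
  apply: open_comp; last exact: open_lt.
  by move=> z _; exact: (@norm_continuous R V).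
have UB : U0 `|` B = setT.
  apply/seteqP; split=> // z _; have [->|] := eqVneq z 0; last by left.
  by right; rewrite /B /= normr0.
have chiB z : B z -> \forall y \near z, chi y = 0.
  by move=> Bz; exact: near_open oB Bz Br.
have pB z j : B z -> pderiv j chi z = 0.
  move=> /chiB Bz; rewrite (pderiv_eq (g := fun=> 0) j Bz).
  exact: isd_val (isdC 0 z (e j)).
have fB z i : B z -> flux chi i z = 0.
  move=> Bz; rewrite /flux /euler pB// big1 ?mulr0 ?subr0// => j _.
  by rewrite pB// mulr0.
have LB z : B z -> Lap chi z = 0.
  move=> Bz; rewrite /Lap big1// => i _.
  rewrite (pderiv_eq (g := fun=> 0) i (near_open oB Bz (fun z Bz => fB z i Bz))).
  exact: isd_val (isdC 0 z (e i)).
have glue k (F : V -> R) : Ck k U0 F -> (forall z, B z -> F z = 0) -> Ck k setT F.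
  move=> HF F0; rewrite -UB; apply: CkU => //.
  by apply: (@eq_Ck _ _ _ _ (fun=> 0)) => [|z /F0 ->|] //; exact: CkC.
have HcU k : Ck k U0 chi by exact: CkS (@subsetT _ _) (Hc k).
pose Y i z := H z * flux chi i z - chi z * flux H i z.
have HY i : Ck 1 setT (Y i).
  apply: glue; last by move=> z Bz; rewrite /Y fB// Br// mulr0 mul0r subr0.
  apply: CkB open_U0 _ _.
    exact: CkM open_U0 (HH 1%N) (Ck_flux i open_U0 (HcU 2%N)).
  exact: CkM open_U0 (HcU 1%N) (Ck_flux i open_U0 (HH 2%N)).
have sY i : supp_in K (Y i).
  by move=> z Kz; rewrite /Y (supp_flux i sc Kz) sc// mulr0 mul0r subr0.
have CL f k : Ck k.+2 U0 f -> Ck k U0 (Lap f).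
  move=> Hf; apply: Ck_sum open_U0 _ => i.
  exact: Ck_pderiv i (Ck_flux i open_U0 Hf).
have cA : continuous (fun x => chi x * Lap H x).
  apply: (Ck_continuous (k := 0)); apply: glue; last by move=> z /Br ->; rewrite mul0r.
  exact: CkM open_U0 (HcU 0%N) (CL H 0%N (HH 2%N)).
have cB : continuous (fun x => H x * Lap chi x).
  apply: (Ck_continuous (k := 0)); apply: glue; last by move=> z /LB ->; rewrite mulr0.
  exact: CkM open_U0 (HH 0%N) (CL chi 0%N (HcU 2%N)).
split; first exact: cA.
have sA : supp_in K (fun x => chi x * Lap H x).
  by move=> z /sc ->; rewrite mul0r.
have sB : supp_in K (fun x => H x * Lap chi x).
  by apply: supp_mull; exact: supp_Lap.
have DE z : \sum_i pderiv i (Y i) z = H z * Lap chi z - chi z * Lap H z.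
  have [Bz|z0] := pselect (B z).
    rewrite LB// Br// mulr0 mul0r subr0 big1// => i _.
    rewrite (pderiv_eq (g := fun=> 0) i (near_open oB Bz _)).
      exact: isd_val (isdC 0 z (e i)).
    by move=> y By; rewrite /Y fB// Br// mulr0 mul0r subr0.
  have Uz : U0 z.
    by apply/negP => /eqP Z; apply: z0; rewrite Z /B /= normr0.
  have D i : pderiv i (Y i) z = H z * pderiv i (flux chi i) z - chi z * pderiv i (flux H i) z
      + (flux chi i z * pderiv i H z - flux H i z * pderiv i chi z).
    have d1 := Ck_der (HH 1%N) i Uz; have d2 := Ck_der (HcU 1%N) i Uz.
    have d3 := Ck_der (Ck_flux i open_U0 (HcU 2%N)) i Uz.
    have d4 := Ck_der (Ck_flux i open_U0 (HH 2%N)) i Uz.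
    have := isd_val (isdB (isdM d1 d3) (isdM d2 d4)); rewrite -/(pderiv i (Y i) z) => ->.
    move: (pderiv i H z) (flux chi i z) (pderiv i (flux chi i) z) (pderiv i chi z).
    move: (flux H i z) (pderiv i (flux H i) z) (H z) (chi z); exact: green_ring.
  have FC : \sum_i flux chi i z * pderiv i H z = \sum_i flux H i z * pderiv i chi z.
    exact: fluxdotC chi H z.
  exact: etrans (eq_bigr _ (fun i _ => D i)) (green_sum _ _ _ _ FC).
apply: (integral_eq_diff0 K0 cB cA sB sA).
have := integral_div0 K0 HY sY.
by under eq_integral do rewrite DE.
Qed.

(** If [Lap H] were nonzero at [x], its integral against a bump around [x] would
    be nonzero, whereas it is [- c * bump 0 = 0] by Green's identity. *)
Lemma green_harmonic (H : V -> R) x : positive_green gm 0 H -> x != 0 -> Lap H x = 0.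
Proof.
move=> [_ sH [_ pH] _] x0.
have HH k : Ck k U0 H by have /smoothP := sH; exact.
have cL : {for x, continuous (Lap H)}.
  apply: continuous_sumf => i.
  exact: Ck_cont (Ck_pderiv i (Ck_flux i open_U0 (HH 2%N))) x0.
apply/eqP/negPn/negP => L0; pose s := Lap H x.
have s0 : 0 < `|s| by rewrite normr_gt0.
have [r1 r10 Hr1] := cont_eps cL s0.
have sLz (z : V) : `|z - x| < r1 -> 0 < s * Lap H z.
  by move=> /Hr1; rewrite -/s; exact: near_same_sign.
have y0 : 0 < sqn x by rewrite sqn_gt0.
pose q := Num.sqrt (sqn x); have q0 : 0 < q by rewrite sqrtr_gt0.
have q2 : q ^+ 2 = sqn x by rewrite sqr_sqrtr// ltW.
pose r := Num.min r1 (q / 2).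
have r0 : 0 < r by rewrite lt_min r10 divr_gt0.
have rq : r ^+ 2 < sqn x.
  rewrite -q2 ltrXn2r ?nnegrE ?(ltW r0) ?(ltW q0)//.
  by rewrite /r gt_min; apply/orP; right; lra.
have r1r : r <= r1 by rewrite /r ge_min lexx.
pose chi := bumpf x r.
have cz : \forall z \near (0 : V), chi z = 0.
  apply: (@near_open [set z | r ^+ 2 < sqn (z - x)]).
  - rewrite (_ : [set z | _] = (fun z => sqn (z - x)) @^-1` [set y | r ^+ 2 < y])//.
    apply: open_comp; last exact: open_gt.
    by move=> z _; exact: Ck_continuous (Ck_sqnB 0 x) z.
  - by rewrite /= sub0r sqnN.
  - by move=> z /= Hz; apply: bumpf_eq0; exact: ltW.
pose K := `|x| + r; have K0 : 0 < K by rewrite ltr_wpDl.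
have sc : supp_in K chi := supp_bumpf (x0 := x) r0.
have [cA EA] := green_identity K0 HH (fun k => Ck_bumpf k x r) sc cz.
have P0 : (\int[leb]_t (H (rv t) * Lap chi (rv t))%:E = 0)%E.
  have := pH chi (bumpf_test x r0).
  rewrite (nbhs_singleton cz) mulr0 => /eqP; rewrite oppe_eq0 => /eqP <-.
  by apply: eq_integral => t _ /=; rewrite -mulrA laplacian_flux.
have sA : supp_in K (fun z => chi z * Lap H z) by move=> z /sc ->; rewrite mul0r.
have sz0 z : 0 <= s * (chi z * Lap H z).
  have [zr|/bumpf_eq0 E] := ltP (sqn (z - x)) (r ^+ 2); last by rewrite /chi E mul0r mulr0.
  have sz : 0 < s * Lap H z by apply: sLz; exact: lt_le_trans (norm_lt_sqn r0 zr) r1r.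
  by rewrite mulrCA; exact: mulr_ge0 (bumpf_ge0 _ _ _) (ltW sz).
have sx0 : 0 < s * (chi x * Lap H x).
  rewrite mulrCA; apply: mulr_gt0; last by apply: sLz; rewrite subrr normr0.
  by apply: bumpf_gt0; rewrite subrr sqn0; exact: exprn_gt0.
exact: integral_neq0 K0 cA sA sz0 sx0 (etrans (esym EA) P0).
Qed.

End harmonic.

(** * The maximum principle and minimality *)

Section hessian_trace.
Context {R : realType} {n : nat}.
Local Notation V := 'rV[R]_n.

Lemma frame_gram (x : V) i j :
  \sum_k (sqn x * (i == k)%:R - x ord0 k * x ord0 i) *
         (sqn x * (j == k)%:R - x ord0 k * x ord0 j) =
  sqn x ^+ 2 * (i == j)%:R - sqn x * (x ord0 i * x ord0 j).
Proof.
set y := sqn x.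
have -> : \sum_k (y * (i == k)%:R - x ord0 k * x ord0 i) *
         (y * (j == k)%:R - x ord0 k * x ord0 j) =
  \sum_k (k == i)%:R * (y ^+ 2 * (j == k)%:R - y * (x ord0 k * x ord0 j))
  - \sum_k (k == j)%:R * (y * (x ord0 k * x ord0 i))
  + (\sum_k x ord0 k ^+ 2) * (x ord0 i * x ord0 j).
  rewrite -sumrB mulr_suml -big_split; apply: eq_bigr => k _ /=.
  by rewrite !(eq_sym k); ring.
rewrite !sum_delta -/(sqn x) -/y (eq_sym j); ring.
Qed.

(** Evaluate the form on the projections of the basis vectors orthogonally to
    [x]: the sum of these values is the trace minus the value at [x / |x|]. The
    vectors [u k] are these projections times [|x| ^ 2]. *)
Lemma psd_trace (h : 'I_n -> 'I_n -> R) (x : V) :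
  (forall v : V, 0 <= \sum_i \sum_j v ord0 i * v ord0 j * h i j) -> 0 < sqn x ->
  \sum_i \sum_j x ord0 i * x ord0 j * h i j <= sqn x * \sum_i h i i.
Proof.
move=> psd y0; set y := sqn x in y0 *; set Q := \sum_i \sum_j _.
pose u k : V := \row_i (y * (i == k)%:R - x ord0 k * x ord0 i).
have : 0 <= \sum_k \sum_i \sum_j u k ord0 i * u k ord0 j * h i j.
  by apply: sumr_ge0 => k _; exact: psd.
have -> : \sum_k \sum_i \sum_j u k ord0 i * u k ord0 j * h i j =
    y * (y * \sum_i h i i - Q).
  rewrite exchange_big /=.
  under eq_bigr do rewrite exchange_big /=.
  have E i j : \sum_k u k ord0 i * u k ord0 j * h i j =
      y ^+ 2 * ((j == i)%:R * h i j) - y * (x ord0 i * x ord0 j * h i j).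
    rewrite -mulr_suml (eq_bigr _ (fun k _ => congr2 *%R (mxE _ _ _ _) (mxE _ _ _ _))).
    by rewrite frame_gram -/y (eq_sym j); ring.
  under eq_bigr do under eq_bigr do rewrite E.
  under eq_bigr do rewrite sumrB -!mulr_sumr sum_delta.
  by rewrite sumrB -!mulr_sumr -/Q; ring.
by rewrite pmulr_rge0// subr_ge0.
Qed.

Lemma sum_lin2 (a b : R) (F G : 'I_n -> R) :
  \sum_i (a * F i - b * G i) = a * (\sum_i F i) - b * (\sum_i G i).
Proof. by rewrite sumrB -!mulr_sumr. Qed.

Lemma sum_lin3 (a b c : R) (F G K : 'I_n -> R) :
  \sum_i (a * F i + b * G i - c * K i) =
  a * (\sum_i F i) + b * (\sum_i G i) - c * (\sum_i K i).
Proof. by rewrite sumrB big_split /= -!mulr_sumr. Qed.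

Lemma quadratic_swap (h : 'I_n -> 'I_n -> R) (x : V) :
  \sum_i x ord0 i * \sum_j x ord0 j * h j i =
  \sum_i \sum_j x ord0 i * x ord0 j * h i j.
Proof.
rewrite exchange_big; apply: eq_bigr => i _; rewrite mulr_sumr.
by apply: eq_bigr => j _; rewrite mulrA (mulrC (x ord0 i)).
Qed.

End hessian_trace.

Section minimality.
Context {R : realType} (m : nat).
Hypothesis m_gt0 : (0 < m)%N.
Local Notation n := m.+2.
Local Notation V := 'rV[R]_n.
Local Notation e i := (delta_mx ord0 i : V).
Implicit Types (x u v : V) (U : set V) (f h : V -> R).
Local Notation sx := (@sx R m).
Local Notation kx := (@kx R m).
Local Notation gm := (@gm R m).
Local Notation Gf := (@Gf R m).

(** At a minimum only the second derivatives survive: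
    [Lap f = s (tr h - (kappa / s ^ 2) h(x, x))] for the Hessian [h >= 0], and
    [h(x, x) <= |x| ^ 2 tr h] while [kappa |x| ^ 2 < s ^ 2]. *)
Lemma Lap_min f x : Ck 2 U0 f -> x != 0 -> (forall z, z != 0 -> f x <= f z) ->
  0 <= Lap f x.
Proof.
move=> Hf x0 xmin.
have p0 i : pderiv i f x = 0 by exact: min_pderiv open_U0 (CkW Hf) x0 xmin.
have E0 : euler f x = 0 by rewrite /euler big1// => j _; rewrite p0 mulr0.
pose h i j := pderiv j (pderiv i f) x.
have psd (v : V) : 0 <= \sum_i \sum_j v ord0 i * v ord0 j * h i j.
  exact: min_hessian open_U0 Hf x0 xmin.
have s0 := sx_gt0 x; have k0 := kx_ge0 x; have S := S_kx x.
pose c i z := kx z / sx z * z ord0 i.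
have dc i : is_derive x (e i) (c i) (pderiv i (c i) x).
  apply: (Ck_der (k := 0) (U := setT)) => //; apply: CkM openT _ (Ck_coord _ _ openT).
  exact: CkM openT (Ck_kx _ _) (Ck_sxV _ openT).
have dE i : pderiv i (euler f) x = \sum_j x ord0 j * h j i.
  have := isd_val (isd_sum (index_enum _) (fun j => isdM (isd_coord j x (e i))
    (Ck_der (Ck_pderiv j Hf) i x0))).
  rewrite -/(pderiv i (euler f) x) => ->; apply: eq_bigr => j _.
  by rewrite p0 mulr0 add0r.
have D i : pderiv i (flux f i) x = sx x * h i i - kx x / sx x * (x ord0 i * \sum_j x ord0 j * h j i).
  have dE' := Ck_der (Ck_euler open_U0 Hf) i x0.
  have ds := Ck_der (Ck_sx m 1) i (I : setT x).
  have df := Ck_der (Ck_pderiv i Hf) i x0.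
  have := isd_val (isdB (isdM ds df) (isdM (dc i) dE')).
  rewrite -/(pderiv i (flux f i) x) => ->.
  by rewrite p0 E0 dE !mulr0 !add0r /c mulrA.
have -> : Lap f x = sx x * \sum_i h i i -
    kx x / sx x * \sum_i \sum_j x ord0 i * x ord0 j * h i j.
  apply: etrans (eq_bigr _ (fun i _ => D i)) _; apply: etrans (sum_lin2 _ _ _ _) _.
  by rewrite quadratic_swap.
have y0 : 0 < sqn x by rewrite sqn_gt0.
have Q1 := psd_trace psd y0; have Q0 := psd x.
move: (\sum_i \sum_j _) (\sum_i h i i) Q0 Q1 => Q t Q0 Q1.
have t0 : 0 <= t by rewrite -(pmulr_rge0 _ y0) (le_trans Q0).
have : kx x / sx x * Q <= kx x / sx x * (sqn x * t).
  by rewrite ler_wpM2l// divr_ge0// ltW.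
have -> : kx x / sx x * (sqn x * t) = sx x * t - t / sx x.
  have -> : kx x / sx x * (sqn x * t) = (kx x * sqn x) * t / sx x by ring.
  have -> : kx x * sqn x = sx x ^+ 2 - 1 by rewrite -S; ring.
  by field; rewrite gt_eqF.
have : 0 <= t / sx x by rewrite divr_ge0// ltW.
move: (kx x / sx x * Q) (t / sx x) (sx x * t) => *; lra.
Qed.

Lemma isd_Gf i x : x != 0 ->
  is_derive x (e i) Gf (- (m%:R * sx x * w (sqn x) ^+ n * x ord0 i)).
Proof.
rewrite -sqn_gt0 => y0.
have H := isdX m (isd_comp (isd_w y0) (isd_sqn x (e i))).
apply: is_derive_eq (isdD H (isd_Pfx i x)) _; rewrite dotp_e.
have E (W : R) : m%:R * W ^+ m.-1 * W ^+ 3 = m%:R * W ^+ n.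
  by case: m m_gt0 => // k _; rewrite -mulrA -exprD addn3.
transitivity (- (m%:R * w (sqn x) ^+ m.-1 * w (sqn x) ^+ 3) * x ord0 i -
    m%:R * (sx x - 1) * w (sqn x) ^+ n * x ord0 i).
  by move: (w _ ^+ m.-1) (w _ ^+ 3) (w _ ^+ n) (sx x) (m%:R : R) => *; field.
by rewrite E; move: (w _ ^+ n) (sx x) (m%:R : R) => *; ring.
Qed.

Lemma pderiv_Gf i x : x != 0 ->
  pderiv i Gf x = - (m%:R * sx x * w (sqn x) ^+ n * x ord0 i).
Proof. by move=> x0; exact: isd_val (isd_Gf i x0). Qed.

(** The stretching factor [s] disappears: the flux is that of [rho ^ -m] for the
    Euclidean metric. *)
Lemma flux_Gf i x : x != 0 -> flux Gf i x = - (m%:R * w (sqn x) ^+ n * x ord0 i).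
Proof.
move=> x0; have s0 := sx_gt0 x; have S := S_kx x.
rewrite /flux /euler pderiv_Gf//.
have -> : \sum_j x ord0 j * pderiv j Gf x = - (m%:R * sx x * w (sqn x) ^+ n * sqn x).
  rewrite /sqn mulr_sumr -sumrN; apply: eq_bigr => j _.
  rewrite pderiv_Gf// -/(sqn x).
  by move: (w _ ^+ n) (m%:R : R) => *; ring.
have -> : kx x / sx x * x ord0 i * - (m%:R * sx x * w (sqn x) ^+ n * sqn x) =
   - (m%:R * w (sqn x) ^+ n * x ord0 i * (kx x * sqn x)).
  by move: (sqn x) (w _ ^+ n) (m%:R : R) => *; field; rewrite gt_eqF.
have -> : kx x * sqn x = sx x ^+ 2 - 1 by rewrite -S; ring.
by move: (w _ ^+ n) (m%:R : R) => *; ring.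
Qed.

Lemma Lap_Gf x : x != 0 -> Lap Gf x = 0.
Proof.
move=> x0; have y0 : 0 < sqn x by rewrite sqn_gt0.
have D i : pderiv i (flux Gf i) x =
    m%:R * n%:R * w (sqn x) ^+ n.+2 * x ord0 i ^+ 2 - m%:R * w (sqn x) ^+ n.
  rewrite (pderiv_eq i (near_open open_U0 x0 (fun z => flux_Gf i (x := z)))).
  have H := isdX n (isd_comp (isd_w y0) (isd_sqn x (e i))).
  have := isd_val (isdN (isdM (isdMl m%:R H) (isd_coord i x (e i)))).
  rewrite /pderiv => ->; rewrite dotp_e mxE !eqxx /=.
  rewrite [w _ ^+ m.+4](_ : _ = w (sqn x) ^+ m.+1 * w (sqn x) ^+ 3); last first.
    by rewrite -exprD addn3.
  by move: (w _ ^+ m.+1) (w _ ^+ n) (w _ ^+ 3) (n%:R : R) (m%:R : R) => *; field.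
rewrite /Lap (eq_bigr _ (fun i _ => D i)) sumrB -mulr_sumr sumr_const card_ord.
rewrite -/(sqn x) [w _ ^+ m.+4](_ : _ = w (sqn x) ^+ n * w (sqn x) ^+ 2); last first.
  by rewrite -exprD addn2.
rewrite -[(_ * _) *+ n]mulr_natl; have := w_sqr y0.
move: (sqn x) (w _ ^+ n) (w _ ^+ 2) (m%:R : R) (n%:R : R) => y a b p q.
move=> by1; have -> : p * q * (a * b) * y = p * q * a * (b * y) by ring.
by rewrite by1; ring.
Qed.

Lemma fluxdot_Gf_gt0 x : x != 0 -> 0 < fluxdot Gf Gf x.
Proof.
move=> x0; have y0 : 0 < sqn x by rewrite sqn_gt0.
have -> : fluxdot Gf Gf x = m%:R ^+ 2 * sx x * w (sqn x) ^+ n ^+ 2 * sqn x.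
  rewrite /fluxdot /sqn mulr_sumr; apply: eq_bigr => i _.
  rewrite flux_Gf// pderiv_Gf// -/(sqn x).
  by move: (w _ ^+ n) (m%:R : R) => *; ring.
have wn : 0 < w (sqn x) ^+ n by rewrite exprn_gt0// w_gt0.
apply: mulr_gt0 => //; apply: mulr_gt0; last exact: exprn_gt0.
by apply: mulr_gt0; [rewrite exprn_gt0// ltr0n|exact: sx_gt0].
Qed.

(** [(1 + c) H - G + c sqrt G] is a strict supersolution, positive near the
    pole and at infinity, hence it has no negative minimum. *)
Section barrier.
Variables (H : V -> R) (c : R).
Hypotheses (PH : positive_green gm 0 H) (c0 : 0 < c).

Definition barrier z : R := (1 + c) * H z - Gf z + c * Num.sqrt (Gf z).

Let HH k : Ck k U0 H.
Proof. by have [_ sH _ _] := PH; have /smoothP := sH; exact. Qed.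

Lemma Ck_sqrtG k : Ck k U0 (fun z => Num.sqrt (Gf z)).
Proof.
apply: (@eq_Ck _ _ _ _ (fun z => Gf z * w (Gf z))); first exact: open_U0.
  move=> z z0; have G0 := Gf_gt0 z0; rewrite /w -{1}(sqr_sqrtr (ltW G0)) expr2.
  by rewrite mulfK// gt_eqF// sqrtr_gt0.
apply: CkM open_U0 (Ck_Gf m k) _.
apply: Ck_comp open_U0 smooth1_w _ (Ck_Gf m k) => z z0; exact: Gf_gt0.
Qed.

Lemma Ck_barrier k : Ck k U0 barrier.
Proof.
apply: CkD open_U0 _ (CkMl _ open_U0 (Ck_sqrtG k)).
exact: CkB open_U0 (CkMl _ open_U0 (HH k)) (Ck_Gf m k).
Qed.

Lemma flux_barrier i z : z != 0 -> flux barrier i z =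
  (1 + c) * flux H i z + (c / 2 * w (Gf z) - 1) * flux Gf i z.
Proof.
move=> z0; apply: flux_comb => j.
have dH := Ck_der (HH 1) j z0; have dG := Ck_der (Ck_Gf m 1) j z0.
have D := isd_val (isdD (isdB (isdMl (1 + c) dH) dG)
  (isdMl c (isd_sqrt (Gf_gt0 z0) dG))).
apply: etrans D _; rewrite /w.
have r0 : 0 < Num.sqrt (Gf z) by rewrite sqrtr_gt0; exact: Gf_gt0.
move: (pderiv j Gf z) (pderiv j H z) (Num.sqrt (Gf z)) r0 => a b r r0.
by field; rewrite gt_eqF.
Qed.

Lemma Lap_barrier_lt0 x : x != 0 -> Lap barrier x < 0.
Proof.
move=> x0; have G0 := Gf_gt0 x0.
pose a z : R := c / 2 * w (Gf z) - 1.
have D i : pderiv i (flux barrier i) x = (1 + c) * pderiv i (flux H i) x +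
    a x * pderiv i (flux Gf i) x - c / 4 * w (Gf x) ^+ 3 * (flux Gf i x * pderiv i Gf x).
  rewrite (pderiv_eq i (near_open open_U0 x0 (fun z => flux_barrier i (z := z)))).
  have dH := Ck_der (Ck_flux i open_U0 (HH 2)) i x0.
  have dG := Ck_der (Ck_flux i open_U0 (Ck_Gf m 2)) i x0.
  have dw := isd_comp (isd_w G0) (Ck_der (Ck_Gf m 1) i x0).
  have da := isdB (isdMl (c / 2) dw) (isdC 1 x (e i)).
  apply: etrans (isd_val (isdD (isdMl (1 + c) dH) (isdM da dG))) _.
  rewrite -/(a x); move: (pderiv i (flux H i) x) (pderiv i (flux Gf i) x) (flux Gf i x).
  by move: (a x) (w (Gf x)) (pderiv i Gf x) => *; field.
have LE : Lap barrier x = (1 + c) * Lap H x + a x * Lap Gf x -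
    c / 4 * w (Gf x) ^+ 3 * fluxdot Gf Gf x.
  exact: etrans (eq_bigr _ (fun i _ => D i)) (sum_lin3 _ _ _ _ _ _).
rewrite LE (green_harmonic PH x0) Lap_Gf// !mulr0 !add0r oppr_lt0.
apply: mulr_gt0; last exact: fluxdot_Gf_gt0.
by rewrite mulr_gt0 ?divr_gt0// exprn_gt0// w_gt0.
Qed.

(** [H / rho ^ -m] and [Gf / rho ^ -m] tend to [1], so the first two terms of the
    barrier are asymptotic to [c rho ^ -m]. *)
Lemma barrier_near_pole : \forall z \near (0 : V)^', 0 < barrier z.
Proof.
have [_ _ _ aH] := PH.
have aG : Gf z / (rdist gm 0 z) ^- (n - 2) @[z --> (0 : V)^'] --> (1 : R).
  exact: Gf_asymptotic.
have L : (1 + c) * (H z / (rdist gm 0 z) ^- (n - 2)) -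
    Gf z / (rdist gm 0 z) ^- (n - 2) @[z --> (0 : V)^'] --> c.
  rewrite [X in _ --> X](_ : c = (1 + c) * 1 - 1); last by ring.
  exact: cvgB (cvgM (cvg_cst (1 + c)) aH) aG.
have nL : \forall z \near (0 : V)^', 0 < (1 + c) * (H z / (rdist gm 0 z) ^- (n - 2)) -
    Gf z / (rdist gm 0 z) ^- (n - 2) by exact: cvgr_gt c L 0 c0.
near=> z.
have z0 : z != 0 by near: z; exact: nbhs_dnbhs_neq.
have z1 : sqn z < 1.
  near: z; apply: nbhs_dnbhs; apply: open_nbhs_nbhs; split; first exact: open_B1.
  by rewrite /B1 /= sqn0.
have : 0 < (1 + c) * (H z / (rdist gm 0 z) ^- (n - 2)) - Gf z / (rdist gm 0 z) ^- (n - 2).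
  by near: z.
rewrite rdist_near0//; have r0 : 0 < Num.sqrt (sqn z) by rewrite sqrtr_gt0 sqn_gt0.
move: (exprn_gt0 (n - 2) r0); rewrite mulrA -mulrBl invrK => q0.
rewrite pmulr_lgt0// /barrier => P; rewrite ltr_pwDl//.
by rewrite mulr_ge0 ?sqrtr_ge0// ltW.
Unshelve. all: by end_near. Qed.

(** [c sqrt G >= G] as soon as [G <= c ^ 2]; and [G] tends to [0], being
    [u + 1 - E (1 - u)] for [u = rho ^ -m]. *)
Lemma barrier_far : exists2 K : R, 0 < K & forall z : V, (exists j, K < `|z ord0 j|) ->
  0 <= barrier z.
Proof.
pose gg (u : R) : R := u + 1 - E (1 - u).
have dg : is_derive (0 : R) 1 gg (1 + 0 - E1 (1 - 0) * (0 - 1)).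
  have d1 : is_derive (0 : R) 1 (fun u : R => u + 1) (1 + 0).
    exact: isdD (is_derive_id (0 : R) 1) (isdC 1 _ _).
  have d2 : is_derive (0 : R) 1 (fun u : R => 1 - u) (0 - 1).
    exact: isdB (isdC 1 _ _) (is_derive_id (0 : R) 1).
  have d3 := isd_comp (phi := E) (f := fun u : R => 1 - u) (isd_E (1 - 0)) d2.
  exact: (isdB (f := fun u : R => u + 1) (g := fun u : R => E (1 - u)) d1 d3).
have g0 : gg 0 = 0 by rewrite /gg subr0 E_1 add0r subrr.
have c2 : 0 < c ^+ 2 by rewrite exprn_gt0.
have [d d0 Hd] : exists2 d : R, 0 < d & forall u : R, 0 <= u -> u < d -> gg u < c ^+ 2.
  have /cvgrPdist_lt/(_ _ c2) := isd_cont dg; rewrite g0.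
  move=> /nbhs_normP[d /= d0 Hd]; exists d => // u u0 ud.
  have : `|0 - u| < d by rewrite sub0r normrN ger0_norm.
  by move=> /Hd; rewrite sub0r normrN; apply: le_lt_trans; exact: ler_norm.
exists (1 + d^-1); first by rewrite addr_gt0 ?invr_gt0.
move=> z [j zj]; set K := 1 + d^-1 in zj.
have K1 : 1 < K by rewrite ltrDl invr_gt0.
have K0 : 0 < K by exact: lt_trans K1.
have Kz : K ^+ 2 < sqn z.
  apply: lt_le_trans (coord_sqn z j).
  by rewrite -(real_normK (num_real (z ord0 j))) ltrXn2r ?nnegrE// ltW.
have y0 : 0 < sqn z by apply: le_lt_trans Kz; rewrite sqr_ge0.
have wK : w (sqn z) < K^-1.
  rewrite /w ltf_pV2 ?posrE ?sqrtr_gt0//.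
  by rewrite -(gtr0_norm K0) -sqrtr_sqr ltr_sqrt.
have w0 := w_ge0 (sqn z).
have Kd : K^-1 < d by rewrite -[ltRHS]invrK ltf_pV2 ?posrE ?invr_gt0// ltrDr.
have w1 : w (sqn z) <= 1 by apply: le_trans (ltW wK) _; rewrite invf_le1// ltW.
have wm : w (sqn z) ^+ m < d.
  apply: le_lt_trans (lt_trans wK Kd).
  by rewrite -[leRHS]expr1 ler_wiXn2l.
have z0 : z != 0 by rewrite -sqn_gt0.
have GE : Gf z = gg (w (sqn z) ^+ m) by rewrite /Gf /Pf /v y0 /gg addrA.
have Gc : Gf z <= c ^+ 2 by rewrite GE ltW// Hd// exprn_ge0.
have [H0 _ _ _] := PH; have Hz := H0 z z0; have G0 := Gf_gt0 z0.
have rc : Num.sqrt (Gf z) <= c by rewrite -(gtr0_norm c0) -sqrtr_sqr ler_wsqrtr.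
rewrite /barrier -{1}(sqr_sqrtr (ltW G0)).
have : 0 <= Num.sqrt (Gf z) * (c - Num.sqrt (Gf z)).
  by rewrite mulr_ge0 ?sqrtr_ge0// subr_ge0.
have : 0 <= (1 + c) * H z by rewrite mulr_ge0 ?ltW// addr_gt0.
by move: (Num.sqrt (Gf z)) ((1 + c) * H z) => r a; lra.
Qed.

Lemma barrier_ge0 x : x != 0 -> 0 <= barrier x.
Proof.
move=> x0; rewrite leNgt; apply/negP => bx.
have [r r0 Hr] : exists2 r : R, 0 < r & forall z : V, z != 0 -> `|z| < r -> 0 < barrier z.
  have := barrier_near_pole => /nbhs_normP[r /= r0 Hr]; exists r => // z z0 zr.
  by apply: Hr => //=; rewrite sub0r normrN.
have [K K0 HK] := barrier_far.
(* A negative value is taken on this compact set only, so its minimum there is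
   global. *)
pose A : set V := [set z | r <= `|z|] `&` cube K.
have Ax : A x.
  split; first by rewrite /= leNgt; apply/negP => /(Hr _ x0); rewrite ltNge (ltW bx).
  by case: (cube_or K x) => // /HK; rewrite leNgt bx.
have A0 z : A z -> z != 0.
  by move=> [+ _]; apply: contraTneq => -> /=; rewrite normr0 -ltNge.
have cA : compact A.
  rewrite /A setIC; apply: compact_closedI; first exact: compact_cube.
  rewrite (_ : [set z : V | r <= `|z|] = (fun z : V => `|z|) @^-1` [set y | r <= y])//.
  apply: preimage_closed; last exact: closed_ge.
  by move=> z _; exact: (@norm_continuous R V).
have [|c' cA' cmin] := @EVT_min_rV R n barrier A (ex_intro _ x Ax) cA.
  apply: continuous_in_subspaceT => z; rewrite inE => /A0 z0.
  exact: Ck_cont (Ck_barrier 0) z0.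
rewrite inE in cA'; have c'0 := A0 _ cA'.
have bc : barrier c' < 0 by apply: le_lt_trans (cmin x _) bx; rewrite inE.
have gmin z : z != 0 -> barrier c' <= barrier z.
  move=> z0; have [Az|Az] := pselect (A z); first by apply: cmin; rewrite inE.
  apply: le_trans (ltW bc) _; have [zr|zr] := ltP `|z| r; first exact: ltW (Hr z z0 zr).
  by case: (cube_or K z) => [Kz|/HK//]; exfalso; exact: Az.
have := Lap_min (Ck_barrier 2) c'0 gmin.
by rewrite leNgt Lap_barrier_lt0.
Qed.

End barrier.

Lemma Gf_minimal : minimal_positive_green gm 0 Gf.
Proof.
split=> [|H PH x x0]; first exact: Gf_positive_green.
have [H0 _ _ _] := PH; have G0 := Gf_gt0 x0.
apply/ler_addgt0Pr => d d0.
have s0 : 0 < H x + Num.sqrt (Gf x) by rewrite addr_gt0 ?sqrtr_gt0 ?H0.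
have c0 : 0 < d / (H x + Num.sqrt (Gf x)) by rewrite divr_gt0.
have := barrier_ge0 PH c0 x0; rewrite /barrier.
have E : d / (H x + Num.sqrt (Gf x)) * (H x + Num.sqrt (Gf x)) = d.
  by rewrite divfK// gt_eqF.
move: (d / _) E => q; lra.
Qed.

Lemma minimal_unique G x : minimal_positive_green gm 0 G -> x != 0 -> G x = Gf x.
Proof.
move=> [PG minG] x0; apply/eqP; rewrite eq_le minG//=; last exact: Gf_positive_green.
by have [_ minGf] := Gf_minimal; exact: minGf.
Qed.

End minimality.

(** * Symbol estimates at the pole *)

Section symbols.
Context {R : realType} {n : nat}.
Local Notation V := 'rV[R]_n.
Local Notation e i := (delta_mx ord0 i : V).
Implicit Types (f g : V -> R) (k : nat) (d : int).

Definition rho (x : V) : R := Num.sqrt (sqn x).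

Definition punctured : set V := U0 `&` B1.

Lemma open_punctured : open punctured.
Proof. exact: openI open_U0 open_B1. Qed.

(** Functions of order [rho ^ d] at the origin, each of the first [k]
    derivatives lowering the order by one. *)
Fixpoint Sym k d f : Prop :=
  (exists2 C : R, 0 <= C & forall x, punctured x -> `|f x| <= C * rho x ^ d) /\
  (if k is k'.+1 then
     forall i, (forall x, punctured x -> derivable f x (e i)) /\ Sym k' (d - 1) (pderiv i f)
   else True).

Lemma rho_gt0 x : punctured x -> 0 < rho x.
Proof. by move=> [x0 _]; rewrite sqrtr_gt0 sqn_gt0. Qed.

Lemma rho_sqr x : rho x ^+ 2 = sqn x.
Proof. by rewrite sqr_sqrtr// sqn_ge0. Qed.

Lemma rho_ge0 x : 0 <= rho x.
Proof. exact: sqrtr_ge0. Qed.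

Lemma rho_lt1 x : B1 x -> rho x < 1.
Proof. by move=> x1; rewrite -sqrtr1 ltr_sqrt. Qed.

Lemma exprz_rho_ge0 x d : 0 <= rho x ^ d.
Proof. exact: exprz_ge0 (rho_ge0 x). Qed.

Lemma Sym_bound k d f : Sym k d f ->
  exists2 C : R, 0 <= C & forall x, punctured x -> `|f x| <= C * rho x ^ d.
Proof. by case: k => [|k] []. Qed.

Lemma eq_Sym k d f g : (forall x, punctured x -> f x = g x) -> Sym k d f -> Sym k d g.
Proof.
elim: k d f g => [|k IH] d f g fg [[C C0 HC] H]; split=> //.
- by exists C => // x Ux; rewrite -fg//; exact: HC.
- by exists C => // x Ux; rewrite -fg//; exact: HC.
have fgn x : punctured x -> \forall z \near x, f z = g z.
  by move=> Ux; apply: filterS (open_nbhs_nbhs (conj open_punctured Ux)) => z; exact: fg.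
move=> i; split=> [x Ux|]; first exact: near_eq_derivable (fgn x Ux) ((H i).1 x Ux).
by apply: IH (H i).2 => x Ux; apply: pderiv_eq; exact: fgn.
Qed.

Lemma SymI k d f (df : 'I_n -> V -> R) (C : R) : 0 <= C ->
  (forall x, punctured x -> `|f x| <= C * rho x ^ d) ->
  (forall i x, punctured x -> is_derive x (e i) f (df i x)) ->
  (forall i, Sym k (d - 1) (df i)) -> Sym k.+1 d f.
Proof.
move=> C0 HC df1 df2; split; first by exists C.
move=> i; split=> [x Ux|]; first exact: isd_ex (df1 i x Ux).
by apply: eq_Sym (df2 i) => x Ux; rewrite /pderiv (isd_val (df1 i x Ux)).
Qed.

Lemma Sym_der k d f i x : Sym k.+1 d f -> punctured x -> is_derive x (e i) f (pderiv i f x).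
Proof. by move=> [_ H] Ux; apply: derivableP; exact: (H i).1. Qed.

Lemma Sym_pderiv k d f i : Sym k.+1 d f -> Sym k (d - 1) (pderiv i f).
Proof. by move=> [_ H]; exact: (H i).2. Qed.

Lemma SymW k d f : Sym k.+1 d f -> Sym k d f.
Proof.
elim: k d f => [|k IH] d f [H1 H2]; split=> // i; split; first exact: (H2 i).1.
by apply: IH; exact: (H2 i).2.
Qed.

Lemma Sym_le k d (j : nat) f : Sym k (d + j%:Z) f -> Sym k d f.
Proof.
have H f' d' : (exists2 C : R, 0 <= C & forall x, punctured x -> `|f' x| <= C * rho x ^ (d' + j%:Z)) ->
    exists2 C : R, 0 <= C & forall x, punctured x -> `|f' x| <= C * rho x ^ d'.
  move=> [C C0 HC]; exists C => // x Ux; apply: le_trans (HC x Ux) _.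
  rewrite ler_wpM2l// expfzDr ?gt_eqF ?rho_gt0// -exprnP ler_piMr ?exprz_rho_ge0//.
  by rewrite exprn_ile1 ?rho_ge0//; exact: ltW (rho_lt1 Ux.2).
elim: k d f => [|k IH] d f [/H H1 H2]; split=> // i; split; first exact: (H2 i).1.
by apply: IH; rewrite addrAC; exact: (H2 i).2.
Qed.

Lemma SymD k d f g : Sym k d f -> Sym k d g -> Sym k d (fun x => f x + g x).
Proof.
have H f' g' d' : (exists2 C : R, 0 <= C & forall x, punctured x -> `|f' x| <= C * rho x ^ d') ->
    (exists2 C : R, 0 <= C & forall x, punctured x -> `|g' x| <= C * rho x ^ d') ->
    exists2 C : R, 0 <= C & forall x, punctured x -> `|f' x + g' x| <= C * rho x ^ d'.
  move=> [C C0 HC] [C' C'0 HC']; exists (C + C'); first by rewrite addr_ge0.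
  move=> x Ux; rewrite mulrDl; apply: le_trans (ler_normD _ _) _.
  by apply: lerD; [exact: HC|exact: HC'].
elim: k d f g => [|k IH] d f g Hf Hg; first by split=> //; exact: H Hf.1 Hg.1.
have [C C0 HC] := H _ _ _ Hf.1 Hg.1.
apply: (SymI (df := fun i x => pderiv i f x + pderiv i g x) C0 HC).
  by move=> i x Ux; exact: isdD (Sym_der i Hf Ux) (Sym_der i Hg Ux).
by move=> i; apply: IH; exact: Sym_pderiv.
Qed.

Lemma SymM k d d' f g : Sym k d f -> Sym k d' g -> Sym k (d + d') (fun x => f x * g x).
Proof.
have H f' g' c c' : (exists2 C : R, 0 <= C & forall x, punctured x -> `|f' x| <= C * rho x ^ c) ->
    (exists2 C : R, 0 <= C & forall x, punctured x -> `|g' x| <= C * rho x ^ c') ->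
    exists2 C : R, 0 <= C & forall x, punctured x -> `|f' x * g' x| <= C * rho x ^ (c + c').
  move=> [C C0 HC] [C' C'0 HC']; exists (C * C'); first by rewrite mulr_ge0.
  move=> x Ux; rewrite expfzDr ?gt_eqF ?rho_gt0// mulrACA normrM.
  by apply: ler_pM => //; [exact: HC|exact: HC'].
elim: k d d' f g => [|k IH] d d' f g Hf Hg; first by split=> //; exact: H Hf.1 Hg.1.
have [C C0 HC] := H _ _ _ _ Hf.1 Hg.1.
apply: (SymI (df := fun i x => pderiv i f x * g x + f x * pderiv i g x) C0 HC).
  by move=> i x Ux; exact: isdM (Sym_der i Hf Ux) (Sym_der i Hg Ux).
move=> i; apply: SymD.
  by rewrite addrAC; apply: IH (Sym_pderiv i Hf) (SymW Hg).
by rewrite -addrA; apply: IH (SymW Hf) (Sym_pderiv i Hg).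
Qed.

Lemma SymC k (c : R) : Sym k 0 (fun=> c).
Proof.
suff H (d : int) (c' : R) : (forall x, punctured x -> `|c'| <= `|c'| * rho x ^ d) -> Sym k d (fun=> c').
  by apply: H => x _; rewrite expr0z mulr1.
elim: k d c' => [|k IH] d c' H; first by split=> //; exists `|c'|.
apply: (SymI (df := fun _ _ => 0) (normr_ge0 c') H) => i.
by apply: IH => x Ux; rewrite normr0 mul0r.
Qed.

Lemma SymMl k d (c : R) f : Sym k d f -> Sym k d (fun x => c * f x).
Proof. by move=> Hf; rewrite -[d]add0r; exact: SymM (SymC k c) Hf. Qed.

Lemma coord_le_rho (x : V) j : `|x ord0 j| <= rho x.
Proof. by rewrite -sqrtr_sqr ler_wsqrtr// coord_sqn. Qed.

Lemma Sym_coord k j : Sym k 1 (fun x => x ord0 j).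
Proof.
have H (x : V) : punctured x -> `|x ord0 j| <= 1 * rho x ^ (1 : int).
  by rewrite mul1r expr1z => _; exact: coord_le_rho.
case: k => [|k]; first by split=> //; exists 1.
apply: (SymI (df := fun i _ => (e i) ord0 j) ler01 H) => [i x _|i].
  exact: isd_coord.
by rewrite subrr; exact: SymC.
Qed.

Lemma Sym_w k : Sym k (-1) (fun x => w (sqn x)).
Proof.
have H (x : V) : punctured x -> `|w (sqn x)| <= 1 * rho x ^ (-1 : int).
  move=> Ux; rewrite mul1r ger0_norm ?w_ge0//.
elim: k => [|k IH]; first by split=> //; exists 1.
apply: (SymI (df := fun i x => - 1 * (w (sqn x) * (w (sqn x) * (w (sqn x) * x ord0 i)))) ler01 H).
  move=> i x Ux; have y0 : 0 < sqn x by rewrite sqn_gt0; exact: Ux.1.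
  apply: is_derive_eq (isd_comp (isd_w y0) (isd_sqn x (e i))) _.
  by rewrite dotp_e; field.
move=> i; apply: SymMl; rewrite -[-1 - 1 : int]/(-1 + (-1 + (-1 + 1))).
by apply: SymM IH (SymM IH (SymM IH (Sym_coord k i))).
Qed.

Lemma isd_rho i x : punctured x -> is_derive x (e i) rho (x ord0 i * w (sqn x)).
Proof.
move=> Ux; have y0 : 0 < sqn x by rewrite sqn_gt0; exact: Ux.1.
apply: is_derive_eq (isd_sqrt y0 (isd_sqn x (e i))) _.
rewrite dotp_e /w; have r0 : 0 < Num.sqrt (sqn x) by rewrite sqrtr_gt0.
by move: (Num.sqrt (sqn x)) r0 => r r0; field; rewrite gt_eqF.
Qed.

Lemma Sym_rho k : Sym k 1 rho.
Proof.
have H (x : V) : punctured x -> `|rho x| <= 1 * rho x ^ (1 : int).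
  by rewrite mul1r expr1z ger0_norm ?rho_ge0.
case: k => [|k]; first by split=> //; exists 1.
apply: (SymI (df := fun i x => x ord0 i * w (sqn x)) ler01 H) => [i x|i].
  exact: isd_rho.
exact: SymM (Sym_coord k i) (Sym_w k).
Qed.

Lemma Sym_rhoX k j : Sym k j%:Z (fun x => rho x ^+ j).
Proof.
elim: j => [|j IH].
  by apply: eq_Sym (SymC k 1) => x _; rewrite expr0.
apply: (@eq_Sym _ _ (fun x => rho x * rho x ^+ j)); first by move=> x _; rewrite exprS.
by rewrite -addn1 PoszD addrC; exact: SymM (Sym_rho k) IH.
Qed.

Section composition.
Variables (m : nat) (phi : nat -> R -> R) (M : nat -> R).
Hypothesis phi_le : forall j u, 0 <= u <= 1 -> `|phi j u| <= M j.
Hypothesis isd_phi : forall j (u : R), 0 <= u -> is_derive u 1 (phi j) (phi j.+1 u).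

Let rhoX01 x : punctured x -> 0 <= rho x ^+ m <= 1.
Proof.
move=> Ux; rewrite exprn_ge0 ?rho_ge0//= exprn_ile1 ?rho_ge0//.
exact: ltW (rho_lt1 Ux.2).
Qed.

Let M0 j : 0 <= M j.
Proof. by apply: le_trans (phi_le j (_ : 0 <= 0 <= 1)); rewrite ?normr_ge0 ?lexx ?ler01. Qed.

Lemma isd_phi_rho i j x : punctured x -> is_derive x (e i) (fun x => phi j (rho x ^+ m))
  (phi j.+1 (rho x ^+ m) * pderiv i (fun x => rho x ^+ m) x).
Proof.
move=> Ux; apply: isd_comp; first by apply: isd_phi; case/andP: (rhoX01 Ux).
have [_ H] := Sym_rhoX 1%N m.
exact: derivableP ((H i).1 x Ux).
Qed.

Lemma Sym_phi k j : Sym k 0 (fun x => phi j (rho x ^+ m)).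
Proof.
elim: k j => [|k IH] j.
  split=> //; exists (M j) => // x Ux; rewrite expr0z mulr1; apply: phi_le; exact: rhoX01.
apply: (SymI (C := M j)) => //.
- by move=> x Ux; rewrite expr0z mulr1; apply: phi_le; exact: rhoX01.
- by move=> i x Ux; exact: isd_phi_rho.
(* The derivative of [rho ^ m] has order [m - 1], better than the order [-1]
   that is needed. *)
move=> i; apply: (@Sym_le _ _ m); rewrite sub0r -[-1 + _]add0r [-1 + _]addrC.
exact: SymM (IH j.+1) (Sym_pderiv i (Sym_rhoX k.+1 m)).
Qed.

(** The difference vanishes to first order in [rho ^ m]. *)
Lemma Sym_phi_sub k : Sym k m%:Z (fun x => phi 0%N (rho x ^+ m) - phi 0%N 0).
Proof.
have H x : punctured x -> `|phi 0%N (rho x ^+ m) - phi 0%N 0| <= M 1%N * rho x ^ (m%:Z).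
  move=> Ux; rewrite -exprnP; have /andP[u0 u1] := rhoX01 Ux.
  move: (rho x ^+ m) u0 u1 => u; rewrite le_eqVlt => /predU1P[<-|u0] u1.
    by rewrite subrr normr0 mulr0.
  have [||s] := @MVT R (phi 0%N) (phi 1%N) 0 u u0.
  - by move=> t; rewrite in_itv/= => /andP[t0 _]; apply: isd_phi; exact: ltW.
  - apply: continuous_in_subspaceT => t; rewrite inE/= in_itv/= => /andP[t0 _].
    exact: isd_cont (isd_phi 0%N t0).
  rewrite in_itv/= => /andP[s0 su] ->; rewrite subr0 normrM (gtr0_norm u0).
  by rewrite ler_wpM2r ?(ltW u0)//; apply: phi_le; rewrite (ltW s0)/= (le_trans (ltW su)).
case: k => [|k]; first by split=> //; exists (M 1%N).
apply: (SymI (M0 1%N) H (df := fun i x => phi 1%N (rho x ^+ m) * pderiv i (fun x => rho x ^+ m) x)).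
  move=> i x Ux; apply: is_derive_eq (isdB (isd_phi_rho i 0%N Ux) (isdC _ x (e i))) _.
  by rewrite subr0.
move=> i; rewrite -[_ - 1]add0r.
exact: SymM (Sym_phi k 1%N) (Sym_pderiv i (Sym_rhoX k.+1 m)).
Qed.

End composition.
End symbols.

(** * Regularity across the pole *)

Section across_the_pole.
Context {R : realType} {n : nat}.
Local Notation V := 'rV[R]_n.
Local Notation e i := (delta_mx ord0 i : V).
Implicit Types (f g : V -> R) (k : nat) (x y : V).

Lemma rho_le_norm x : rho x <= n%:R * `|x|.
Proof.
have n0 : 0 <= n%:R * `|x| by rewrite mulr_ge0.
rewrite -(ger0_norm n0) -sqrtr_sqr ler_wsqrtr//.
apply: (@le_trans _ _ (\sum_(j < n) `|x| ^+ 2)).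
  apply: ler_sum => j _; rewrite -(real_normK (num_real _)).
  by rewrite lerXn2r ?nnegrE// norm_coord.
rewrite sumr_const card_ord -[leLHS]mulr_natl exprMn ler_wpM2r ?sqr_ge0//.
case: (n) => [|k]; first by rewrite expr2 mul0r.
by rewrite expr2 ler_peMr// ler1n.
Qed.

Lemma rho0 : rho (0 : V) = 0.
Proof. by rewrite /rho sqn0 sqrtr0. Qed.

Lemma rhoZ (t : R) i : rho (t *: e i) = `|t|.
Proof. by rewrite /rho -dotp_sqn dotpZl dotpZr dotp_sqn sqn_e mulr1 sqrtr_sqr. Qed.

Lemma B10 : B1 (0 : V).
Proof. by rewrite /B1 /= sqn0. Qed.

Lemma punctured_or0 x : B1 x -> x = 0 \/ punctured x.
Proof. by move=> x1; have [->|x0] := eqVneq x 0; [left|right]. Qed.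

Lemma Sym_bound0 k f : f 0 = 0 -> Sym k 1 f ->
  exists2 C : R, 0 <= C & forall x, B1 x -> `|f x| <= C * rho x.
Proof.
move=> f0 /Sym_bound[C C0 HC]; exists C => // x /punctured_or0[->|/HC//].
by rewrite f0 normr0 rho0 mulr0.
Qed.

Lemma near_B1 x : B1 x -> exists2 r : R, 0 < r & forall y, `|y - x| < r -> B1 y.
Proof. exact: open_eps (@open_B1 R n). Qed.

Lemma Sym_cont0 k f : f 0 = 0 -> Sym k 1 f -> {for 0, continuous f}.
Proof.
move=> f0 /(Sym_bound0 f0)[C C0 HC]; apply: eps_cont => d d0.
have [r r0 Hr] := near_B1 B10.
have q0 : 0 < C * n%:R + 1 by rewrite ltr_wpDl// mulr_ge0.
exists (Num.min r (d / (C * n%:R + 1))); first by rewrite lt_min r0 divr_gt0.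
move=> y; rewrite lt_min => /andP[/Hr y1]; rewrite f0 !subr0 => yd.
apply: le_trans (HC y y1) _; apply: (@le_trans _ _ (C * (n%:R * `|y|))).
  by rewrite ler_wpM2l// rho_le_norm.
move: yd; rewrite ltr_pdivlMr// mulrA => /ltW; apply: le_trans.
by rewrite mulrC ler_wpM2l// lerDl.
Qed.

(** [f] is [O (t ^ 2)] on the line. *)
Lemma Sym_diff0 k f i : f 0 = 0 -> Sym k 2 f -> is_derive (0 : V) (e i) f 0.
Proof.
move=> f0 /Sym_bound[C C0 HC]; apply: eps_isd => d d0.
have q0 : 0 < C + 1 by rewrite ltr_wpDl.
exists (Num.min 1 (d / (C + 1))); first by rewrite lt_min ltr01 divr_gt0.
move=> t; rewrite lt_min => /andP[t1 td]; rewrite addr0 f0 mulr0 !subr0.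
have [->|t0] := eqVneq t 0; first by rewrite scale0r f0 normr0 mulr0.
have nt : 0 < `|t| by rewrite normr_gt0.
have Ut : punctured (t *: e i).
  split; first by rewrite /U0 /= -sqn_gt0 -rho_sqr rhoZ exprn_gt0.
  by rewrite /B1 /= -rho_sqr rhoZ expr_lt1// ltW.
apply: le_trans (HC _ Ut) _; rewrite rhoZ -[_ ^ _]/(`|t| ^+ 2) expr2 mulrA ler_wpM2r//.
move: td; rewrite ltr_pdivlMr// mulrC => /ltW; apply: le_trans.
by rewrite ler_wpM2r// lerDl.
Qed.

Lemma Sym_nat k (j l : nat) f : (j <= l)%N -> Sym k l%:Z f -> Sym k j%:Z f.
Proof. by move=> /subnKC <-; rewrite PoszD; exact: Sym_le. Qed.

(** A derivative lowers the order by one and the last one still has order [1],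
    hence tends to [0]; the order at least [2] before gives differentiability
    at the origin with zero derivative. *)
Lemma Sym_Ck k f : f 0 = 0 -> Ck k punctured f -> Sym k k.+1%:Z f ->
  Ck k B1 f /\ forall s, (size s <= k)%N -> pderivs s f 0 = 0.
Proof.
elim: k f => [|k IH] f f0 Hf Sf.
  split=> [|[]//]; split=> // x /punctured_or0[->|Ux]; last exact: Ck_cont Hf Ux.
  exact: Sym_cont0 f0 Sf.
have d0 i : is_derive (0 : V) (e i) f 0 by exact: Sym_diff0 f0 (Sym_nat (j := 2) _ Sf).
have IHi i : Ck k B1 (pderiv i f) /\ forall s, (size s <= k)%N -> pderivs s (pderiv i f) 0 = 0.
  apply: IH; [exact: isd_val (d0 i)|exact: Ck_pderiv|].
  by have := Sym_pderiv i Sf; rewrite -[k.+2]addn1 PoszD addrK.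
split.
  split=> [x /punctured_or0[->|Ux]|i]; last 1 first.
  - split=> [x /punctured_or0[->|Ux]|]; first exact: isd_ex (d0 i).
      exact: isd_ex (Ck_der Hf i Ux).
    exact: (IHi i).1.
  - exact: Sym_cont0 f0 (Sym_nat (j := 1) _ Sf).
  - exact: Ck_cont Hf Ux.
case/lastP => [//|s i]; rewrite size_rcons pderivs_rcons => sk.
exact: (IHi i).2.
Qed.

Lemma mvt_segment f (d : V -> R) x v :
  (forall t : R, 0 <= t <= 1 -> is_derive (t *: v + x) v f (d (t *: v + x))) ->
  exists2 t : R, 0 <= t <= 1 & f (v + x) - f x = d (t *: v + x).
Proof.
move=> H; have H1 (t : R) : 0 <= t <= 1 -> is_derive t 1 (fun t : R => f (t *: v + x))
    (d (t *: v + x)).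
  by move=> t01; exact: (isd_line_at f x v t _).1 (H t t01).
have [||t] := @MVT R (fun t : R => f (t *: v + x)) (fun t : R => d (t *: v + x)) 0 1 ltr01.
- by move=> t; rewrite in_itv/= => /andP[t0 t1]; apply: H1; rewrite !ltW.
- by apply: continuous_in_subspaceT => t; rewrite inE/= in_itv/= => /H1/isd_cont.
rewrite in_itv/= => /andP[t0 t1]; rewrite scale1r scale0r add0r subr0 mulr1 => E.
by exists t => //; rewrite !ltW.
Qed.

Lemma B1_convex (t : R) x y : 0 <= t <= 1 -> B1 x -> B1 y -> B1 (t *: (x - y) + y).
Proof.
move=> /andP[t0 t1]; rewrite /B1 /= => x1 y1.
have -> : t *: (x - y) + y = t *: x + (1 - t) *: y.
  by rewrite scalerBr scalerBl scale1r addrA addrAC.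
rewrite -dotp_sqn dotpDl !dotpDr !dotpZl !dotpZr !dotp_sqn (dotpC y).
have CS : 2 * dotp x y <= sqn x + sqn y.
  have : 0 <= sqn (x - y) by exact: sqn_ge0.
  rewrite -dotp_sqn dotpDl !dotpDr !dotpNl (dotpC _ (- y)) (dotpC _ (- y)) !dotpNl.
  by rewrite !dotp_sqn (dotpC y); lra.
move: (dotp x y) (sqn x) (sqn y) x1 y1 CS => a b c b1 c1 CS.
have : t * (1 - t) * (2 * a) <= t * (1 - t) * (b + c).
  by rewrite ler_wpM2l// mulr_ge0// subr_ge0.
have [->|tn0] := eqVneq t 0; first by lra.
have tp : 0 < t by rewrite lt_def tn0.
have : t * b < t * 1 by rewrite ltr_pM2l.
have : (1 - t) * c <= (1 - t) * 1 by rewrite ler_wpM2l ?subr_ge0// ltW.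
by lra.
Qed.

Lemma rho_scale_le (t : R) x : `|t| <= 1 -> rho (t *: x) <= rho x.
Proof.
move=> t1; apply: ler_wsqrtr; rewrite -dotp_sqn dotpZl dotpZr dotp_sqn mulrA.
rewrite ler_piMl ?sqn_ge0// -expr2 -(real_normK (num_real t)).
by rewrite exprn_ile1.
Qed.

(** On segments avoiding the origin the mean value theorem applies; on a segment
    through the origin both endpoints are within [|x - y|] of it, where [f]
    vanishes. *)
Lemma Sym_lipschitz f : f 0 = 0 -> Ck 1 punctured f -> Sym 1 1 f ->
  [lipschitz f x | x in B1].
Proof.
move=> f0 Hf Sf; have [C C0 HC] := Sym_bound0 f0 Sf.
have /all_sig2[D D0 HD] : forall i, {D : R | 0 <= D & forall x, punctured x -> `|pderiv i f x| <= D}.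
  move=> i; apply: cid2; have [D D0 HD] := Sym_bound (Sym_pderiv i Sf).
  by exists D => // x /HD; rewrite subrr expr0z mulr1.
pose L := 2 * C * n%:R + \sum_i D i.
have sD0 : 0 <= \sum_i D i by apply: sumr_ge0 => i _; exact: D0.
have L0 : 0 <= L by rewrite addr_ge0// mulr_ge0// mulr_ge0.
exists L; split; first exact: num_real.
move=> M LM [x y] [/= x1 y1].
suff : `|f x - f y| <= L * `|x - y|.
  by move=> H; apply: le_trans H _; rewrite /= ler_wpM2r// ltW.
have [H|H] := pselect (forall t : R, 0 <= t <= 1 -> t *: (x - y) + y != 0).
  have H1 (t : R) : 0 <= t <= 1 -> punctured (t *: (x - y) + y).
    by move=> t01; split; [exact: H|exact: B1_convex].
  have [|t t01] := @mvt_segment f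
    (fun z => \sum_i (x - y) ord0 i * pderiv i f z) y (x - y).
    by move=> t /H1 Ut; exact: C1_dir open_punctured Hf Ut.
  rewrite subrK => ->; rewrite mulrDl; apply: (@le_trans _ _ ((\sum_i D i) * `|x - y|)).
    rewrite mulr_suml; apply: le_trans (ler_norm_sum _ _ _) _.
    apply: ler_sum => i _; rewrite normrM mulrC.
    by apply: ler_pM => //; [exact: HD (H1 t t01)|exact: norm_coord].
  by rewrite lerDr !mulr_ge0.
have [t [t01 tz]] : exists t : R, 0 <= t <= 1 /\ t *: (x - y) + y = 0.
  move/existsNP : H => [t /not_implyP[t01 /negP]]; rewrite negbK => /eqP tz.
  by exists t.
have Ey : y = (- t) *: (x - y) by apply/eqP; rewrite scaleNr -addr_eq0 addrC tz.
have Ex : x = (1 - t) *: (x - y).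
  by rewrite scalerBl scale1r -scaleNr -Ey subrK.
have rn := rho_le_norm (x - y).
have ry : rho y <= rho (x - y).
  by rewrite {1}Ey; apply: rho_scale_le; rewrite normrN ger0_norm; case/andP: t01.
have rx : rho x <= rho (x - y).
  rewrite {1}Ex; apply: rho_scale_le; case/andP: t01 => t0 t1.
  by rewrite ger0_norm ?subr_ge0// gerBl.
apply: le_trans (ler_normB _ _) _.
apply: (@le_trans _ _ (2 * C * (n%:R * `|x - y|))).
  have := HC x x1; have := HC y y1.
  have := ler_wpM2l C0 (le_trans rx rn); have := ler_wpM2l C0 (le_trans ry rn).
  by move: (n%:R * `|x - y|) => q; lra.
by rewrite mulrA ler_wpM2r// lerDl.
Qed.

(** [a = 0] unless [s] is empty. *)
Lemma pderivs_addC s f (c : R) : exists a : R,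
  pderivs s (fun x => f x + c) = fun x => pderivs s f x + a.
Proof.
elim: s => [|i s [a IH]]; first by exists c.
exists 0; rewrite /= IH; apply/funext => x; rewrite addr0 /pderiv /derive.
rewrite (_ : (fun h : R => h^-1 *: (((fun x0 => pderivs s f x0 + a) \o shift x)
    (h *: e i) - (pderivs s f x + a))) = (fun h : R => h^-1 *: ((pderivs s f \o shift x)
    (h *: e i) - pderivs s f x)))//.
by apply/funext => h /=; rewrite opprD addrACA subrr addr0.
Qed.

Lemma Ck_pderivs k s f U : Ck (k + size s) U f -> Ck k U (pderivs s f).
Proof.
elim/last_ind: s f => [|s i IH] f; first by rewrite addn0.
by rewrite size_rcons pderivs_rcons addnS => Hf; apply: IH; exact: Ck_pderiv.
Qed.

Lemma Sym_pderivs k (d : nat) s f : Sym (k + size s) (d + size s)%:Z f ->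
  Sym k d%:Z (pderivs s f).
Proof.
elim/last_ind: s f => [|s i IH] f; first by rewrite !addn0.
rewrite size_rcons pderivs_rcons !addnS => Sf; apply: IH.
by have := Sym_pderiv i Sf; rewrite -addn1 PoszD addrK.
Qed.

Lemma Sym_Ck1 k f : Ck k.+1 punctured f -> Sym k.+1 k.+1%:Z (fun x => f x - f 0) ->
  is_Ck1 k B1 f.
Proof.
move=> Hf Sf; pose h x := f x - f 0.
have h0 : h 0 = 0 by rewrite /h subrr.
have Hh : Ck k.+1 punctured h by exact: CkB open_punctured Hf (CkC _ _ open_punctured).
have fh : f = fun x => h x + f 0 by apply/funext => x; rewrite /h subrK.
have [Ch h0s] := Sym_Ck h0 (CkW Hh) (SymW Sf).
split.
  apply/is_CkP; rewrite fh; apply: CkD => //; [exact: open_B1|exact: CkC open_B1].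
move=> s sk; have [a Ea] := pderivs_addC s h (f 0).
have L : [lipschitz pderivs s h x | x in B1].
  apply: Sym_lipschitz; first by apply: h0s; rewrite sk.
    by apply: Ck_pderivs; rewrite sk add1n.
  by apply: (@Sym_pderivs 1 1 s h); rewrite sk add1n.
rewrite fh Ea; move: L => [M [Mr HM]]; exists M; split=> // N MN [x y] /= xy.
have := HM N MN (x, y) xy; rewrite /=.
by rewrite (_ : pderivs s h x + a - (pderivs s h y + a) = pderivs s h x - pderivs s h y)//; ring.
Qed.

End across_the_pole.

Section taylor.
Context {R : realType}.

(** Induction on [k] with [phi 1] in place of [phi 0], and the mean value theorem
    for the remainder. *)
Lemma taylor_peano k (phi : nat -> R -> R) (r : R) : 0 < r ->
  (forall j (t : R), (j < k)%N -> `|t| < r -> is_derive t 1 (phi j) (phi j.+1 t)) ->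
  {for 0, continuous (phi k)} -> (forall j, (j < k)%N -> phi j 0 = 0) ->
  forall d : R, 0 < d -> exists2 q, 0 < q & forall t, `|t| < q ->
    `|phi 0%N t - phi k 0 / k`!%:R * t ^+ k| <= d * `|t| ^+ k.
Proof.
move=> r0; elim: k phi => [|k IH] phi Hd ck z d d0.
  have [q q0 Hq] := cont_eps ck d0; exists q => // t tq.
  rewrite expr0 divr1 !mulr1; apply: ltW; apply: Hq; by rewrite subr0.
have [q q0 Hq] := IH (fun j => phi j.+1) (fun j t jk => Hd j.+1 t jk) ck
  (fun j jk => z j.+1 jk) d d0.
exists (Num.min q r) => [|t]; first by rewrite lt_min q0.
rewrite lt_min => /andP[tq tr]; pose L := phi k.+1 0 / (k.+1)`!%:R.
pose g (t : R) := phi 0%N t - L * t ^+ k.+1.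
pose dg (t : R) := phi 1%N t - phi k.+1 0 / k`!%:R * t ^+ k.
have dgE (s : R) : `|s| < r -> is_derive s 1 g (dg s).
  move=> sr; apply: is_derive_eq (isdB (Hd 0%N s (ltn0Sn k) sr)
    (isdMl L (isdX k.+1 (is_derive_id s 1)))) _.
  rewrite /dg /L /= factS natrM; congr (_ - _).
  have k0 : (k.+1)%:R != 0 :> R by rewrite pnatr_eq0.
  have f0 : (k`!)%:R != 0 :> R by rewrite pnatr_eq0 -lt0n fact_gt0.
  by move: ((k.+1)%:R : R) ((k`!)%:R : R) (s ^+ k) k0 f0 => a b c a0 b0; field; rewrite a0 b0.
have Es (s : R) : s *: (1 : R) + 0 = s by rewrite addr0 /GRing.scale /= mulr1.
have [|s st] := @mvt_dir R R g dg 0 1 t.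
  by move=> s st; rewrite Es; apply: dgE; exact: le_lt_trans tr.
rewrite !Es => E.
have g0 : g 0 = 0 by rewrite /g z// expr0n mulr0 subrr.
move: E; rewrite g0 subr0 -/(g t) => ->; rewrite normrM exprS mulrCA ler_wpM2l//.
apply: le_trans (Hq s (le_lt_trans st tq)) _; rewrite ler_wpM2l ?(ltW d0)//.
by rewrite lerXn2r ?nnegrE.
Qed.

End taylor.

Section odd_power.
Context {R : realType} {n : nat} (m : nat) (phi : nat -> R -> R) (M : nat -> R).
Local Notation V := 'rV[R]_n.
Local Notation e i := (delta_mx ord0 i : V).
Hypothesis m_gt0 : (0 < m)%N.
Hypothesis phi_le : forall j u, 0 <= u <= 1 -> `|phi j u| <= M j.
Hypothesis isd_phi : forall j (u : R), 0 <= u -> is_derive u 1 (phi j) (phi j.+1 u).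

Let K (x : V) : R := phi 0%N (rho x ^+ m).

Lemma phi_rho_0 : K 0 = phi 0%N 0.
Proof. by rewrite /K rho0 expr0n eqn0Ngt m_gt0. Qed.

Lemma Ck_phi_rho k : Ck k punctured K.
Proof.
have Hr : Ck k punctured (@rho R n).
  apply: (@eq_Ck _ _ _ _ (fun x => sqn x * w (sqn x))); first exact: open_punctured.
    by move=> x Ux; rewrite /w -{1}rho_sqr expr2 mulfK// gt_eqF// rho_gt0.
  apply: CkM open_punctured (Ck_sqn _ open_punctured) _.
  apply: Ck_comp open_punctured smooth1_w _ (Ck_sqn _ open_punctured) => x Ux.
  by rewrite /= sqn_gt0; exact: Ux.1.
apply: (@Ck_comp _ _ _ _ [set u : R | 0 <= u]) (CkX m open_punctured Hr); first exact: open_punctured.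
  by exists phi.
by move=> x _; rewrite /= exprn_ge0// rho_ge0.
Qed.

Lemma phi_rho_Ck1 k : m = k.+1 -> is_Ck1 k B1 K.
Proof.
move=> mk; apply: Sym_Ck1; first exact: Ck_phi_rho.
by rewrite phi_rho_0 -{2}mk; exact: Sym_phi_sub phi_le isd_phi k.+1.
Qed.

(** On a line through the origin [K - K 0] is [phi' 0 * |t| ^ m + o (|t| ^ m)],
    while a [C ^ m] function whose first [m - 1] derivatives vanish at [0] is
    [c t ^ m + o (|t| ^ m)]. For [m] odd, [t] and [- t] give [c = phi' 0] and
    [c = - phi' 0]. *)
Lemma phi_rho_not_Ck (i : 'I_n) (U : set V) : odd m -> phi 1%N 0 != 0 -> open U -> U 0 ->
  ~ Ck m U K.
Proof.
move=> m_odd d1 oU U0' HK; pose h x := K x - phi 0%N 0.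
have Hh : Ck m U h by exact: CkB oU HK (CkC _ _ oU).
have h0 : h 0 = 0 by rewrite /h phi_rho_0 subrr.
have [l ml] : exists l, m = l.+1 by exists m.-1; rewrite prednK.
have hs s : (size s < m)%N -> pderivs s h 0 = 0.
  rewrite ml ltnS; apply: (Sym_Ck h0 _ _).2.
    exact: CkB open_punctured (Ck_phi_rho l) (CkC _ _ open_punctured).
  by rewrite -ml; exact: Sym_phi_sub phi_le isd_phi l.
have [r r0 Ur] := open_eps oU U0'.
pose psi j (t : R) := pderivs (nseq j i) h (t *: e i + 0).
have Ut (t : R) : `|t| < r -> U (t *: e i + 0).
  move=> tr; apply: Ur; rewrite addr0 subr0 normrZ; apply: le_lt_trans tr.
  by rewrite ler_piMr// norm_e.
have [H1 H2] := (is_CkP m U h).2 Hh.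
have dpsi j (t : R) : (j < m)%N -> `|t| < r -> is_derive t 1 (psi j) (psi j.+1 t).
  move=> jm tr; apply: (isd_line_at _ _ _ _ _).1; apply: derivableP.
  by apply: H1; [rewrite size_nseq|exact: Ut].
have cpsi : {for 0, continuous (psi m)}.
  apply: (@cont_comp _ _ _ (fun t : R => t *: e i + 0) (pderivs (nseq m i) h)).
    by move=> P; apply: (@cvgD _ _ _ _ _ (fun t : R => t *: e i) (fun=> 0));
      [exact: scalel_continuous|exact: cvg_cst].
  by rewrite scale0r add0r; apply: H2; rewrite ?size_nseq.
have psi0 j : (j < m)%N -> psi j 0 = 0.
  by move=> jm; rewrite /psi scale0r add0r; apply: hs; rewrite size_nseq.
pose d := `|phi 1%N 0| / 4.
have d0 : 0 < d by rewrite divr_gt0 ?normr_gt0.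
have [q q0 Hq] := taylor_peano r0 dpsi cpsi psi0 d0.
have [q' q'0 Hq'] := isd_eps (isd_phi 0%N (lexx 0)) d0.
pose t := Num.min (1 / 2) (Num.min (q / 2) (q' / 2)).
have t0 : 0 < t by rewrite !lt_min !divr_gt0.
have t1 : t <= 1 / 2 by rewrite /t ge_min lexx.
have tq : t < q.
  by rewrite /t !gt_min; apply/orP; right; apply/orP; left; lra.
have tq' : t < q'.
  by rewrite /t !gt_min; apply/orP; right; apply/orP; right; lra.
have tm0 : 0 < t ^+ m by rewrite exprn_gt0.
have tl1 : t <= 1 by apply: le_trans t1 _; lra.
have tm : t ^+ m <= t ^+ 1 := ler_wiXn2l (ltW t0) tl1 m_gt0.
have psiE (s : R) : psi 0%N s = phi 0%N (`|s| ^+ m) - phi 0%N 0.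
  by rewrite /psi /= /h /K addr0 rhoZ.
set c := psi m 0 / _ in Hq.
have P1 := Hq t; have P2 := Hq (- t).
rewrite !psiE normrN (gtr0_norm t0) exprNn -signr_odd m_odd expr1 in P1 P2.
have := Hq' (t ^+ m); rewrite (gtr0_norm tm0) addr0 /GRing.scale /= mulr1.
move=> /(_ (le_lt_trans tm tq')) P3.
move: (P1 tq) (P2 tq) P3; set A := _ - phi 0%N 0.
move: (t ^+ m) tm0 A => u u0 A; rewrite mulN1r mulrN opprK => Q1 Q2 Q3.
have Q4 : `|u * phi 1%N 0| <= 2 * (d * u).
  move: Q1 Q2 Q3; rewrite !ler_norml => /andP[? ?] /andP[? ?] /andP[? ?].
  by apply/andP; split; lra.
move: Q4; rewrite normrM (gtr0_norm u0) /d; have := normr_gt0 (phi 1%N 0).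
rewrite d1 => p0; have := mulr_gt0 u0 p0; move: `|phi 1%N 0| => p; lra.
Qed.

End odd_power.

(** * The gradient of [b] near the pole *)

Section power_profile.
Context {R : realType} (p : R).
Hypothesis p_le0 : p <= 0.

(** [pphi j] is the [j]-th derivative of [(1 + u) ^ p]. *)
Fixpoint pcoef (j : nat) : R := if j is j'.+1 then pcoef j' * (p - j'%:R) else 1.

Definition pphi (j : nat) (u : R) : R := pcoef j * (1 + u) `^ (p - j%:R).

Lemma pphi_le j u : 0 <= u <= 1 -> `|pphi j u| <= `|pcoef j|.
Proof.
move=> /andP[u0 _]; rewrite /pphi normrM ler_piMr// ger0_norm ?powR_ge0//.
rewrite -[leRHS](powRr0 (1 + u)); apply: ler_powR; first by rewrite lerDl.
by rewrite subr_le0 (le_trans p_le0).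
Qed.

Lemma isd_pphi j (u : R) : 0 <= u -> is_derive u 1 (pphi j) (pphi j.+1 u).
Proof.
move=> u0; have u1 : 0 < 1 + u by rewrite ltr_pwDl.
have d1 : is_derive u 1 (fun u : R => 1 + u) (0 + 1).
  exact: isdD (isdC 1 _ _) (is_derive_id u 1).
have H := isd_comp (phi := fun y => y `^ (p - j%:R)) (f := fun u : R => 1 + u)
  (is_derive1_powR (p - j%:R) u1) d1.
apply: is_derive_eq (isdMl (pcoef j) H) _.
rewrite /pphi /= -natr1 opprD addrA; ring.
Qed.

End power_profile.

Section final.
Context {R : realType} (m : nat).
Hypothesis m_gt0 : (0 < m)%N.
Local Notation n := m.+2.
Local Notation V := 'rV[R]_n.
Local Notation e i := (delta_mx ord0 i : V).
Local Notation gm := (@gm R m).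
Local Notation Gf := (@Gf R m).

(* The exponent of [G] in [grad b], [b] being [G ^ (- 1 / m)]. *)
Let q : R := - m%:R^-1 - 1.

Lemma normsq_gradient_B1 (f : V -> R) x : B1 x ->
  normsq_gradient gm f x = \sum_i pderiv i f x ^+ 2.
Proof.
move=> x1; have k0 : kx x = 0 by rewrite /kx kf_le1// ltW.
have gE : gradient gm f x = \row_i pderiv i f x.
  apply/rowP => i; rewrite !mxE.
  transitivity (\sum_j (j == i)%:R * pderiv j f x); last exact: sum_delta.
  apply: eq_bigr => j _.
  by rewrite invmx_gkE ?S_neq0// k0 !mul0r subr0 eq_sym.
rewrite /normsq_gradient ip_gm k0 !mul0r addr0 dotp_sqn gE.
by apply: eq_bigr => i _; rewrite mxE.
Qed.

Lemma eq_normsq_gradient (g : V -> 'M[R]_n) (f h : V -> R) (U : set V) x :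
  open U -> (forall z, U z -> f z = h z) -> U x ->
  normsq_gradient g f x = normsq_gradient g h x.
Proof.
move=> oU fh Ux; rewrite /normsq_gradient.
suff -> : gradient g f x = gradient g h x by [].
apply/rowP => i; rewrite !mxE; apply: eq_bigr => j _; congr (_ * _).
by apply: pderiv_eq; exact: near_open oU Ux fh.
Qed.

Lemma pderiv_green_b i x : punctured x ->
  pderiv i (green_b Gf) x = Gf x `^ q * w (sqn x) ^+ n * x ord0 i.
Proof.
move=> Ux; have x0 : x != 0 := Ux.1; have G0 := Gf_gt0 x0.
have H := isd_comp (is_derive1_powR ((2 - n%:R)^-1) G0) (isd_Gf m_gt0 i x0).
rewrite /pderiv (isd_val H).
have -> : sx x = 1 by rewrite /sx sf_le1// ltW//; exact: Ux.2.
have E : (2 - n%:R : R)^-1 = - m%:R^-1.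
  by rewrite -[n]addn2 natrD opprD addrC subrK invrN.
rewrite E -/q; have m0 : (m%:R : R) != 0 by rewrite pnatr_eq0 -lt0n.
by move: (Gf x `^ q) (w _ ^+ n) (m%:R : R) m0 => a b c c0; field.
Qed.

(** Where [g] is Euclidean, [G = rho ^ -m + 1], hence
    [|grad b|^2 = (1 + rho ^ m) ^ (- 2 (n - 1) / m)]. *)
Lemma normsq_green_b x : punctured x ->
  normsq_gradient gm (green_b Gf) x = pphi (q * 2) 0 (rho x ^+ m).
Proof.
move=> Ux; have x0 : x != 0 := Ux.1; have x1 : sqn x < 1 := Ux.2.
have r0 := rho_gt0 Ux; have wr : w (sqn x) = (rho x)^-1 by [].
rewrite normsq_gradient_B1//.
rewrite (eq_bigr _ (fun i _ => congr1 (fun a => a ^+ 2) (pderiv_green_b i Ux))).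
under eq_bigr do rewrite exprMn.
rewrite -mulr_sumr -/(sqn x) wr -rho_sqr.
have GE : Gf x = (rho x)^-1 ^+ m * (1 + rho x ^+ m).
  rewrite /Gf Pf_le1 ?(ltW x1)// wr mulrDr mulr1; congr (_ + _).
  by rewrite -exprMn mulVf ?expr1n// gt_eqF.
have rm0 : 0 <= rho x ^+ m by rewrite exprn_ge0// ltW.
rewrite GE powRM ?exprn_ge0 ?invr_ge0 ?(ltW r0)//; last by rewrite addr_ge0.
have -> : ((rho x)^-1 ^+ m) `^ q = rho x ^+ m.+1.
  have -> : (rho x)^-1 ^+ m = (rho x)^-1 `^ m%:R.
    by rewrite powR_mulrn// invr_ge0 ltW.
  rewrite -powRrM.
  have -> : m%:R * q = - m.+1%:R.
    rewrite /q mulrBr mulrN mulfV ?pnatr_eq0 -?lt0n// mulr1 -natr1; ring.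
  by rewrite powRN powR_mulrn ?invr_ge0 ?(ltW r0)// exprVn invrK.
have -> : rho x ^+ m.+1 * (1 + rho x ^+ m) `^ q * (rho x)^-1 ^+ n =
    (1 + rho x ^+ m) `^ q * (rho x)^-1.
  rewrite [_^-1 ^+ n]exprSr mulrAC [_ * (_ * _)]mulrA -exprMn mulfV ?gt_eqF//.
  by rewrite expr1n mul1r mulrC.
rewrite -exprMn divfK ?gt_eqF// /pphi /= mul1r subr0 powRrM powR_mulrn//.
exact: powR_ge0.
Qed.

Let q2_le0 : q * 2 <= 0.
Proof.
rewrite pmulr_lle0// /q -opprD oppr_le0 addr_ge0// invr_ge0 ler0n//.
Qed.

Lemma eq_pderivs (f g : V -> R) U s x : open U -> (forall z, U z -> f z = g z) -> U x ->
  pderivs s f x = pderivs s g x.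
Proof.
move=> oU fg; elim: s x => [|i s IH] x Ux /=; first exact: fg.
by apply: pderiv_eq; exact: near_open oU Ux IH.
Qed.

Lemma normsq_green_b_regularity (G : V -> R) : odd m -> minimal_positive_green gm 0 G ->
  exists F, is_extension_normsq_grad_b gm 0 G F /\
    (exists U : set V, [/\ open U, U 0 & is_Ck1 m.-1 U F]) /\
    (forall U : set V, open U -> U 0 -> ~ is_Ck m U F).
Proof.
move=> m_odd mG; pose K (x : V) := pphi (q * 2) 0 (rho x ^+ m).
have le := pphi_le q2_le0; have der := isd_pphi (q * 2).
pose F x := if x == 0 then 1 else normsq_gradient gm (green_b G) x.
have FK x : B1 x -> F x = K x.
  move=> x1; rewrite /F; case: eqVneq => [->|x0].
    by rewrite /K rho0 expr0n eqn0Ngt m_gt0 /pphi /= addr0 powR1 mulr1.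
  transitivity (normsq_gradient gm (green_b Gf) x); last exact: normsq_green_b.
  apply: (eq_normsq_gradient _ (@open_U0 R n) _ x0) => z z0.
  by rewrite /green_b (minimal_unique m_gt0 mG z0).
have K1 : is_Ck1 m.-1 B1 K.
  by apply: phi_rho_Ck1 le der _ _ => //; rewrite prednK.
have oB := @open_B1 R n; have F1 : is_Ck1 m.-1 B1 F.
  split.
    apply/is_CkP; apply: (@eq_Ck _ _ _ _ K) => //; first by move=> x /FK.
    by apply/is_CkP; exact: K1.1.
  move=> s sm; have [M [Mr HM]] := K1.2 s sm; exists M; split=> // N MN [x y] /= xy.
  have := HM N MN (x, y) xy; rewrite /=.
  by rewrite !(eq_pderivs s oB FK) //; [exact: xy.2|exact: xy.1].
exists F; split; last split.
- split=> [x x0|]; first by rewrite /F (negbTE x0).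
  have := Ck_cont ((is_CkP _ _ _).1 F1.1) (@B10 R n); exact.
- by exists B1; split=> //; exact: B10.
- move=> U oU U0' HF.
  have HK : Ck m (U `&` B1) K.
    apply: (@eq_Ck _ _ _ _ F); [exact: openI|by move=> x [_ /FK]|].
    by apply: (CkS (U := U)); [move=> x []|exact/is_CkP].
  apply: (phi_rho_not_Ck m_gt0 le der (ord0 : 'I_n) m_odd _ _ _ HK).
  + rewrite /pphi /= addr0 powR1 mulr1 mul1r subr0 mulf_neq0 ?pnatr_eq0//.
    by rewrite /q -opprD oppr_eq0 gt_eqF// ltr_wpDl// invr_ge0 ler0n.
  + exact: openI.
  + by split=> //; exact: B10.
Qed.

End final.

Theorem corollary6p2 (R : realType) (n : nat) (n_ge3 : (3 <= n)%N)
    (n_odd : odd n) :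
  exists (p : 'rV[R]_n) (g : 'rV[R]_n -> 'M[R]_n),
    [/\ riemannian_metric g, complete_metric g, ~ flat g & nonneg_sectional g]
    /\ (\forall x \near p, g x = euclidean_metric R n x)
    /\ (exists G, minimal_positive_green g p G)
    /\ (forall G, minimal_positive_green g p G ->
          exists F, is_extension_normsq_grad_b g p G F
            /\ (exists U : set 'rV[R]_n,
                  [/\ open U, U p & is_Ck1 (n - 3) U F])
            /\ (forall U : set 'rV[R]_n, open U -> U p ->
                  ~ is_Ck (n - 2) U F))
    /\ ~ isometric g (euclidean_metric R n).
Proof.
case: n n_ge3 n_odd => [|[|[|k]]]// _ n_odd.
have k_odd : odd k.+1 by move: n_odd; rewrite /= negbK.
exists 0, (@gm R k.+1); split; last split; last split; last split.
- split; [exact: gm_riemannian|exact: gm_complete|exact: gm_not_flat|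
    exact: gm_nonneg_sectional].
- exact: gm_euclidean_near.
- by exists (@Gf R k.+1); exact: Gf_minimal.
- move=> G mG; have -> : (k.+3 - 3)%N = k by rewrite !subSS subn0.
  rewrite subn2 /=.
  exact: (@normsq_green_b_regularity R k.+1 (ltn0Sn k) G k_odd mG).
- exact: (gm_not_isometric (ltn0Sn k)).
Qed.
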